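(* Let $(X,d)$ be a compact metric space and $f:X\to X$ a continuous map. Suppose that $f$ has positive topological entropy and that the entropy map $\mathcal{M}\to[0,\infty]$, $\mu\mapsto h_\mu(f)$, is upper semi-continuous. Fix an integer $m\ge 1$. (a) Let $\{\varphi_k\}_{k\ge 1}$ be a dense sequence in $C(X,\mathbb{R})$ and let $\Phi=(\varphi_1,\dots,\varphi_m):X\to\mathbb{R}^m$. Suppose that $\mathcal{M}_{per}$ is dense in $\mathcal{M}_E$ or, more generally, that the potential $\Phi$ is good. If $w$ is in the relative interior of ${\rm Rot}(\Phi)$ (which is the interior of ${\rm Rot}(\Phi)$ when that interior is non-empty), then $H(w)>0$ and $h(\mathcal{M}_\Phi(w))=[0,H(w)]$. (b) Let $\Phi:X\to\mathbb{R}^m$ be a continuous potential and let $w\in{\rm Rot}(\Phi)$ be a rotation vector which does not belong to the relative interior of ${\rm Rot}(\Phi)$. Then one of the following four possibilities holds: (i) $h(\mathcal{M}_\Phi(w))=\{H(w)\}$; (ii) $h(\mathcal{M}_\Phi(w))=[x,H(w)]$ for some $0<x<H(w)$; (iii) $h(\mathcal{M}_\Phi(w))=[0,H(w)]$; (iv) $h(\mathcal{M}_\Phi(w))=(x,H(w)]$ for some $0\le x<H(w)$.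
   Context: $C(X,\mathbb{R})$ is the space of continuous functions $X\to\mathbb{R}$ with the supremum norm. $\mathcal{M}$ is the set of $f$-invariant Borel probability measures on $X$ with the weak$^\ast$ topology, and $\mathcal{M}_E\subset\mathcal{M}$ is the subset of ergodic measures. A periodic point measure is a measure $\mu\in\mathcal{M}$ supported on the (finite) orbit of a periodic point and invariant, with that single orbit as support; $\mathcal{M}_{per}$ is the set of periodic point measures. $h_\mu(f)$ denotes the measure-theoretic entropy of $f$ with respect to $\mu$, and for $\mathcal{M}'\subset\mathcal{M}$ we write $h(\mathcal{M}')=\{h_\mu(f):\mu\in\mathcal{M}'\}$. For a continuous $\Phi=(\varphi_1,\dots,\varphi_m):X\to\mathbb{R}^m$ and $\mu\in\mathcal{M}$, the rotation vector is ${\rm rv}(\mu)=(\int_X\varphi_1\,d\mu,\dots,\int_X\varphi_m\,d\mu)$; the rotation set is ${\rm Rot}(\Phi)=\{{\rm rv}(\mu):\mu\in\mathcal{M}\}$. For $w\in{\rm Rot}(\Phi)$, the rotation class is $\mathcal{M}_\Phi(w)=\{\mu\in\mathcal{M}:{\rm rv}(\mu)=w\}$ and the localized entropy is $H(w)=\sup\{h_\mu(f):\mu\in\mathcal{M}_\Phi(w)\}$. The set $h(\mathcal{M}_\Phi(w))$ is called the entropy spectrum of the rotation class. The relative interior ${\rm ri}(K)$ of $K\subset\mathbb{R}^m$ is its interior relative to the smallest affine subspace of $\mathbb{R}^m$ containing $K$. A vector $w\in{\rm Rot}(\Phi)$ is a periodic point rotation vector if $\mathcal{M}_\Phi(w)$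 contains a periodic point measure. The potential $\Phi$ is good if every rotation vector in the relative interior of ${\rm Rot}(\Phi)$ can be written as a convex combination of periodic point rotation vectors. *)

(* Defs.v *)
From HB Require Import structures.
From mathcomp Require Import all_boot all_order all_algebra.
From mathcomp Require Import finmap.
From mathcomp Require Import all_classical all_reals all_analysis.

Set Implicit Arguments.
Unset Strict Implicit.
Unset Printing Implicit Defensive.

Import Order.TTheory GRing.Theory Num.Theory.
Import numFieldNormedType.Exports.

Local Open Scope classical_set_scope.
Local Open Scope ring_scope.

(* Measurable types are pointed in the library, so the metric spaces
   considered here carry a base point, i.e. they are nonempty. *)
#[short(type="pmetricType")]
HB.structure Definition PointedMetric (R : numDomainType) :=
  {X of Pointed X & Metric R X}.

Definition borel (R : realType) (X : pmetricType R) :=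
  g_sigma_algebraType (@open X).

Section WeakStar.
Variables (R : realType) (X : pmetricType R).

Definition integral_map (mu : probability (borel X) R) :
    {ptws continuousType X R -> R} :=
  fun phi => (\int[mu]_x phi x)%R.

(* The weak* topology: the coarsest one that makes mu |-> \int[mu]_x phi x
   continuous for every continuous phi : X -> R. *)
HB.instance Definition _ := Topological.copy (probability (borel X) R)
  (initial_topology integral_map).

End WeakStar.

Section ContinuousFunctions.
Variables (R : realType) (X : topologicalType).

Definition supnorm (g : X -> R) : R := sup (range (fun x => `|g x|)).

Definition dense_sequence (phi : nat -> continuousType X R) :=
  forall (g : continuousType X R) (e : R), 0 < e ->
    exists k, supnorm (fun x => g x - phi k x) < e.

End ContinuousFunctions.

Section UpperSemicontinuity.
Variables (R : realType) (T : topologicalType).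

Definition upper_semicontinuous_on (A : set T) (h : T -> \bar R) :=
  forall x, A x -> forall a : R, (h x < a%:E)%E ->
    \forall y \near within A (nbhs x), (h y < a%:E)%E.

End UpperSemicontinuity.

Section RelativeInterior.
Variables (R : realType) (m : nat).
Implicit Types K A : set 'rV[R]_m.

Definition affine_subspace A :=
  forall (x y : 'rV[R]_m) (t : R), A x -> A y -> A (t *: x + (1 - t) *: y).

Definition affine_hull K : set 'rV[R]_m :=
  \bigcap_(A in [set A | affine_subspace A /\ K `<=` A]) A.

(* The second clause says that w has a neighbourhood U with
   U `&` affine_hull K `<=` K. *)
Definition relative_interior K : set 'rV[R]_m :=
  [set w | affine_hull K w /\ within (affine_hull K) (nbhs w) K].

Definition convex_combinations K : set 'rV[R]_m :=
  [set w | exists (k : nat) (v : 'I_k -> 'rV[R]_m) (c : 'I_k -> R),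
    [/\ forall i, K (v i), forall i, 0 <= c i, \sum_i c i = 1
      & w = \sum_i c i *: v i]].

End RelativeInterior.

Section TopologicalEntropy.
Variables (R : realType) (X : metricType R) (f : X -> X).

Definition bowen_dist (n : nat) (x y : X) : R :=
  \big[Order.max/0]_(i < n) mdist (iter i f x) (iter i f y).

Definition separated (n : nat) (e : R) (A : {fset X}) :=
  forall x y, x \in A -> y \in A -> x != y -> e < bowen_dist n x y.

Definition separated_number (n : nat) (e : R) : \bar R :=
  ereal_sup [set (#|` A|%:R)%:E | A in separated n e].

(* Bowen's definition of topological entropy, by (n, e)-separated sets. *)
Definition topological_entropy : \bar R :=
  lim (limn_esup (fun n => (n%:R^-1)%:E * lne (separated_number n e))%E
         @[e --> (0 : R)^'+]).

End TopologicalEntropy.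

Section MetricEntropy.
Variables (R : realType) (X : pmetricType R) (f : X -> X).

Definition measurable_partition (k : nat) (P : 'I_k -> set (borel X)) :=
  [/\ forall i, measurable (P i), trivIset setT P & \bigcup_i P i = setT].

(* The join of P, f^-1 P, ..., f^-(n-1) P; its cells are indexed by the words
   of length n over 'I_k and may be empty. *)
Definition refined_partition (k : nat) (P : 'I_k -> set (borel X)) (n : nat)
    (w : {ffun 'I_n -> 'I_k}) : set (borel X) :=
  \bigcap_(i in [set: 'I_n]) (iter i f @^-1` P (w i)).

(* Null cells contribute 0. *)
Definition shannon_entropy (mu : probability (borel X) R) (I : finType)
    (Q : I -> set (borel X)) : R :=
  - \sum_(i : I) fine (mu (Q i)) * ln (fine (mu (Q i))).

Definition partition_entropy (mu : probability (borel X) R) (k : nat)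
    (P : 'I_k -> set (borel X)) : R :=
  limn (fun n => n%:R^-1 * shannon_entropy mu (@refined_partition k P n)).

Definition entropy (mu : probability (borel X) R) : \bar R :=
  ereal_sup [set h | exists (k : nat) (P : 'I_k -> set (borel X)),
    measurable_partition P /\ h = (partition_entropy mu P)%:E].

End MetricEntropy.

Section InvariantMeasures.
Variables (R : realType) (X : pmetricType R) (f : X -> X).

Definition invariant_measures : set (probability (borel X) R) :=
  [set mu | forall A : set (borel X), measurable A -> mu (f @^-1` A) = mu A].

Definition ergodic_measures : set (probability (borel X) R) :=
  [set mu | invariant_measures mu /\
    forall A : set (borel X), measurable A -> f @^-1` A = A ->
      mu A = 0%E \/ mu A = 1%E].

Definition orbit (x : X) : set X := range (fun n => iter n f x).

Definition msupport (mu : probability (borel X) R) : set X :=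
  [set x | forall U : set X, open U -> U x -> (0 < mu U)%E].

Definition periodic_point (x : X) := exists2 n, (0 < n)%N & iter n f x = x.

Definition periodic_measures : set (probability (borel X) R) :=
  [set mu | invariant_measures mu /\ exists x,
    [/\ periodic_point x, mu (orbit x) = 1%E & msupport mu = orbit x]].

End InvariantMeasures.

Section Rotation.
Variables (R : realType) (X : pmetricType R) (f : X -> X).
Variables (m : nat) (Phi : X -> 'rV[R]_m).

Definition rotation_vector (mu : probability (borel X) R) : 'rV[R]_m :=
  \row_(i < m) (\int[mu]_x Phi x ord0 i)%R.

Definition rotation_set : set 'rV[R]_m :=
  rotation_vector @` invariant_measures f.

Definition rotation_class (w : 'rV[R]_m) : set (probability (borel X) R) :=
  [set mu | invariant_measures f mu /\ rotation_vector mu = w].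

Definition entropy_spectrum (w : 'rV[R]_m) : set (\bar R) :=
  entropy f @` rotation_class w.

Definition localized_entropy (w : 'rV[R]_m) : \bar R :=
  ereal_sup (entropy_spectrum w).

Definition periodic_rotation_vectors : set 'rV[R]_m :=
  [set w | rotation_set w /\
    exists2 mu, rotation_class w mu & periodic_measures f mu].

Definition good :=
  relative_interior rotation_set `<=`
    convex_combinations periodic_rotation_vectors.

End Rotation.

(* Main.v *)
(* The spectrum of a rotation class is an interval because entropy is affine on
   invariant measures, and it contains its supremum because entropy is upper
   semicontinuous and rotation classes are weak* compact (ultralimits of positive
   functionals, together with the Riesz representation theorem); this gives (b).
   For (a) the spectrum must contain a positive value and 0. Misiurewicz's
   argument turns positive topological entropy into an invariant measure mu of
   positive entropy, and a point w of the relative interior lies strictly between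
   rv(mu) and some other point of Rot(Phi), so a mixture of mu with a measure over
   that point has rotation vector w and positive entropy. The rotation vectors of
   zero-entropy measures form a convex set C; if periodic measures are dense among
   the ergodic ones then C is dense in Rot(Phi), since each linear functional is
   maximized over Rot(Phi) at an ergodic measure, and a dense convex subset
   contains the relative interior. *)
From HB Require Import structures.
Require Import Defs.
From mathcomp Require Import all_boot all_order all_algebra.
From mathcomp Require Import all_classical all_reals all_analysis.
From mathcomp Require Import measurable_realfun zify ring lra.
Set Implicit Arguments.
Unset Strict Implicit.
Unset Printing Implicit Defensive.
Import Order.TTheory GRing.Theory Num.Theory.
Import numFieldNormedType.Exports.
Local Open Scope classical_set_scope.
Local Open Scope ring_scope.

(** * Shannon entropy of finite distributions *)

(** All limits of measures are taken along one fixed free ultrafilter on the naturals. Every bounded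
    real sequence converges along it, so limits exist test function by test function, without
    diagonal extraction or metrizability of the space of measures. Upper semicontinuity, which is
    given for the weak* topology, applies because such a limit is also a topological limit along the
    same ultrafilter.

    Affinity of entropy is inherited from finite distributions: Shannon entropy is concave, and
    convex up to the entropy of the pair [(t, 1 - t)], a constant that disappears after division by
    the word length.

    Entropy may be infinite. Upper semicontinuity then makes it infinite for every invariant measure
    as soon as it is so for one, hence a spectrum cannot jump from a finite value to [+oo].

    In Misiurewicz's argument the obstacle is that indicators of partition cells are not continuous;
    the cells are therefore cut out of balls whose bounding spheres are null. Ergodic maximizers are
    produced directly, by breaking ties along the dense sequence, and not through an ergodic
    decomposition. *)

Section FiniteEntropy.
Variable R : realType.

Definition pushd (T I : finType) (p : T -> R) (Z : T -> I) (i : I) : R :=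
  \sum_(t | Z t == i) p t.

Definition Hent (I : finType) (p : I -> R) : R := - \sum_i p i * ln (p i).

Definition distr (I : finType) (p : I -> R) :=
  (forall i, 0 <= p i) /\ \sum_i p i = 1.

Lemma ln_le_sub1 (x : R) : 0 < x -> ln x <= x - 1.
Proof. by move=> x0; have := @le_ln1Dx R (x - 1); rewrite addrCA subrr addr0; apply; lra. Qed.

(** This is [ln x <= x - 1] at [x = q / p]. The condition on zeros matters because [ln 0] is [0]
    here: a vanishing [q] would otherwise cost nothing. *)
Lemma gibbs_term (p q : R) : 0 <= p -> 0 <= q -> (q = 0 -> p = 0) ->
  p * ln q - p * ln p <= q - p.
Proof.
move=> p0 q0 qp; have [->|pn0] := eqVneq p 0; first by rewrite !mul0r subrr subr0.
have pp : 0 < p by rewrite lt_neqAle eq_sym pn0.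
have qq : 0 < q.
  rewrite lt_neqAle eq_sym q0 andbT; apply/eqP => /qp /eqP; exact/negP.
rewrite -mulrBr -ln_div// (le_trans (ler_wpM2l p0 (ln_le_sub1 _)))//.
  by rewrite divr_gt0.
by rewrite mulrBr mulr1 mulrCA divff// mulr1.
Qed.

(** Gibbs' inequality, the common source of the support bound, of subadditivity and of concavity
    below, each for its own reference weight [q]. Only total masses are compared, so [q] may have
    mass below that of [p]. *)
Lemma gibbs (I : finType) (p q : I -> R) : (forall i, 0 <= p i) ->
  (forall i, 0 <= q i) -> (forall i, q i = 0 -> p i = 0) ->
  \sum_i q i <= \sum_i p i -> Hent p <= - \sum_i p i * ln (q i).
Proof.
move=> p0 q0 qp s; rewrite /Hent lerN2 -subr_le0 -sumrB.
apply: (@le_trans _ _ (\sum_i (q i - p i))).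
  by apply: ler_sum => i _; exact: (gibbs_term (p0 i) (q0 i) (@qp i)).
by rewrite sumrB subr_le0.
Qed.

Lemma distr_le1 (I : finType) (p : I -> R) : distr p -> forall i, p i <= 1.
Proof.
by move=> [p0 <-] i; rewrite (bigD1 i)//= lerDl sumr_ge0.
Qed.

Lemma Hent_ge0 (I : finType) (p : I -> R) : distr p -> 0 <= Hent p.
Proof.
move=> dp; rewrite oppr_ge0 sumr_le0// => i _.
rewrite mulr_ge0_le0 ?(dp.1)// ln_le0// distr_le1//.
Qed.

(** Gibbs against the weight [1/n] on [A], whose total mass [#|A| / n] may be smaller than 1. *)
Lemma Hent_supp_le (I : finType) (p : I -> R) (A : {pred I}) (n : nat) :
  distr p -> (forall i, i \notin A -> p i = 0) -> (#|A| <= n)%N ->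
  Hent p <= ln n%:R.
Proof.
move=> [p0 p1] pA An.
have n0 : (0 < n)%N.
  rewrite lt0n; apply/eqP => n0; move: An; rewrite n0 leqn0 => /eqP/card0_eq A0.
  have /eqP := p1; rewrite big1 1?eq_sym ?oner_eq0// => i _.
  by apply: pA; rewrite A0.
pose q i : R := if i \in A then n%:R^-1 else 0.
have nR : (0 : R) < n%:R by rewrite ltr0n.
apply: (le_trans (@gibbs I p q p0 _ _ _)).
- by move=> i; rewrite /q; case: ifP => // _; rewrite invr_ge0 ltW.
- move=> i; rewrite /q; case: ifPn => [_ /eqP|iA _]; last exact: pA.
  by rewrite invr_eq0 (gt_eqF nR).
- rewrite p1 /q -big_mkcond/= sumr_const -[leLHS]mulr_natl ler_pdivrMr// mul1r.
  by rewrite ler_nat.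
- rewrite -sumrN (eq_bigr (fun i => p i * ln n%:R)).
    by rewrite -mulr_suml p1 mul1r.
  move=> i _; rewrite /q; case: ifPn => iA; last by rewrite pA// !mul0r oppr0.
  by rewrite lnV// mulrN opprK.
Qed.

Lemma Hent_le_card (I : finType) (p : I -> R) :
  distr p -> Hent p <= ln #|I|%:R.
Proof. by move=> dp; apply: (@Hent_supp_le _ _ I). Qed.

Lemma sum_pushd (T I : finType) (p : T -> R) (Z : T -> I) (F : I -> R) :
  \sum_i pushd p Z i * F i = \sum_t p t * F (Z t).
Proof.
rewrite (partition_big Z predT)//=; apply: eq_bigr => i _.
by rewrite mulr_suml; apply: eq_bigr => t /eqP ->.
Qed.

Lemma distr_pushd (T I : finType) (p : T -> R) (Z : T -> I) :
  distr p -> distr (pushd p Z).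
Proof.
move=> [p0 p1]; split=> [i|]; first by rewrite sumr_ge0.
have := sum_pushd p Z (fun=> 1).
by under eq_bigr do rewrite mulr1; under [RHS]eq_bigr do rewrite mulr1; rewrite p1.
Qed.

Lemma Hent_pushdE (T I : finType) (p : T -> R) (Z : T -> I) :
  Hent (pushd p Z) = - \sum_t p t * ln (pushd p Z (Z t)).
Proof. by rewrite /Hent (sum_pushd p Z (fun i => ln (pushd p Z i))). Qed.

(** Fibres of [W] lie inside fibres of [Z], hence are lighter, and the logarithms compare term by
    term over [T]. *)
Lemma le_Hent_pushd (T I J : finType) (p : T -> R) (Z : T -> I) (W : T -> J) :
  (forall t, 0 <= p t) -> (forall t t', W t = W t' -> Z t = Z t') ->
  Hent (pushd p Z) <= Hent (pushd p W).
Proof.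
move=> p0 WZ; rewrite !Hent_pushdE lerN2; apply: ler_sum => t _.
have [->|pn0] := eqVneq (p t) 0; first by rewrite !mul0r.
have pt : 0 < p t by rewrite lt_neqAle eq_sym pn0 p0.
have le1 : p t <= pushd p W (W t).
  by rewrite /pushd (bigD1 t)//= lerDl sumr_ge0.
have le2 : pushd p W (W t) <= pushd p Z (Z t).
  rewrite /pushd [leRHS]big_mkcond [leLHS]big_mkcond; apply: ler_sum => u _.
  case: eqP => [/WZ ->|_]; first by rewrite eqxx.
  by case: ifP.
by rewrite ler_wpM2l// ler_ln ?posrE// ?(lt_le_trans pt)// (le_trans le1).
Qed.

Lemma eq_Hent_pushd (T I J : finType) (p : T -> R) (Z : T -> I) (W : T -> J) :
  (forall t, 0 <= p t) -> (forall t t', W t = W t' <-> Z t = Z t') ->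
  Hent (pushd p Z) = Hent (pushd p W).
Proof.
move=> p0 WZ; apply/eqP; rewrite eq_le.
by rewrite !le_Hent_pushd// => t t' /WZ.
Qed.

Lemma pushd_id (T : finType) (p : T -> R) : pushd p id = p.
Proof. by apply/funext => t; rewrite /pushd big_pred1_eq. Qed.

(** Gibbs for the law of the pair [(Z1, Z2)] against the product of its marginals; [Z] is a function
    of this pair. *)
Lemma Hent_pushd_subadd (T I J K : finType) (p : T -> R)
    (Z : T -> K) (Z1 : T -> I) (Z2 : T -> J) : distr p ->
  (forall t t', Z1 t = Z1 t' -> Z2 t = Z2 t' -> Z t = Z t') ->
  Hent (pushd p Z) <= Hent (pushd p Z1) + Hent (pushd p Z2).
Proof.
move=> dp Z12; pose W t := (Z1 t, Z2 t).
apply: (@le_trans _ _ (Hent (pushd p W))).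
  by apply: le_Hent_pushd dp.1 _ => t t' [? ?]; apply: Z12.
have [p0 p1] := dp.
have [q0 q1] := distr_pushd W dp.
have [a0 a1] := distr_pushd Z1 dp; have [b0 b1] := distr_pushd Z2 dp.
have pr t : 0 < p t -> 0 < pushd p Z1 (Z1 t) /\ 0 < pushd p Z2 (Z2 t).
  by move=> pt; split; rewrite (lt_le_trans pt)// /pushd (bigD1 t)//= lerDl sumr_ge0.
apply: (le_trans (@gibbs _ _ (fun ij => pushd p Z1 ij.1 * pushd p Z2 ij.2) q0 _ _ _)).
- by move=> ij; rewrite mulr_ge0.
- move=> [i j] /= /eqP ab0; apply: big1 => t /eqP[ti tj]; apply/eqP/negPn.
  apply/negP => pn0; have /pr[] : 0 < p t by rewrite lt_neqAle eq_sym pn0 p0.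
  rewrite ti tj => ai bj; move: ab0; rewrite mulf_eq0 => /orP[]/eqP e.
    by rewrite e ltxx in ai.
  by rewrite e ltxx in bj.
- rewrite q1 -(pair_bigA _ (fun i j => pushd p Z1 i * pushd p Z2 j))/=.
  by under eq_bigr do rewrite -mulr_sumr b1 mulr1; rewrite a1.
- rewrite (sum_pushd p W (fun ij => ln (pushd p Z1 ij.1 * pushd p Z2 ij.2))).
  rewrite !Hent_pushdE -opprD -big_split/= lerN2; apply: ler_sum => t _.
  have [->|pn0] := eqVneq (p t) 0; first by rewrite !mul0r addr0.
  have /pr[ai bj] : 0 < p t by rewrite lt_neqAle eq_sym pn0 p0.
  by rewrite lnM// mulrDr.
Qed.

(** Gibbs compares each [p s] with the mixture [q]; averaging the cross terms
    [- \sum_i p s i * ln (q i)] over [s] gives exactly the entropy of [q]. *)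
Lemma Hent_concave (S I : finType) (c : S -> R) (p : S -> I -> R) :
  (forall s, 0 <= c s) -> (forall s, distr (p s)) -> \sum_s c s = 1 ->
  \sum_s c s * Hent (p s) <= Hent (fun i => \sum_s c s * p s i).
Proof.
move=> c0 dp c1; set q := (X in _ <= Hent X).
have q0 i : 0 <= q i by apply: sumr_ge0 => s _; rewrite mulr_ge0// (dp s).1.
have q1 : \sum_i q i = 1.
  rewrite exchange_big/= -[RHS]c1; apply: eq_bigr => s _.
  by rewrite -mulr_sumr (dp s).2 mulr1.
have -> : Hent q = \sum_s c s * (- \sum_i p s i * ln (q i)).
  rewrite /Hent; under [RHS]eq_bigr do rewrite mulrN.
  rewrite sumrN; congr (- _).
  under [RHS]eq_bigr do rewrite mulr_sumr.
  rewrite exchange_big/=; apply: eq_bigr => i _.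
  by rewrite mulr_suml; apply: eq_bigr => s _; rewrite mulrA.
apply: ler_sum => s _; have [->|cn0] := eqVneq (c s) 0; first by rewrite !mul0r.
have cs : 0 < c s by rewrite lt_neqAle eq_sym cn0 c0.
rewrite ler_wpM2l//; apply: gibbs => //; [exact: (dp s).1| |].
  move=> i /eqP; rewrite /q psumr_eq0; last first.
    by move=> s' _; rewrite mulr_ge0// (dp s').1.
  by move=> /allP/(_ s); rewrite mem_index_enum => /(_ isT); rewrite /= mulf_eq0 (negbTE cn0) => /eqP.
by rewrite q1 (dp s).2.
Qed.

Lemma Hent_mix_ge (I : finType) (t : R) (p q : I -> R) :
  0 <= t <= 1 -> distr p -> distr q ->
  t * Hent p + (1 - t) * Hent q <= Hent (fun i => t * p i + (1 - t) * q i).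
Proof.
move=> /andP[t0 t1] dp dq.
have big2 (F : 'I_2 -> R) : \sum_s F s = F ord0 + F ord_max.
  by rewrite big_ord_recl big_ord1; congr (_ + F _); exact: val_inj.
have := @Hent_concave _ I (fun b : 'I_2 => if b == ord0 then t else 1 - t)
  (fun b => if b == ord0 then p else q).
rewrite !big2/=; under [X in _ -> _ -> _ -> _ <= Hent X]funext do rewrite big2/=.
apply; [by move=> s; case: ifP => _ //; rewrite subr_ge0|by move=> s; case: ifP|lra].
Qed.

(** [x ln x] is superadditive on nonnegative reals; applied to [t p_i] and [(1 - t) q_i] it leaves
    the entropy of [(t, 1 - t)] as excess. The excess does not depend on [I], so it vanishes in
    entropy per unit time. *)
Lemma Hent_almost_convex (I : finType) (t : R) (p q : I -> R) :
  0 < t < 1 -> distr p -> distr q ->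
  Hent (fun i => t * p i + (1 - t) * q i) <=
  t * Hent p + (1 - t) * Hent q + (- (t * ln t) - (1 - t) * ln (1 - t)).
Proof.
move=> /andP[t0 t1] [p0 p1] [q0 q1].
have s0 : 0 < 1 - t by lra.
have xlnxM (a x : R) : 0 < a -> 0 <= x ->
    a * x * ln (a * x) = a * (x * ln x) + x * (a * ln a).
  move=> a0 x0; have [->|xn0] := eqVneq x 0; first by rewrite !(mulr0, mul0r) addr0.
  by rewrite lnM ?posrE// ?lt_neqAle 1?eq_sym ?xn0//; ring.
have D (x y : R) : 0 <= x -> 0 <= y -> x * ln x + y * ln y <= (x + y) * ln (x + y).
  move=> x0 y0; rewrite mulrDl lerD//.
    have [->|xn0] := eqVneq x 0; first by rewrite !mul0r.
    have xx : 0 < x by rewrite lt_neqAle eq_sym xn0.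
    by rewrite ler_wpM2l// ler_ln ?posrE ?lerDl// ltr_wpDr.
  have [->|xn0] := eqVneq y 0; first by rewrite !mul0r.
  have xx : 0 < y by rewrite lt_neqAle eq_sym xn0.
  by rewrite ler_wpM2l// ler_ln ?posrE ?lerDr// ltr_wpDl.
have -> : t * Hent p + (1 - t) * Hent q + (- (t * ln t) - (1 - t) * ln (1 - t)) =
   - \sum_i ((t * (p i * ln (p i)) + p i * (t * ln t)) +
            ((1 - t) * (q i * ln (q i)) + q i * ((1 - t) * ln (1 - t)))).
  rewrite !big_split/= -!mulr_sumr -!mulr_suml p1 q1 /Hent; ring.
rewrite /Hent lerN2; apply: ler_sum => i _.
by rewrite -!xlnxM// D// mulr_ge0// ltW.
Qed.

End FiniteEntropy.

(** * Subadditive sequences and limits along a free ultrafilter *)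

Section Fekete.
Variable R : realType.

Lemma subadditive_mul (a : nat -> R) q t :
  a 0%N = 0 -> (forall n m, a (n + m)%N <= a n + a m) -> a (t * q)%N <= t%:R * a q.
Proof.
move=> a0 sub; elim: t => [|t IH]; first by rewrite mul0n a0 mul0r.
rewrite mulSn (le_trans (sub _ _))// -natr1 mulrDl mul1r addrC lerD2r//.
Qed.

(** Fekete's lemma. The infimum runs over [n.+1] because the term at [0] would be
    [0^-1 * a 0 = 0]. *)
Lemma fekete (a : nat -> R) : (forall n, 0 <= a n) -> a 0%N = 0 ->
  (forall n m, a (n + m)%N <= a n + a m) ->
  (fun n => n%:R^-1 * a n) @ \oo -->
    inf [set n.+1%:R^-1 * a n.+1 | n in [set: nat]].
Proof.
move=> a_ge0 a0 sub; set A := [set _ | _ in _]; set l := inf A.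
have Ainf : has_inf A.
  split; first by exists (1%:R^-1 * a 1%N), 0%N.
  by exists 0 => _ [n _ <-]; rewrite mulr_ge0// invr_ge0.
apply/cvgrPdist_lt => e e0.
have e20 : 0 < e / 2 by rewrite divr_gt0.
have [_ [q' _ <-]] := inf_adherent e20 Ainf.
set q := q'.+1; rewrite -/l => ql.
(* Bounds [a] at every remainder modulo [q]. *)
pose C := \sum_(r < q) a r.
have C0 : 0 <= C by rewrite sumr_ge0.
near=> n.
have n0 : (0 < n)%N by near: n; exists 1%N.
have nR : (0 : R) < n%:R by rewrite ltr0n.
have qR : (0 : R) < q%:R by rewrite ltr0n.
have ln : l <= n%:R^-1 * a n.
  by apply: (ge_inf Ainf.2); exists n.-1 => //; rewrite prednK.
rewrite ler0_norm ?subr_le0// opprB ltrBlDr.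
have an : a n <= (n %/ q)%:R * a q + C.
  rewrite {1}(divn_eq n q) (le_trans (sub _ _))// lerD ?subadditive_mul//.
  by rewrite /C (bigD1 (Ordinal (ltn_pmod n (ltn0Sn q'))))//= lerDl sumr_ge0.
have : n%:R^-1 * a n <= q%:R^-1 * a q + C / n%:R.
  rewrite (le_trans (ler_wpM2l _ an)) ?invr_ge0// mulrDr lerD//; last by rewrite mulrC.
  rewrite mulrA ler_wpM2r// mulrC ler_pdivrMr// ler_pdivlMl//.
  by rewrite -natrM ler_nat mulnC leq_trunc_div.
move=> /le_lt_trans; apply.
have Cn : C / n%:R < e / 2.
  rewrite ltr_pdivrMr// mulrC -ltr_pdivrMr//.
  by near: n; exact: nbhs_infty_gtr.
lra.
Unshelve. all: by end_near. Qed.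

End Fekete.

Section FreeUltrafilter.

(** Chosen once and for all, so that limits of different sequences are compatible with sums,
    products and inequalities. *)
Definition freeU : set_system nat := sval (cid (ultraFilterLemma eventually_filter)).

#[global] Instance freeU_ultra : UltraFilter freeU.
Proof. by rewrite /freeU; case: cid => /= G []. Qed.

Lemma freeU_oo : \oo `<=` freeU.
Proof. by rewrite /freeU; case: cid => /= G []. Qed.

Variable R : realType.

Lemma cvg_freeU (u : nat -> R) (l : R) : u @ \oo --> l -> u @ freeU --> l.
Proof. by move=> h; apply: cvg_trans h; apply: cvg_app; exact: freeU_oo. Qed.

(** There is a cluster point in [[-M, M]]; for an ultrafilter it is a limit, since either a
    neighbourhood or its complement has its preimage in the filter. *)
Lemma freeU_bounded_cvg (u : nat -> R) (M : R) :
  (forall n, `|u n| <= M) -> cvg (u @ freeU).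
Proof.
move=> uM; have := @segment_compact R (- M) M.
move=> /(_ (u @ freeU) _ _)[].
  by apply: (@filterS _ freeU _ setT) filterT => n _ /=; rewrite in_itv/= -ler_norml.
move=> l [_ cl]; apply/cvg_ex; exists l => N Nl.
have [//|NN] := @in_ultra_setVsetC _ freeU (u @^-1` N) _.
by have [x [/= ]] := cl (~` N) N NN Nl.
Qed.

Lemma freeU_lim_le (u v : nat -> R) (k l : R) : (\forall n \near freeU, u n <= v n) ->
  u @ freeU --> k -> v @ freeU --> l -> k <= l.
Proof. by move=> uv uk vl; apply: (ler_cvg_to uk vl). Qed.

End FreeUltrafilter.

(** * Integrals of continuous functions *)

Section Cutoff.
Variables (R : realType) (X : pmetricType R).
Implicit Types (U : set X) (x y : X).

(* min(1, d(x, X \ U)), which makes sense also for U = X. *)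
Definition cutoff U x : R := inf ([set mdist x y | y in ~` U] `|` [set 1]).

Let cutoff_inf U x : has_inf ([set mdist x y | y in ~` U] `|` [set 1]).
Proof.
split; first by exists 1; right.
by exists 0 => _ [[y _ <-]|->//]; exact: mdist_ge0.
Qed.

Lemma cutoff_ge0 U x : 0 <= cutoff U x.
Proof.
apply: lb_le_inf (cutoff_inf U x).1 _.
by move=> _ [[y _ <-]|->//]; exact: mdist_ge0.
Qed.

Lemma cutoff_le1 U x : cutoff U x <= 1.
Proof. by apply: (ge_inf (cutoff_inf U x).2); right. Qed.

Lemma cutoff_out U x : ~ U x -> cutoff U x = 0.
Proof.
move=> Ux; apply/eqP; rewrite eq_le cutoff_ge0 andbT.
by apply: (ge_inf (cutoff_inf U x).2); left; exists x => //; rewrite mdistxx.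
Qed.

Lemma cutoff_gt0 U x : open U -> U x -> 0 < cutoff U x.
Proof.
move=> oU Ux; have : nbhs x U by exact: open_nbhs_nbhs.
move=> /nbhs_ballP[e /= e0 eU].
apply: (@lt_le_trans _ _ (Num.min 1 e)); first by rewrite lt_min ltr01 e0.
apply: lb_le_inf (cutoff_inf U x).1 _.
move=> _ [[y Uy <-]|->]; last by rewrite ge_min lexx.
rewrite ge_min; apply/orP; right; rewrite leNgt; apply/negP => ye.
by apply: Uy; apply: eU; rewrite ballEmdist.
Qed.

Lemma cutoff_lip U x y : cutoff U x <= cutoff U y + mdist x y.
Proof.
rewrite -lerBlDr; apply: lb_le_inf (cutoff_inf U y).1 _.
move=> _ [[z Uz <-]|->]; rewrite lerBlDr.
  rewrite [leRHS]addrC (le_trans _ (metric_triangle x y z))//.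
  by apply: (ge_inf (cutoff_inf U x).2); left; exists z.
by rewrite (le_trans (cutoff_le1 _ _))// lerDl mdist_ge0.
Qed.

Lemma lip_continuous (g : X -> R) :
  (forall x y, g x <= g y + mdist x y) -> continuous g.
Proof.
move=> gl x; apply/cvgrPdist_lt => e e0.
apply/nbhs_ballP; exists e => //= y; rewrite ballEmdist /= => xy.
have := gl x y; have := gl y x; rewrite (metric_sym y x) => h1 h2.
by rewrite ltr_norml; apply/andP; split; lra.
Qed.

Lemma cutoff_continuous U : continuous (cutoff U).
Proof. by apply: lip_continuous => x y; exact: cutoff_lip. Qed.

Lemma mdist_continuous x : continuous (mdist x : X -> R).
Proof.
apply: lip_continuous => y z; rewrite [mdist y z]metric_sym.
exact: metric_triangle.
Qed.

(** For open [U] these continuous functions increase with [n] to the indicator of [U]; they carry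
    information from integrals to measures of open sets. *)
Definition tent U (n : nat) x : R := Num.min 1 (n%:R * cutoff U x).

Lemma tent_ge0 U n x : 0 <= tent U n x.
Proof. by rewrite /tent le_min ler01 mulr_ge0// cutoff_ge0. Qed.

Lemma tent_le1 U n x : tent U n x <= 1.
Proof. by rewrite /tent ge_min lexx. Qed.

Lemma tent_out U n x : ~ U x -> tent U n x = 0.
Proof. by move=> Ux; rewrite /tent cutoff_out// mulr0; apply: min_r. Qed.

Lemma tent_continuous U n : continuous (tent U n).
Proof.
move=> x; apply: (@continuous_min R X (fun=> 1) (fun x => n%:R * cutoff U x)).
  exact: cvg_cst.
by apply: cvgM; [exact: cvg_cst|exact: cutoff_continuous].
Qed.

End Cutoff.

Section ContinuousIntegrals.
Variables (R : realType) (X : pmetricType R).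
Hypothesis Xc : compact [set: X].
Implicit Types (mu : probability (borel X) R) (g h : X -> R).

Lemma continuous_bounded g : continuous g -> exists M, forall x, `|g x| <= M.
Proof.
move=> gc; have : compact (g @` setT).
  by apply: continuous_compact => //; apply: continuous_subspaceT.
move=> /compact_bounded[M [_ HM]]; exists (M + 1) => x.
by apply: (HM (M + 1)); [rewrite ltrDl|exists x].
Qed.

Lemma borel_open (U : set X) : open U -> measurable (U : set (borel X)).
Proof. by move=> oU; apply: sub_sigma_algebra. Qed.

Lemma borel_continuous g : continuous g -> measurable_fun setT (g : borel X -> R).
Proof.
move=> gc; apply: (measurability _ (measurable_realfun.RGenOInfty.measurableE R)).
move=> _ [_ [a ->] <-]; rewrite setTI; apply: borel_open.
by apply: (open_comp (fun x _ => gc x)); exact: interval_open.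
Qed.

Lemma borel_continuous_map (f : X -> X) : continuous f ->
  measurable_fun setT (f : borel X -> borel X).
Proof.
move=> fc; apply: (@measurability _ _ (borel X) (borel X) setT f (@open X)) => //.
move=> _ [U oU <-]; rewrite setTI; apply: borel_open.
exact: (open_comp (fun x _ => fc x)).
Qed.

Lemma borel_continuous_iter (f : X -> X) n : continuous f ->
  continuous (iter n f).
Proof.
move=> fc; elim: n => [|n IH] x; first exact: cvg_id.
exact: (continuous_comp (IH x) (fc _)).
Qed.

Lemma continuous_integrable mu g : continuous g ->
  mu.-integrable setT (EFin \o (g : borel X -> R)).
Proof.
move=> gc; apply: measurable_bounded_integrable => //.
- by rewrite (le_lt_trans (probability_le1 _ _))// ltry.
- exact: borel_continuous.
have [M HM] := continuous_bounded gc.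
by exists M; split; [exact: num_real|move=> N MN x _ /=; rewrite (le_trans (HM x))// ltW].
Qed.

Lemma intD mu g h : continuous g -> continuous h ->
  \int[mu]_x (g x + h x) = \int[mu]_x g x + \int[mu]_x h x.
Proof. by move=> gc hc; rewrite RintegralD//; exact: continuous_integrable. Qed.

Lemma intZ mu (c : R) g : continuous g -> \int[mu]_x (c * g x) = c * \int[mu]_x g x.
Proof. by move=> gc; rewrite RintegralZl//; exact: continuous_integrable. Qed.

Lemma int_cst mu (c : R) : \int[mu]_x c = c.
Proof. rewrite Rintegral_cst//; transitivity (c * 1); last exact: mulr1.
by congr (c * _); exact: (congr1 fine (probability_setT mu)). Qed.

Lemma int_le mu g h : continuous g -> continuous h -> (forall x, g x <= h x) ->
  \int[mu]_x g x <= \int[mu]_x h x.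
Proof. by move=> gc hc gh; apply: le_Rintegral => //; exact: continuous_integrable. Qed.

Lemma intN mu g : continuous g -> \int[mu]_x (- g x) = - \int[mu]_x g x.
Proof.
move=> gc; rewrite -[RHS]mulN1r -intZ//; apply: eq_Rintegral => x _.
by rewrite mulN1r.
Qed.

Lemma intB mu g h : continuous g -> continuous h ->
  \int[mu]_x (g x - h x) = \int[mu]_x g x - \int[mu]_x h x.
Proof.
by move=> gc hc; rewrite intD ?intN// => x; apply: continuousN; exact: hc.
Qed.

Lemma int_dist mu g h e : continuous g -> continuous h ->
  (forall x, `|g x - h x| <= e) -> `|\int[mu]_x g x - \int[mu]_x h x| <= e.
Proof.
move=> gc hc gh; rewrite -intB//.
have gh' : continuous (fun x => g x - h x).
  by move=> x; apply: continuousB; [exact: gc|exact: hc].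
have ec c : continuous (fun _ : X => c : R) by move=> x; exact: cvg_cst.
rewrite ler_norml -{1}(int_cst mu (- e)) -{2}(int_cst mu e).
by apply/andP; split; apply: int_le => // x; have := gh x; rewrite ler_norml => /andP[].
Qed.

Lemma int_norm_le mu g M : continuous g -> (forall x, `|g x| <= M) ->
  `|\int[mu]_x g x| <= M.
Proof.
move=> gc gM; have := @int_dist mu g (fun=> 0) M gc.
rewrite int_cst subr0; apply=> [x|x]; [exact: cvg_cst|by rewrite subr0].
Qed.

Definition fm mu (A : set X) : R := fine (mu A).

Lemma fmE mu A : measurable (A : set (borel X)) -> mu A = (fm mu A)%:E.
Proof. by move=> mA; rewrite fineK// fin_num_measure. Qed.

Lemma fm_ge0 mu A : 0 <= fm mu A.
Proof. by rewrite fine_ge0. Qed.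

Lemma fm_le1 mu A : measurable (A : set (borel X)) -> fm mu A <= 1.
Proof. by move=> mA; rewrite -lee_fin -fmE// probability_le1. Qed.

Lemma fm_le mu A B : measurable (A : set (borel X)) -> measurable (B : set (borel X)) ->
  A `<=` B -> fm mu A <= fm mu B.
Proof. by move=> mA mB AB; rewrite -lee_fin -!fmE// le_measure ?inE. Qed.

Lemma fm_setT mu : fm mu setT = 1.
Proof. by rewrite /fm probability_setT. Qed.

Lemma fm_setC mu A : measurable (A : set (borel X)) -> fm mu (~` A) = 1 - fm mu A.
Proof.
move=> mA; apply: EFin_inj; rewrite -fmE; last exact: measurableC.
by rewrite probability_setC// EFinB -fmE.
Qed.

Let indic_int mu (A : set (borel X)) : measurable A ->
  mu.-integrable setT (EFin \o (\1_A : borel X -> R)).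
Proof.
move=> mA; apply: measurable_bounded_integrable => //.
- by rewrite (le_lt_trans (probability_le1 _ _))// ltry.
exists 1; split; [exact: num_real|move=> N MN x _ /=].
by rewrite indicE (le_trans _ (ltW MN))//; case: (_ \in _); rewrite ?normr1 ?normr0.
Qed.

Let Rint_indic mu (A : set (borel X)) : measurable A -> \int[mu]_x (\1_A x : R) = fm mu A.
Proof. by move=> mA; rewrite /Rintegral integral_indic// setIT. Qed.

Lemma fm_le_int mu A g : measurable (A : set (borel X)) -> continuous g ->
  (forall x, 0 <= g x) -> (forall x, A x -> 1 <= g x) -> fm mu A <= \int[mu]_x g x.
Proof.
move=> mA gc g0 g1; rewrite -Rint_indic//; apply: le_Rintegral => //.
- exact: indic_int.
- exact: continuous_integrable.
move=> x _; rewrite indicE; have [/set_mem/g1//|_] := boolP (x \in A); exact: g0.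
Qed.

Lemma int_le_fm mu A g : measurable (A : set (borel X)) -> continuous g ->
  (forall x, g x <= 1) -> (forall x, ~ A x -> g x <= 0) -> \int[mu]_x g x <= fm mu A.
Proof.
move=> mA gc g0 g1; rewrite -Rint_indic//; apply: le_Rintegral => //.
- exact: continuous_integrable.
- exact: indic_int.
move=> x _; rewrite indicE; have [_|/negP xA] := boolP (x \in A); first exact: g0.
by apply: g1 => Ax; apply: xA; rewrite inE.
Qed.

(** The integral lies between the masses of [V n], where the tent equals 1, and of [U]; the sets
    [V n] increase to [U]. *)
Lemma int_tent_cvg mu U : open U -> (fun n => \int[mu]_x tent U n x) @ \oo --> fm mu U.
Proof.
move=> oU; pose V n := [set x | 1 < n%:R * cutoff U x].
have mV n : measurable (V n : set (borel X)).
  apply: borel_open; have -> : V n = (fun x => n%:R * cutoff U x) @^-1` `]1, +oo[%classic.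
    by apply/seteqP; split => x; rewrite /V /= in_itv/= andbT.
  apply: open_comp; last exact: interval_open.
  by move=> x _; apply: cvgM; [exact: cvg_cst|exact: cutoff_continuous].
have mU := borel_open oU.
have UV : U = \bigcup_n V n.
  apply/seteqP; split=> [x Ux|x [n _]].
    have c0 := cutoff_gt0 oU Ux.
    have : \forall n \near \oo, (cutoff U x)^-1 < n%:R by exact: nbhs_infty_gtr.
    case=> n _ /(_ n (leqnn _)) cn; exists n => //=.
    by rewrite /V/= -ltr_pdivrMr// mul1r.
  rewrite /V /=; apply: contraPP => /cutoff_out ->; rewrite mulr0.
  by apply/negP; rewrite -leNgt.
have VU : (fun n => mu (V n)) @ \oo --> mu U.
  rewrite UV; apply: nondecreasing_cvg_mu => //; first by rewrite -UV.
  move=> n m nm; apply/subsetPset => x; rewrite /V /= => /lt_le_trans; apply.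
  by rewrite ler_wpM2r ?cutoff_ge0// ler_nat.
have {}VU : (fun n => fm mu (V n)) @ \oo --> fm mu U.
  by apply: fine_cvg; rewrite fmE// in VU.
apply: squeeze_cvgr VU (cvg_cst _); apply: nearW => n; apply/andP; split.
  apply: fm_le_int => //; [exact: tent_continuous|by move=> x; exact: tent_ge0|].
  by move=> x; rewrite /V /tent /= => /ltW h; rewrite le_min lexx.
apply: int_le_fm => //; [exact: tent_continuous|by move=> x; exact: tent_le1|].
by move=> x /tent_out ->.
Qed.

(** Open sets are stable under intersection and generate the Borel sets. *)
Lemma open_measure_eq (mu nu : probability (borel X) R) :
  (forall U : set X, open U -> fm mu U = fm nu U) ->
  forall A, measurable (A : set (borel X)) -> mu A = nu A.
Proof.
move=> h A mA.
apply: (@measure_unique _ _ (borel X) (@open X) (fun=> setT) erefl _ _ _ mu nu) => //.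
- by move=> B C; exact: openI.
- by move=> _; exact: openT.
- by rewrite bigcup_const.
- move=> B oB; have mB := borel_open oB.
  exact: (etrans (fmE mu mB) (etrans (congr1 EFin (h _ oB)) (esym (fmE nu mB)))).
- by move=> _; apply: (le_lt_trans (probability_le1 mu measurableT)); rewrite ltry.
Qed.

Lemma int_measure_eq (mu nu : probability (borel X) R) :
  (forall g, continuous g -> \int[mu]_x g x = \int[nu]_x g x) ->
  forall A, measurable (A : set (borel X)) -> mu A = nu A.
Proof.
move=> h; apply: open_measure_eq => U oU.
suff : (fun n => \int[mu]_x tent U n x) @ \oo --> fm nu U.
  by apply: cvg_unique; [exact: norm_hausdorff|exact: int_tent_cvg].
have -> : (fun n => \int[mu]_x tent U n x) = (fun n => \int[nu]_x tent U n x).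
  by apply/funext => n; apply: h; exact: tent_continuous.
exact: int_tent_cvg.
Qed.

End ContinuousIntegrals.

(** * The Riesz representation theorem on a compact metric space *)

Section Riesz.
Variables (R : realType) (X : pmetricType R).
Hypothesis Xc : compact [set: X].
Implicit Types (g h : X -> R) (U V : set X).

Definition pos_functional (L : (X -> R) -> R) :=
  [/\ forall g h, continuous g -> continuous h ->
        L (fun x => g x + h x) = L g + L h,
      forall (c : R) g, continuous g -> L (fun x => c * g x) = c * L g,
      forall g, continuous g -> (forall x, 0 <= g x) -> 0 <= L g &
      L (fun=> 1) = 1].

Section Construction.
Variable L : (X -> R) -> R.
Hypothesis HL : pos_functional L.

Let LD g h : continuous g -> continuous h -> L (fun x => g x + h x) = L g + L h.
Proof. by case: HL => + _ _ _; apply. Qed.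

Let LZ (c : R) g : continuous g -> L (fun x => c * g x) = c * L g.
Proof. by case: HL => _ + _ _; apply. Qed.

Let L0 g : continuous g -> (forall x, 0 <= g x) -> 0 <= L g.
Proof. by case: HL => _ _ + _; apply. Qed.

Let L1 : L (fun=> 1) = 1.
Proof. by case: HL. Qed.

Let cstc (c : R) : continuous (fun _ : X => c).
Proof. by move=> x; exact: cvg_cst. Qed.

Let Dc (g h : X -> R) : continuous g -> continuous h -> continuous (fun x => g x + h x).
Proof. by move=> gc hc x; apply: continuousD; [exact: gc|exact: hc]. Qed.

Let Zc c (g : X -> R) : continuous g -> continuous (fun x => c * g x).
Proof. by move=> gc x; apply: cvgM; [exact: cvg_cst|exact: gc]. Qed.

Let Lcst c : L (fun=> c) = c.
Proof.
rewrite -[RHS]mulr1 -[X in _ = _ * X]L1 -LZ//.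
by congr L; apply/funext => x; rewrite mulr1.
Qed.

Let L_le g h : continuous g -> continuous h -> (forall x, g x <= h x) -> L g <= L h.
Proof.
move=> gc hc gh; have nc : continuous (fun x => -1 * g x) by exact: Zc.
have -> : L h = L g + L (fun x => h x + -1 * g x).
  rewrite -LD//; last exact: Dc.
  by congr L; apply/funext => x; ring.
by rewrite lerDl L0//; [exact: Dc|move=> x; rewrite mulN1r subr_ge0].
Qed.

Let sumc n (g : nat -> X -> R) : (forall i, continuous (g i)) ->
  continuous (fun x => \sum_(i < n) g i x).
Proof.
move=> gc; elim: n => [|n IH].
  by under eq_fun do rewrite big_ord0; exact: cstc.
by under eq_fun do rewrite big_ord_recr/=; exact: Dc.
Qed.

Let Lsum n (g : nat -> X -> R) : (forall i, continuous (g i)) ->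
  L (fun x => \sum_(i < n) g i x) = \sum_(i < n) L (g i).
Proof.
move=> gc; elim: n => [|n IH].
  rewrite big_ord0 -[RHS](Lcst 0); congr L; apply/funext => x.
  by rewrite big_ord0.
rewrite big_ord_recr/= -IH -LD//; last exact: sumc.
by congr L; apply/funext => x; rewrite big_ord_recr.
Qed.

(** Test functions vanish off [U] but need not have support inside it; small values near the
    boundary of [U] are absorbed by an [e] in [Lam_subadd] and [cara_open]. *)
Let test (U : set X) : set (X -> R) :=
  [set g : X -> R | [/\ continuous g, forall x, 0 <= g x <= 1 & forall x, ~ U x -> g x = 0]].

Let Lam (U : set X) : \bar R := ereal_sup [set (L g)%:E | g in test U].

Let Lam_le1 U : (Lam U <= 1)%E.
Proof.
apply: ge_ereal_sup => _ [g [gc g01 _] <-].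
by rewrite lee_fin -L1 L_le// => x; have /andP[] := g01 x.
Qed.

Let Lam_test U g : test U g -> ((L g)%:E <= Lam U)%E.
Proof. by move=> tg; apply: ereal_sup_ubound; exists g. Qed.

Let Lam_ge0 U : (0 <= Lam U)%E.
Proof.
apply: (@le_trans _ _ (L (fun=> 0))%:E); first by rewrite Lcst.
by apply: Lam_test; split=> // x; rewrite lexx ler01.
Qed.

Let Lam_mono U V : U `<=` V -> (Lam U <= Lam V)%E.
Proof.
move=> UV; apply: ge_ereal_sup => _ [g [gc g01 gU] <-]; apply: Lam_test; split=> //.
by move=> x Vx; apply: gU => /UV.
Qed.

(** Up to [e], a test function [g] of the union is dominated by a finite sum of test functions of
    the pieces, namely truncations of [g] by multiples of cutoffs; these play the role of a
    partition of unity. *)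
Let Lam_subadd (U : nat -> set X) : (forall n, open (U n)) ->
  (Lam (\bigcup_n U n) <= \sum_(n <oo) Lam (U n))%E.
Proof.
move=> oU; apply: ge_ereal_sup => _ [g [gc g01 gU] <-].
apply/lee_addgt0Pr => e e0.
pose S N x := Num.min (g x) (\sum_(i < N) N%:R * cutoff (U i) x).
(* Compactness makes [N] uniform. Near a point with [g < e] the bound is trivial; any other point
   lies in some [U k], and for large [N] the term [N * cutoff (U k)] is at least [1 >= g] nearby. *)
have [N HN] : exists N, forall x, g x - e <= S N x.
  have /compact_near_coveringP cov := Xc.
  have [] := cov nat \oo (fun N x => g x - e <= S N x) _ _.
    move=> x _; have [gx|gx] := ltP (g x) e.
      exists ([set y | g y < e], setT).
        split=> /=; last exact: filterT.
        by apply: (cvgr_lt (g x)) => //; exact: gc.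
      move=> [y N] [/= gy _]; rewrite /S.
      have s0 : 0 <= \sum_(i < N) N%:R * cutoff (U i) y.
        by apply: sumr_ge0 => i _; rewrite mulr_ge0// cutoff_ge0.
      have [g0 _] := andP (g01 y).
      by rewrite le_min; apply/andP; split; lra.
    have [k _ Ukx] : (\bigcup_n U n) x.
      by apply: contrapT => /gU gx0; move: gx; rewrite gx0 leNgt e0.
    have c0 := cutoff_gt0 (oU k) Ukx.
    have c20 : cutoff (U k) x / 2 < cutoff (U k) x by lra.
    have M0 : \forall N \near \oo, (cutoff (U k) x / 2)^-1 < N%:R by exact: nbhs_infty_gtr.
    exists ([set y | cutoff (U k) x / 2 < cutoff (U k) y],
            [set N | (k < N)%N /\ (cutoff (U k) x / 2)^-1 < N%:R]).
      split => /=.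
        by apply: (cvgr_gt (cutoff (U k) x)) => //; exact: cutoff_continuous.
      by apply: filterI M0; exists k.+1.
    move=> [y N] [/= cy [kN NN]]; rewrite /S le_min; apply/andP; split; first lra.
    have [_ g1] := andP (g01 y).
    rewrite (bigD1 (Ordinal kN))//=.
    have s0 : 0 <= \sum_(i < N | i != Ordinal kN) N%:R * cutoff (U i) y.
      by apply: sumr_ge0 => i _; rewrite mulr_ge0// cutoff_ge0.
    have : 1 <= N%:R * cutoff (U k) y.
      have h0 : 0 < cutoff (U k) x / 2 by lra.
      rewrite -ler_pdivrMr ?(lt_trans h0)// mul1r (le_trans _ (ltW NN))//.
      by rewrite lef_pV2 ?posrE//; [exact: ltW|exact: lt_trans cy].
    by move=> h; lra.
  by move=> N _ /(_ N (leqnn N)) HN; exists N => x; exact: HN.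
pose H i x := Num.min (g x) (N%:R * cutoff (U i) x).
have Hc i : continuous (H i).
  move=> x; apply: (@continuous_min R X g (fun x => N%:R * cutoff (U i) x)).
    exact: gc.
  by apply: Zc; exact: cutoff_continuous.
have H0 i x : 0 <= H i x.
  by rewrite /H le_min (andP (g01 x)).1 mulr_ge0// cutoff_ge0.
have le1 : L g <= \sum_(i < N) L (H i) + e.
  rewrite -Lsum// -[X in _ + X](Lcst e) -LD//; last exact: sumc.
  apply: L_le => //; first by apply: Dc => //; exact: sumc.
  move=> x; rewrite -lerBlDr (le_trans (HN x))// /S /H.
  (* Truncation at [g x] is subadditive on nonnegative reals. *)
  suff D n : Num.min (g x) (\sum_(i < n) N%:R * cutoff (U i) x) <=
      \sum_(i < n) Num.min (g x) (N%:R * cutoff (U i) x) by exact: D.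
  elim: n => [|n IH]; first by rewrite !big_ord0 ge_min lexx orbT.
  rewrite !big_ord_recr/=.
  have n0 : 0 <= N%:R * cutoff (U n) x by rewrite mulr_ge0// cutoff_ge0.
  have [g0 _] := andP (g01 x).
  have s0 : 0 <= \sum_(i < n) N%:R * cutoff (U i) x.
    by apply: sumr_ge0 => i _; rewrite mulr_ge0// cutoff_ge0.
  apply: le_trans (lerD IH (lexx _)).
  move: n0 s0; set b := \sum_(i < n) _; set c := _ * cutoff (U n) x => c0 b0.
  have [ab|ab] := leP (g x) b; have [ac|ac] := leP (g x) c; rewrite ge_min; apply/orP; first [left; lra|right; lra].
apply: (@le_trans _ _ ((\sum_(i < N) L (H i))%:E + e%:E)%E).
  by rewrite -EFinD lee_fin.
rewrite leeD2r//; apply: (@le_trans _ _ (\sum_(i < N) Lam (U i))%E).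
  rewrite -sumEFin; apply: lee_sum => i _; apply: Lam_test; split=> // [x|x /cutoff_out cx].
    by rewrite H0/= /H ge_min (andP (g01 x)).2.
  by rewrite /H cx mulr0; apply: min_r; exact: (andP (g01 x)).1.
rewrite -(big_mkord xpredT (fun i => Lam (U i))).
by apply: nneseries_lim_ge => *; exact: Lam_ge0.
Qed.

Definition riesz_outer (A : set X) : \bar R :=
  ereal_inf [set Lam U | U in [set U | open U /\ A `<=` U]].

Let outer_open U : open U -> riesz_outer U = Lam U.
Proof.
move=> oU; apply/eqP; rewrite eq_le; apply/andP; split.
  by apply: ereal_inf_lbound; exists U => //; split.
by apply: le_ereal_inf_tmp => _ [V [oV UV] <-]; exact: Lam_mono.
Qed.

Let outer0 : riesz_outer set0 = 0%E.
Proof.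
rewrite outer_open; last exact: open0.
apply/eqP; rewrite eq_le Lam_ge0 andbT.
apply: ge_ereal_sup => _ [g [gc g01 g0] <-].
rewrite lee_fin -(Lcst 0); apply: L_le => // x.
by rewrite g0.
Qed.

Let outer_ge0 A : (0 <= riesz_outer A)%E.
Proof. by apply: le_ereal_inf_tmp => _ [V _ <-]; exact: Lam_ge0. Qed.

Let outer_mono : {homo riesz_outer : A B / A `<=` B >-> (A <= B)%E}.
Proof.
move=> A B AB; apply: le_ereal_inf_tmp => _ [V [oV BV] <-].
by apply: ereal_inf_lbound; exists V => //; split=> //; exact: subset_trans BV.
Qed.

Let outer_fin A : riesz_outer A \is a fin_num.
Proof.
rewrite ge0_fin_numE//; apply: (@le_lt_trans _ _ (1%:E)); last exact: ltry.
apply: (le_trans _ (Lam_le1 setT)); apply: ereal_inf_lbound; exists setT => //.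
by split=> //; exact: openT.
Qed.

Let outer_approx A (e : R) : 0 < e -> exists2 U, open U /\ A `<=` U &
  (Lam U <= riesz_outer A + e%:E)%E.
Proof.
move=> e0; have [_ [U UA <-] h] := lb_ereal_inf_adherent e0 (outer_fin A).
by exists U => //; exact: ltW.
Qed.

Let outer_sigma_subadd : sigma_subadditive riesz_outer.
Proof.
move=> F; apply/lee_addgt0Pr => e e0.
have e2 n : 0 < e / (2 ^ n.+1)%:R by rewrite divr_gt0// ltr0n expn_gt0.
pose U n := sval (cid2 (outer_approx (F n) (e2 n))).
have UP n : open (U n) /\ F n `<=` U n by rewrite /U; case: cid2.
have Ule n : (Lam (U n) <= riesz_outer (F n) + (e / (2 ^ n.+1)%:R)%:E)%E by rewrite /U; case: cid2.
have oU n : open (U n) by case: (UP n).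
apply: (@le_trans _ _ (Lam (\bigcup_n U n))).
  apply: ereal_inf_lbound; exists (\bigcup_n U n) => //; split.
    by apply: bigcup_open.
  by apply: subset_bigcup => n _; case: (UP n).
apply: (le_trans (Lam_subadd oU)).
apply: (@le_trans _ _ (\sum_(n <oo) (riesz_outer (F n) + (e / (2 ^ n.+1)%:R)%:E))%E).
  by apply: lee_nneseries => [n _ _|n _]; [exact: Lam_ge0|exact: Ule].
apply: epsilon_trick => // ; exact: ltW.
Qed.

HB.instance Definition _ := isOuterMeasure.Build R X riesz_outer
  outer0 outer_ge0 outer_mono outer_sigma_subadd.

Let mu0 : {outer_measure set X -> \bar R} := riesz_outer.

(** A test function [g] of the part of [V] in [U] and a test function [h] for the part outside must
    add up to a test function of [V]. Lowering [g] to [max(g, e) - e] makes room: it vanishes on the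
    open set [W] where [g < e], which contains [V] minus [U], and costs at most [e]. *)
Let cara_open U : open U -> mu0.-caratheodory U.
Proof.
move=> oU; apply: le_caratheodory_measurable => A.
apply: le_ereal_inf_tmp => _ [V [oV AV] <-].
have oVU : open (V `&` U) by exact: openI.
apply: (@le_trans _ _ (Lam (V `&` U) + riesz_outer (V `&` ~` U))%E).
  apply: leeD; last by apply: outer_mono; exact: setSI.
  by rewrite -outer_open//; apply: outer_mono; exact: setSI.
rewrite -leeBrDr; last exact: outer_fin.
apply: ge_ereal_sup => _ [g [gc g01 gVU] <-].
rewrite leeBrDr; last exact: outer_fin.
apply/lee_addgt0Pr => e e0.
pose W := V `&` [set x | g x < e].
have oW : open W.
  apply: openI => //; have -> : [set x | g x < e] = g @^-1` `]-oo, e[%classic.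
    by apply/seteqP; split=> x /=; rewrite in_itv.
  by apply: open_comp => [x _|]; [exact: gc|exact: interval_open].
pose g' x := Num.max (g x) e + (- e).
have g'c : continuous g'.
  apply: (@Dc (fun x => Num.max (g x) e) (fun=> - e)) => //.
  by move=> x; apply: (@continuous_max R X g (fun=> e)); [exact: gc|exact: cvg_cst].
have gg' : L g <= L g' + e.
  rewrite -[X in _ + X](Lcst e) -LD//; apply: L_le => //; first exact: Dc.
  by move=> x; rewrite /g' subrK le_max lexx.
apply: (@le_trans _ _ ((L g')%:E + e%:E + Lam W)%E).
  apply: leeD; first by rewrite -EFinD lee_fin.
  apply: ereal_inf_lbound; exists W => //; split=> // x [Vx Ux]; split => //=.
  by rewrite gVU// => -[].
rewrite addeAC leeD2r// addeC -leeBrDr//.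
apply: ge_ereal_sup => _ [h [hc h01 hW] <-].
rewrite leeBrDr// -EFinD -LD//; apply: Lam_test; split; first exact: Dc.
- move=> x; have [h0 h1] := andP (h01 x); have [g0 g1] := andP (g01 x).
  rewrite /g'; have [gx|gx] := leP (g x) e.
    by rewrite subrr addr0 h0.
  rewrite hW ?add0r; last by move=> [_ /=]; rewrite ltNge (ltW gx).
  by apply/andP; split; lra.
- move=> x Vx; rewrite hW ?add0r; last by move=> [].
  rewrite /g' gVU; last by move=> [].
  by rewrite max_r ?subrr// ltW.
Qed.

Let cara_borel (A : set (borel X)) : measurable A -> mu0.-caratheodory A.
Proof.
apply: smallest_sub; last by move=> U; exact: cara_open.
exact: (sigma_algebra_measurable (caratheodory_type mu0)).
Qed.

Definition riesz_measure (A : set (borel X)) : \bar R := riesz_outer A.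

Let rm0 : riesz_measure set0 = 0%E.
Proof. exact: outer0. Qed.

Let rm_ge0 A : (0 <= riesz_measure A)%E.
Proof. exact: outer_ge0. Qed.

Let rm_sigma : semi_sigma_additive riesz_measure.
Proof.
move=> F mF tF mUF.
apply: (@caratheodory_measure_sigma_additive R X mu0 F) => //.
  by move=> i; exact: cara_borel.
exact: cara_borel.
Qed.

HB.instance Definition _ := isMeasure.Build _ (borel X) R riesz_measure
  rm0 rm_ge0 rm_sigma.

Let rmT : riesz_measure setT = 1%E.
Proof.
rewrite /riesz_measure outer_open; last exact: openT.
apply/eqP; rewrite eq_le Lam_le1/= -[X in (X <= _)%E]/(1%:E) -{1}L1.
by apply: Lam_test; split=> // x; [rewrite /= ler01 lexx|move=> /(_ I)].
Qed.

HB.instance Definition _ := Measure_isProbability.Build _ (borel X) R riesz_measure rmT.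

Let P : probability (borel X) R := riesz_measure.

(* Slice g into the layers g_i = min(max(g - i/N, 0), 1/N). *)
Let L_le_int01 g : continuous g -> (forall x, 0 <= g x <= 1) -> L g <= \int[P]_x g x.
Proof.
move=> gc g01; apply/ler_addgt0Pl => e e0.
have [N Ne] : exists N : nat, e^-1 < N%:R.
  by have [N _ /(_ N (leqnn N))] := nbhs_infty_gtr e^-1; exists N.
have NR : (0 : R) < N%:R by rewrite (lt_trans _ Ne)// invr_gt0.
have N1e : N%:R^-1 < e by rewrite invf_plt.
pose G (i : nat) x := Num.min (Num.max (g x - i%:R / N%:R) 0) N%:R^-1.
have Gc i : continuous (G i).
  move=> x; apply: (@continuous_min R X (fun x => Num.max (g x - i%:R / N%:R) 0) (fun=> N%:R^-1)).
    apply: (@continuous_max R X (fun x => g x - i%:R / N%:R) (fun=> 0)); last exact: cvg_cst.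
    by apply: continuousB; [exact: gc|exact: cvg_cst].
  exact: cvg_cst.
have Ni0 : 0 < (N%:R : R)^-1 by rewrite invr_gt0.
have G0 i x : 0 <= G i x by rewrite /G le_min le_max lexx orbT/= ltW.
have G1 i x : G i x <= N%:R^-1 by rewrite /G ge_min lexx orbT.
have Gsum n x : \sum_(i < n) G i x = Num.min (g x) (n%:R / N%:R).
  elim: n => [|n IH].
    by rewrite big_ord0 mul0r min_r// (andP (g01 x)).1.
  rewrite big_ord_recr/= IH /G -natr1 mulrDl mul1r.
  have [ab|ab] := leP (g x) (n%:R / N%:R).
    by rewrite max_r ?subr_le0// min_l ?(ltW Ni0)// min_l ?addr0//; lra.
  rewrite max_l; last lra.
  have [abc|abc] := leP (g x - n%:R / N%:R) N%:R^-1.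
    rewrite min_l; lra.
  rewrite min_r; lra.
have gE : g = fun x => \sum_(i < N) G i x.
  apply/funext => x; rewrite Gsum divff ?gt_eqF// min_l//.
  exact: (andP (g01 x)).2.
pose V i := [set x | i%:R / N%:R < g x].
have oV i : open (V i).
  have -> : V i = g @^-1` `]i%:R / N%:R, +oo[%classic.
    by apply/seteqP; split=> x; rewrite /V /= in_itv/= andbT.
  by apply: open_comp => [x _|]; [exact: gc|exact: interval_open].
have mV i := borel_open (oV i).
(* [N * G i] is a test function of [V i]. *)
have LG i : L (G i) <= N%:R^-1 * fm P (V i).
  rewrite -ler_pdivrMl// invrK -LZ// -lee_fin -fmE//.
  have -> : P (V i) = Lam (V i) by rewrite -outer_open.
  apply: Lam_test; split; first exact: Zc.
    move=> x; rewrite mulr_ge0 ?ler0n//=.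
    by rewrite -ler_pdivlMl// mulr1.
  move=> x /negP; rewrite -leNgt => gx.
  by rewrite /G max_r ?subr_le0// min_l ?mulr0// ltW.
(* [N * G i] equals 1 on [V i.+1]: the lower bound on the integral is that of the next layer up. *)
have IG i : N%:R^-1 * fm P (V i.+1) <= \int[P]_x G i x.
  rewrite -ler_pdivlMl// invrK -intZ//; apply: fm_le_int => //.
  - exact: Zc.
  - by move=> x; rewrite mulr_ge0// ltW.
  - move=> x; rewrite /V /= -natr1 mulrDl mul1r => gx.
    rewrite /G max_l ?min_r ?divff// ?gt_eqF//; lra.
have {1}-> := gE; rewrite Lsum//.
have intsum n : \int[P]_x (\sum_(i < n) G i x) = \sum_(i < n) \int[P]_x G i x.
  elim: n => [|n IH].
    rewrite big_ord0 -[RHS](int_cst P); apply: eq_Rintegral => x _.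
    by rewrite big_ord0.
  rewrite big_ord_recr/= -IH -intD//; last exact: sumc.
  by apply: eq_Rintegral => x _; rewrite big_ord_recr.
have {1}-> : \int[P]_x g x = \sum_(i < N) \int[P]_x G i x by rewrite -intsum {1}gE.
(* The shift by one layer costs only the first layer, at most [1/N], which is below [e]. *)
have tele n : \sum_(i < n.+1) L (G i) <= N%:R^-1 + \sum_(i < n) \int[P]_x G i x.
  elim: n => [|n IH].
    rewrite big_ord_recr !big_ord0/= add0r addr0 (le_trans (LG 0%N))//.
    by rewrite ler_piMr ?(ltW Ni0)//; exact: fm_le1.
  rewrite big_ord_recr [in leRHS]big_ord_recr/= addrA lerD//.
  exact: (le_trans (LG n.+1) (IG n)).
apply: (@le_trans _ _ (\sum_(i < N.+1) L (G i))).
  by rewrite big_ord_recr/= lerDl L0.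
by rewrite (le_trans (tele N))// lerD2r ltW.
Qed.

Let L_le_int g : continuous g -> L g <= \int[P]_x g x.
Proof.
move=> gc; have [M0 HM0] := continuous_bounded Xc gc.
pose M := Num.max M0 1; have Mp : 0 < M by rewrite /M lt_max ltr01 orbT.
have HM x : `|g x| <= M by rewrite le_max HM0.
pose h x := (2 * M)^-1 * g x + 2^-1.
have hc : continuous h by apply: Dc => //; exact: Zc.
have h01 x : 0 <= h x <= 1.
  have := HM x; rewrite ler_norml => /andP[g1 g2].
  have -> : h x = (g x + M) / (2 * M) by rewrite /h; field; rewrite gt_eqF.
  rewrite divr_ge0 ?ler_pdivrMr//=; lra.
have := L_le_int01 hc h01; rewrite /h LD//; last exact: Zc.
rewrite intD//; last exact: Zc.
rewrite LZ// intZ// Lcst int_cst lerD2r ler_pM2l//.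
by rewrite invr_gt0; lra.
Qed.

(** One inequality is enough: applied to [-g] it yields the reverse one. *)
Lemma riesz_int g : continuous g -> \int[P]_x g x = L g.
Proof.
move=> gc; apply/eqP; rewrite eq_le L_le_int// andbT.
have nc : continuous (fun x => -1 * g x) by exact: Zc.
have := L_le_int nc; rewrite LZ// intZ//; lra.
Qed.

End Construction.

Theorem riesz L : pos_functional L ->
  exists mu : probability (borel X) R, forall g, continuous g -> \int[mu]_x g x = L g.
Proof. by move=> HL; exists (riesz_measure L); exact: riesz_int HL. Qed.

End Riesz.

(** * Weak limits of probability measures *)

Section WeakLimits.
Variables (R : realType) (X : pmetricType R).
Hypothesis Xc : compact [set: X].
Implicit Types (g h : X -> R) (mu nu : probability (borel X) R).

Lemma pos_functional_int mu : @pos_functional R X (fun g => \int[mu]_x g x).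
Proof.
split=> [g h gc hc|c g gc|g gc g0|]; [exact: intD|exact: intZ| |exact: int_cst].
exact: Rintegral_ge0.
Qed.

Lemma pos_functional_le L g h : @pos_functional R X L -> continuous g -> continuous h ->
  (forall x, g x <= h x) -> L g <= L h.
Proof.
move=> [LD LZ L0 _] gc hc gh.
have nc : continuous (fun x => -1 * g x).
  by move=> x; apply: cvgM; [exact: cvg_cst|exact: gc].
have dc : continuous (fun x => h x + -1 * g x).
  by move=> x; apply: cvgD; [exact: hc|exact: nc].
have -> : L h = L g + L (fun x => h x + -1 * g x).
  by rewrite -LD//; congr L; apply/funext => x; ring.
by rewrite lerDl L0// => x; rewrite mulN1r subr_ge0.
Qed.

Lemma pos_functional_norm L g M : @pos_functional R X L -> continuous g ->
  (forall x, `|g x| <= M) -> `|L g| <= M.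
Proof.
move=> HL gc gM; have [LD LZ L0 L1] := HL.
have cc (c : R) : continuous (fun _ : X => c) by move=> x; exact: cvg_cst.
have Lc c : L (fun=> c) = c.
  by rewrite -[RHS]mulr1 -[X in _ = _ * X]L1 -LZ//; congr L; apply/funext => x; rewrite mulr1.
rewrite ler_norml -{1}(Lc (- M)) -{2}(Lc M); apply/andP; split;
  by apply: pos_functional_le => // x; have := gM x; rewrite ler_norml => /andP[].
Qed.

(** Boundedness gives a limit for each [g], and linearity and positivity survive. The sequence
    consists of functionals because the orbit averages in Misiurewicz's argument arise as such. *)
Theorem functional_ultralimit (L : nat -> (X -> R) -> R) :
  (forall n, pos_functional (L n)) ->
  exists mu, forall g, continuous g -> (fun n => L n g) @ freeU --> \int[mu]_x g x.
Proof.
move=> HL.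
have cL g : continuous g -> cvg ((fun n => L n g) @ freeU).
  move=> gc; have [M HM] := continuous_bounded Xc gc.
  by apply: (@freeU_bounded_cvg _ _ M) => n; exact: pos_functional_norm.
pose Lim g := lim ((fun n => L n g) @ freeU).
have [] := @riesz R X Xc Lim.
  split=> [g h gc hc|c g gc|g gc g0|]; rewrite /Lim.
  - have -> : (fun n => L n (fun x => g x + h x)) = (fun n => L n g + L n h).
      by apply/funext => n; have [-> //] := HL n.
    by apply: limD; exact: cL.
  - have -> : (fun n => L n (fun x => c * g x)) = (fun n => c * L n g).
      by apply/funext => n; have [_ -> //] := HL n.
    by apply: cvg_lim => //; apply: cvgM; [exact: cvg_cst|exact: cL].
  - apply: limr_ge; first exact: cL.
    by apply: nearW => n; have [_ _ L0 _] := HL n; exact: L0.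
  - have -> : (fun n => L n (fun=> 1)) = (fun=> 1).
      by apply/funext => n; have [_ _ _ ->] := HL n.
    by apply: cvg_lim => //; exact: cvg_cst.
move=> mu Hmu; exists mu => g gc; rewrite Hmu//; exact: cL.
Qed.

Definition wcvg (mu_ : nat -> probability (borel X) R) mu :=
  forall g, continuous g -> (fun n => \int[mu_ n]_x g x) @ freeU --> \int[mu]_x g x.

Lemma wcvg_subseq (mu_ : nat -> probability (borel X) R) : exists mu, wcvg mu_ mu.
Proof. by apply: functional_ultralimit => n; exact: pos_functional_int. Qed.

Section Invariance.
Variable f : X -> X.
Hypothesis fc : continuous f.

Let compc g : continuous g -> continuous (g \o f).
Proof. by move=> gc x; apply: continuous_comp; [exact: fc|exact: gc]. Qed.

Let mf : measurable_fun setT (f : borel X -> borel X).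
Proof. exact: borel_continuous_map. Qed.

Lemma measurable_preim (A : set (borel X)) : measurable A -> measurable (f @^-1` A : set (borel X)).
Proof. by move=> mA; have := mf measurableT mA; rewrite setTI. Qed.

Let image mu : probability (borel X) R := distribution mu (mfun_Sub (mem_set mf)).

Let int_image mu g : continuous g -> \int[image mu]_x g x = \int[mu]_x g (f x).
Proof.
move=> gc; rewrite /Rintegral/= integral_distribution//.
  by apply/measurable_EFinP; exact: borel_continuous.
by apply: continuous_integrable => //; exact: compc.
Qed.

(** Weak limits only see integrals of continuous functions, so this is the form of invariance that
    passes to them; these integrals determine the measure. *)
Lemma invariantP mu : invariant_measures f mu <->
  forall g, continuous g -> \int[mu]_x g (f x) = \int[mu]_x g x.
Proof.
split=> [fmu g gc|h A mA].
  rewrite -int_image//; rewrite /Rintegral; congr fine.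
  by apply: eq_measure_integral => A mA _; exact: fmu.
have := @int_measure_eq R X Xc (image mu) mu _ A mA; apply.
by move=> g gc; rewrite int_image// h.
Qed.

Lemma wcvg_invariant (mu_ : nat -> probability (borel X) R) mu :
  (forall n, invariant_measures f (mu_ n)) -> wcvg mu_ mu -> invariant_measures f mu.
Proof.
move=> fmu cmu; apply/invariantP => g gc.
have h1 := cmu _ (compc gc); have h2 := cmu _ gc.
move: h1; under [X in X @ _]eq_fun do rewrite /= (invariantP _).1//.
by move=> h1; apply: cvg_unique h1 h2; exact: norm_hausdorff.
Qed.

Lemma fm_preimage mu (A : set X) : invariant_measures f mu ->
  measurable (A : set (borel X)) -> fm mu (f @^-1` A) = fm mu A.
Proof. by move=> fmu mA; congr fine; exact: fmu. Qed.

End Invariance.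

Lemma fm_setU mu (A B : set X) : measurable (A : set (borel X)) ->
  measurable (B : set (borel X)) -> A `&` B = set0 ->
  fm mu (A `|` B) = fm mu A + fm mu B.
Proof.
move=> mA mB AB; apply: EFin_inj; rewrite EFinD.
have := measureU mu mA mB AB; rewrite /= => h.
by rewrite -(fmE mu (measurableU _ _ mA mB)) -(fmE mu mA) -(fmE mu mB).
Qed.

Lemma fm_set0 mu : fm mu set0 = 0.
Proof. by rewrite /fm measure0. Qed.

(* Sets sandwiched between continuous functions with almost equal integrals,
   i.e. those whose boundary is mu-null. *)
Definition contset mu (A : set X) := measurable (A : set (borel X)) /\
  forall e, 0 < e -> exists g h, [/\ continuous g, continuous h,
   (forall x, 0 <= g x <= 1) /\ (forall x, 0 <= h x <= 1),
   (forall x, ~ A x -> g x = 0) /\ (forall x, A x -> h x = 1) &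
   \int[mu]_x h x - \int[mu]_x g x <= e].

Let compl_int mu g : continuous g -> \int[mu]_x (1 - g x) = 1 - \int[mu]_x g x.
Proof.
by move=> gc; rewrite (@intB R X Xc mu (fun=> 1) g)// ?int_cst// => x; exact: cvg_cst.
Qed.

Let complc g : continuous g -> continuous (fun x => 1 - g x).
Proof. by move=> gc x; apply: continuousB; [exact: cvg_cst|exact: gc]. Qed.

Lemma contsetC mu A : contset mu A -> contset mu (~` A).
Proof.
move=> [mA HA]; split; first exact: measurableC.
move=> e /HA[g [h [gc hc [g01 h01] [gA hA] gh]]].
exists (fun x => 1 - h x), (fun x => 1 - g x); split; try exact: complc.
- split=> x; first by have /andP[] := h01 x; lra.
  by have /andP[] := g01 x; lra.
- split=> x; first by move=> /contrapT/hA ->; rewrite subrr.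
  by move=> /gA ->; rewrite subr0.
- by rewrite !compl_int//; lra.
Qed.

(** The sandwich for the intersection is the product of the two, with gap controlled by
    [h h' - g g' = (h - g) h' + (h' - g') g]. *)
Lemma contsetI mu A B : contset mu A -> contset mu B -> contset mu (A `&` B).
Proof.
move=> [mA HA] [mB HB]; split; first exact: measurableI.
move=> e e0; have e20 : 0 < e / 2 by lra.
have [g [h [gc hc [g01 h01] [gA hA] gh]]] := HA _ e20.
have [g' [h' [g'c h'c [g'01 h'01] [g'A h'A] g'h']]] := HB _ e20.
have Mc (u v : X -> R) : continuous u -> continuous v -> continuous (fun x => u x * v x : R).
  by move=> uc vc x; apply: continuousM; [exact: uc|exact: vc].
have Bc (u v : X -> R) : continuous u -> continuous v -> continuous (fun x => u x - v x : R).
  by move=> uc vc x; apply: continuousB; [exact: uc|exact: vc].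
have Dc (u v : X -> R) : continuous u -> continuous v -> continuous (fun x => u x + v x : R).
  by move=> uc vc x; apply: continuousD; [exact: uc|exact: vc].
have M01 (a b : R) : 0 <= a <= 1 -> 0 <= b <= 1 -> 0 <= a * b <= 1.
  by move=> /andP[a0 a1] /andP[b0 b1]; rewrite mulr_ge0//= mulr_ile1.
exists (fun x => g x * g' x), (fun x => h x * h' x); split; try exact: Mc.
- by split=> x; exact: M01.
- split=> x; last by move=> [/hA -> /h'A ->]; rewrite mulr1.
  move=> /not_andP[/gA ->|/g'A ->]; by rewrite ?mul0r ?mulr0.
- have gleh x : g x <= h x.
    have [Ax|Ax] := pselect (A x); first by rewrite hA// (andP (g01 x)).2.
    by rewrite gA// (andP (h01 x)).1.
  have g'leh' x : g' x <= h' x.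
    have [Ax|Ax] := pselect (B x); first by rewrite h'A// (andP (g'01 x)).2.
    by rewrite g'A// (andP (h'01 x)).1.
  rewrite -intB//; try exact: Mc.
  apply: (@le_trans _ _ (\int[mu]_x ((h x - g x) + (h' x - g' x)))).
    apply: int_le => //; [by apply: Bc; exact: Mc|by apply: Dc; exact: Bc|move=> x].
    have /andP[a0 a1] := g01 x; have /andP[b0 b1] := h01 x.
    have /andP[c0 c1] := g'01 x; have /andP[d0 d1] := h'01 x.
    have -> : h x * h' x - g x * g' x = (h x - g x) * h' x + (h' x - g' x) * g x by ring.
    by rewrite lerD// ler_piMr// subr_ge0.
  rewrite intD; [|exact: Xc|exact: Bc|exact: Bc]; rewrite !intB//; lra.
Qed.

Lemma contsetT mu : contset mu setT.
Proof.
have cc (c : R) : continuous (fun _ : X => c) by move=> x; exact: cvg_cst.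
split; first exact: measurableT.
move=> e e0; exists (fun=> 1), (fun=> 1); split; try exact: cc.
- by split=> x; rewrite ler01 lexx.
- by split=> [x /(_ I)|].
- by rewrite subrr ltW.
Qed.

Lemma contset_bigI mu n (A : 'I_n -> set X) : (forall i, contset mu (A i)) ->
  contset mu (\bigcap_(i in [set: 'I_n]) A i).
Proof.
move=> HA; have -> : \bigcap_(i in [set: 'I_n]) A i = \big[setI/setT]_(i < n) A i.
  rewrite -bigcap_seq; apply: eq_bigcapl; split => // i _ /=.
  exact: mem_index_enum.
by apply: big_ind => //; [exact: contsetT|exact: contsetI].
Qed.

Lemma contset_preimage f mu A : continuous f -> invariant_measures f mu ->
  contset mu A -> contset mu (f @^-1` A).
Proof.
move=> fc fmu [mA HA]; split; first exact: measurable_preim.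
have compc g : continuous g -> continuous (g \o f).
  by move=> gc x; apply: continuous_comp; [exact: fc|exact: gc].
move=> e /HA[g [h [gc hc [g01 h01] [gA hA] gh]]].
exists (g \o f), (h \o f); split; try exact: compc.
- by split=> x /=.
- by split=> x /=; [exact: gA|exact: hA].
- by rewrite /= !(invariantP fc mu).1.
Qed.

Lemma contset_iter f mu A n : continuous f -> invariant_measures f mu ->
  contset mu A -> contset mu (iter n f @^-1` A).
Proof.
move=> fc fmu cA; elim: n => [|n IH]; first by rewrite preimage_id.
have -> : iter n.+1 f @^-1` A = f @^-1` (iter n f @^-1` A).
  by apply/seteqP; split=> x /=; rewrite -iterSr.
exact: contset_preimage.
Qed.

(** Radii of spheres with positive mass are atoms of the law of the distance to [x], so they are
    countably many, whereas a nondegenerate interval has positive Lebesgue measure. *)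
Lemma null_sphere mu x (a b : R) : a < b ->
  exists2 r, a < r < b & fm mu [set y | mdist x y = r] = 0.
Proof.
move=> ab; apply: contrapT => /forall2NP H.
have md : measurable_fun setT (mdist x : borel X -> R).
  exact: (borel_continuous (@mdist_continuous R X x)).
have := @pmf_gt0_countable _ (borel X) R mu (mfun_Sub (mem_set md)).
set D := [set r | _] => cD.
have ID : `]a, b[ `<=` D.
  move=> r; rewrite /= in_itv/= => rab; rewrite /D /=.
  case: (H r) => [//|/eqP]; rewrite lt_neqAle fine_ge0// andbT eq_sym.
  by rewrite /fm /pmf; apply.
have : countable (`]a, b[ : set R) by exact: sub_countable (subset_card_le ID) cD.
move=> /countable_lebesgue_measure0; rewrite lebesgue_measure_itv/= lte_fin ab.
by rewrite -EFinB => /eqP; rewrite eqe subr_eq0 gt_eqF.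
Qed.

(** When the sphere is null, the ball [U] and the exterior [W] share the full mass; a tent of [U]
    and one minus a tent of [W] form the sandwich. *)
Lemma contset_ball mu x (a b : R) : 0 < a < b ->
  exists2 r, a < r < b & contset mu (ball x r).
Proof.
move=> /andP[a0 ab]; have [r /andP[ar rb] nr] := null_sphere mu x ab.
exists r; first by rewrite ar.
have r0 : 0 < r by rewrite (lt_trans a0).
have dc := @mdist_continuous R X x.
pose U := [set y | mdist x y < r]; pose W := [set y | r < mdist x y].
have oU : open U.
  have -> : U = mdist x @^-1` `]-oo, r[%classic by apply/seteqP; split=> y; rewrite /U /= in_itv.
  by apply: open_comp => [y _|]; [exact: dc|exact: interval_open].
have oW : open W.
  have -> : W = mdist x @^-1` `]r, +oo[%classic.
    by apply/seteqP; split=> y; rewrite /W /= in_itv/= andbT.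
  by apply: open_comp => [y _|]; [exact: dc|exact: interval_open].
rewrite ballEmdist; have mU := borel_open oU; have mW := borel_open oW.
split=> // e e0.
have UW : fm mu U + fm mu W = 1.
  have -> : fm mu W = fm mu (~` U).
    have mS : measurable ([set y | mdist x y = r] : set (borel X)).
      have -> : [set y | mdist x y = r] = ~` (U `|` W).
        apply/seteqP; split=> y; rewrite /U /W /= => h.
          by rewrite h ltxx => -[].
        by apply/eqP; rewrite eq_le !leNgt; apply/andP; split; apply/negP => ?; apply: h; [right|left].
      by apply: measurableC; exact: measurableU.
    have -> : ~` U = W `|` [set y | mdist x y = r].
      apply/seteqP; split=> y; rewrite /U /W /=.
        by move=> /negP; rewrite -leNgt le_eqVlt => /orP[/eqP ->|]; [right|left].
      by move=> [/ltW yr|->]; apply/negP; rewrite -leNgt.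
    rewrite fm_setU// ?nr ?addr0//.
    by apply/seteqP; split=> // y; rewrite /W /= => -[+ yr]; rewrite yr ltxx.
  by rewrite fm_setC//; ring.
have e20 : 0 < e / 2 by lra.
have /cvgrPdist_lt/(_ _ e20) h1 := @int_tent_cvg R X Xc mu U oU.
have /cvgrPdist_lt/(_ _ e20) h2 := @int_tent_cvg R X Xc mu W oW.
have [n [n1 n2]] : exists n : nat, `|fm mu U - \int[mu]_x tent U n x| < e / 2 /\
   `|fm mu W - \int[mu]_x tent W n x| < e / 2.
  have [n [? ?]] := filter_ex (filterI h1 h2).
  by exists n.
exists (tent U n), (fun y => 1 - tent W n y); split.
- exact: tent_continuous.
- by apply: complc; exact: tent_continuous.
- split=> y; first by rewrite tent_ge0 tent_le1.
  by have := tent_ge0 W n y; have := tent_le1 W n y; move=> *; apply/andP; split; lra.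
- split=> y; first exact: tent_out.
  move=> yr; rewrite tent_out ?subr0// /W /= => yr'.
  by have := lt_trans yr yr'; rewrite ltxx.
- rewrite compl_int; last exact: tent_continuous.
  by move: n1 n2; rewrite !ltr_norml => /andP[? ?] /andP[? ?]; lra.
Qed.

(** A portmanteau argument. [p n] stands for the value at the indicator of [A], where convergence of
    [L n] is not given; it is caught between the values at functions below and above the
    indicator. *)
Lemma contset_cvg mu A (L : nat -> (X -> R) -> R) (p : nat -> R) :
  contset mu A ->
  (forall g, continuous g -> (fun n => L n g) @ freeU --> \int[mu]_x g x) ->
  (forall n g, (forall x, 0 <= g x <= 1) -> (forall x, ~ A x -> g x = 0) -> L n g <= p n) ->
  (forall n h, (forall x, 0 <= h x <= 1) -> (forall x, A x -> h x = 1) -> p n <= L n h) ->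
  p @ freeU --> fm mu A.
Proof.
move=> [mA HA] HL pg ph; apply/cvgrPdist_lt => e e0.
have e20 : 0 < e / 2 by lra.
have [g [h [gc hc [g01 h01] [gA hA] gh]]] := HA _ e20.
have /cvgrPdist_lt/(_ _ e20) Lg := HL _ gc.
have /cvgrPdist_lt/(_ _ e20) Lh := HL _ hc.
have gfm : \int[mu]_x g x <= fm mu A.
  apply: int_le_fm => //; first by move=> x; have /andP[] := g01 x.
  by move=> x /gA ->.
have fmh : fm mu A <= \int[mu]_x h x.
  apply: fm_le_int => //; first by move=> x; have /andP[] := h01 x.
  by move=> x /hA ->.
near=> n.
have : `|\int[mu]_x g x - L n g| < e / 2 by near: n.
have : `|\int[mu]_x h x - L n h| < e / 2 by near: n.
have := pg n g g01 gA; have := ph n h h01 hA.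
rewrite !ltr_norml => q1 q2 /andP[q3 q4] /andP[q5 q6].
apply/andP; split; lra.
Unshelve. all: by end_near. Qed.

End WeakLimits.

(** * Entropy as a function of the measure *)

Section MeasureConstructions.
Variables (R : realType) (X : pmetricType R).
Hypothesis Xc : compact [set: X].
Implicit Types (g h : X -> R) (mu nu : probability (borel X) R).

Lemma cond_prob_exists mu (A : set (borel X)) : measurable A -> 0 < fm mu A ->
  exists P : probability (borel X) R, forall B : set (borel X), measurable B ->
    fm P B = (fm mu A)^-1 * fm mu (B `&` A).
Proof.
move=> mA a0; have ai0 : 0 <= (fm mu A)^-1 by rewrite invr_ge0 ltW.
pose m : {measure set (borel X) -> \bar R} := mscale (NngNum ai0) (mrestr mu mA).
have mE B : m B = ((fm mu A)^-1%:E * mu (B `&` A))%E by [].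
have mT : m setT = 1%E.
  by rewrite mE setTI (fmE mu mA) -EFinM mulVf// gt_eqF.
pose P : probability (borel X) R :=
  HB.pack (Measure.sort m) (Measure_isProbability.Build _ _ _ (Measure.sort m) mT).
exists P => B mB; rewrite /fm -[P B]/(m B) mE.
by rewrite (fmE mu (measurableI _ _ mB mA)) -EFinM.
Qed.

(** A relation and not an operation, so that a given measure can be recognized as a mixture, as
    happens in [ergodic_max]. *)
Definition is_mix (t : R) mu nu (P : probability (borel X) R) :=
  forall A : set (borel X), measurable A -> fm P A = t * fm mu A + (1 - t) * fm nu A.

Lemma mix_exists (t : R) mu nu : 0 <= t <= 1 -> exists P, is_mix t mu nu P.
Proof.
move=> /andP[t0 t1]; have s0 : 0 <= 1 - t by rewrite subr_ge0.
pose m : {measure set (borel X) -> \bar R} :=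
  measure_add (mscale (NngNum t0) mu) (mscale (NngNum s0) nu).
have mE B : m B = (t%:E * mu B + (1 - t)%:E * nu B)%E := measure_addE _ _ B.
have mT : m setT = 1%E.
  rewrite mE; have -> := probability_setT mu; have -> := probability_setT nu.
  by rewrite !mule1 -EFinD addrC subrK.
pose P : probability (borel X) R :=
  HB.pack (Measure.sort m) (Measure_isProbability.Build _ _ _ (Measure.sort m) mT).
exists P => B mB; rewrite /fm -[P B]/(m B) mE.
by rewrite (fmE mu mB) (fmE nu mB) -!EFinM -EFinD.
Qed.

(** Adding a bound [M] of [g] reduces to nonnegative integrands, for which the integral is additive
    in the measure. *)
Lemma mix_int (t : R) mu nu P g : 0 <= t <= 1 -> is_mix t mu nu P -> continuous g ->
  \int[P]_x g x = t * \int[mu]_x g x + (1 - t) * \int[nu]_x g x.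
Proof.
move=> /andP[t0 t1] HP.
have s0 : 0 <= 1 - t by rewrite subr_ge0.
pose m : {measure set (borel X) -> \bar R} :=
  measure_add (mscale (NngNum t0) mu) (mscale (NngNum s0) nu).
have mP (A : set (borel X)) : measurable A -> P A = m A.
  have -> : m A = (t%:E * mu A + (1 - t)%:E * nu A)%E := measure_addE _ _ A.
  move=> mA; rewrite (fmE P mA) HP//.
  by rewrite (fmE mu mA) (fmE nu mA) -!EFinM -EFinD.
have pos (k : X -> R) : continuous k -> (forall x, 0 <= k x) ->
    \int[P]_x k x = t * \int[mu]_x k x + (1 - t) * \int[nu]_x k x.
  move=> kc k0; have mk : measurable_fun setT (EFin \o (k : borel X -> R)).
    by apply/measurable_EFinP; exact: borel_continuous.
  have fin (Q : probability (borel X) R) : (\int[Q]_x (k x)%:E \is a fin_num)%E.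
    by apply: integrable_fin_num => //; exact: continuous_integrable.
  have -> : \int[P]_x k x = \int[m]_x k x.
    by rewrite /Rintegral; congr fine; apply: eq_measure_integral => A mA _; exact: mP.
  rewrite /Rintegral ge0_integral_measure_add//; last by move=> x _; rewrite lee_fin.
  rewrite !ge0_integral_mscale//=; try by move=> x _; rewrite lee_fin.
  by rewrite fineD ?fineM// fin_numM.
move=> gc; have [M HM] := continuous_bounded Xc gc.
have cM : continuous (fun _ : X => M) by move=> x; exact: cvg_cst.
have gMc : continuous (fun x => g x + M).
  by move=> x; apply: continuousD; [exact: gc|exact: cM].
have := pos _ gMc; rewrite !(intD Xc)// !int_cst => pos'.
have : \int[P]_x g x + M = t * (\int[mu]_x g x + M) + (1 - t) * (\int[nu]_x g x + M).
  by apply: pos' => x; have := HM x; rewrite ler_norml => /andP[]; lra.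
lra.
Qed.

Lemma mix_invariant (f : X -> X) t mu nu P : continuous f -> is_mix t mu nu P ->
  invariant_measures f mu -> invariant_measures f nu -> invariant_measures f P.
Proof.
move=> fc HP fmu fnu A mA.
have mfA := measurable_preim fc mA.
by rewrite (fmE P mA) (fmE P mfA) !HP// !(fm_preimage fmu) ?(fm_preimage fnu).
Qed.

End MeasureConstructions.

(** * Finite-valued observables and their laws *)

Section Law.
Variables (R : realType) (X : pmetricType R).
Implicit Types (mu nu : probability (borel X) R).

(** Finite partitions are handled as finite-valued maps: joins become pairs or words, and coarsening
    becomes composition. *)
Definition fmeas (I : finType) (Z : X -> I) :=
  forall i, measurable ([set x | Z x = i] : set (borel X)).

Definition law mu (I : finType) (Z : X -> I) (i : I) : R := fm mu [set x | Z x = i].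

Lemma fmeas_preim (I : finType) (Z : X -> I) (P : pred I) : fmeas Z ->
  measurable ([set x | P (Z x)] : set (borel X)).
Proof.
move=> mZ; have -> : [set x | P (Z x)] =
    \bigcup_(i in [set i | P i]) [set x | Z x = i].
  by apply/seteqP; split=> [x Px|x [i Pi /= ->]//]; exists (Z x).
by apply: fin_bigcup_measurable => // i _; exact: mZ.
Qed.

Lemma fmeas_comp (I J : finType) (Z : X -> I) (g : I -> J) : fmeas Z -> fmeas (g \o Z).
Proof.
move=> mZ j; have -> : [set x | (g \o Z) x = j] = [set x | g (Z x) == j].
  by apply/seteqP; split=> x /= /eqP.
exact: (@fmeas_preim I Z (fun i => g i == j)).
Qed.

Lemma fm_fmeas mu (I : finType) (Z : X -> I) (P : pred I) : fmeas Z ->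
  fm mu [set x | P (Z x)] = \sum_(i | P i) law mu Z i.
Proof.
move=> mZ; rewrite -big_filter.
have : uniq [seq i <- index_enum I | P i] by rewrite filter_uniq// index_enum_uniq.
have -> : [set x | P (Z x)] = [set x | Z x \in [seq i <- index_enum I | P i]].
  by apply/seteqP; split=> x /=; rewrite mem_filter mem_index_enum andbT.
elim: {P} [seq i <- index_enum I | P i] => [_|i s IH /= /andP[si us]].
  by rewrite big_nil -[RHS](fm_set0 mu); congr fm; apply/seteqP; split.
rewrite big_cons -IH// /law -fm_setU//.
- congr fm; apply/seteqP; split=> x /=; rewrite inE; first by move=> /orP[/eqP|]; [left|right].
  by move=> [->|->]; rewrite ?eqxx ?orbT.
- exact: (@fmeas_preim I Z (mem s)).
- by apply/seteqP; split=> // x /= [-> ]; rewrite (negbTE si).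
Qed.

Lemma law_comp mu (I J : finType) (Z : X -> I) (g : I -> J) : fmeas Z ->
  law mu (g \o Z) = pushd (law mu Z) g.
Proof.
move=> mZ; apply/funext => j; rewrite /pushd -fm_fmeas//.
by congr fm; apply/seteqP; split=> x /= /eqP.
Qed.

Lemma law_distr mu (I : finType) (Z : X -> I) : fmeas Z -> distr (law mu Z).
Proof.
move=> mZ; split=> [i|]; first exact: fm_ge0.
by rewrite -(@fm_fmeas mu I Z predT)// -(fm_setT mu); congr fm; apply/seteqP.
Qed.

Lemma fmeas_pair (I J : finType) (Z : X -> I) (W : X -> J) : fmeas Z -> fmeas W ->
  fmeas (fun x => (Z x, W x)).
Proof.
move=> mZ mW [i j]; have -> : [set x | (Z x, W x) = (i, j)] =
    [set x | Z x = i] `&` [set x | W x = j].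
  by apply/seteqP; split=> x /= [-> ->].
exact: measurableI.
Qed.

End Law.

Lemma cvg_invn (R : realType) : (fun n : nat => n%:R^-1 : R) @ \oo --> 0.
Proof. by rewrite -cvg_shiftS; exact: cvg_harmonic. Qed.

(** * Entropy of a partition along orbits, and affinity in the measure *)

Section Entropy.
Variables (R : realType) (X : pmetricType R) (f : X -> X).
Hypotheses (Xc : compact [set: X]) (fc : continuous f).
Implicit Types (mu nu : probability (borel X) R).

Definition word k (idx : X -> 'I_k) n (x : X) : {ffun 'I_n -> 'I_k} :=
  [ffun i : 'I_n => idx (iter i f x)].

Definition kent mu k (idx : X -> 'I_k) : R :=
  limn (fun n => n%:R^-1 * Hent (law mu (word idx n))).

Let miter n (A : set (borel X)) : measurable A -> measurable (iter n f @^-1` A : set (borel X)).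
Proof. by move=> mA; apply: measurable_preim => //; exact: borel_continuous_iter. Qed.

Lemma fmeas_word k (idx : X -> 'I_k) n : fmeas idx -> fmeas (word idx n).
Proof.
move=> mi w; have -> : [set x | word idx n x = w] =
    \bigcap_(i in [set: 'I_n]) (iter i f @^-1` [set x | idx x = w i]).
  apply/seteqP; split=> [x /= <- i _ /=|x H /=]; first by rewrite ffunE.
  by apply/ffunP => i; rewrite ffunE; exact: H.
by apply: fin_bigcap_measurable => // i _; apply: miter; exact: mi.
Qed.

Arguments fmeas_word {k idx} n mi.

Lemma entropyE mu : entropy f mu = ereal_sup [set h | exists k (idx : X -> 'I_k),
  fmeas idx /\ h = (kent mu idx)%:E].
Proof.
congr ereal_sup; apply/seteqP; split=> h [k].
  move=> [P [[mP tP uP] ->]].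
  have ex x : exists i, P i x.
    by have : setT x by []; rewrite -uP => -[i _ Pix]; exists i.
  pose idx x := sval (cid (ex x)).
  have idxP x : P (idx x) x by rewrite /idx; case: cid.
  have PE i : P i = [set x | idx x = i].
    apply/seteqP; split=> [x Px|x <-]//=.
    by apply: (tP _ _ I I); exists x; split.
  exists k, idx; split; first by move=> i; rewrite -PE.
  congr (_%:E); congr (limn _); apply/funext => n; congr (_ * _).
  rewrite /shannon_entropy /Hent; congr (- _); apply: eq_bigr => w _.
  suff -> : @refined_partition R X f k P n w = [set x | word idx n x = w] by [].
  apply/seteqP; split=> [x Hx|x /= <- i _ /=]; last by rewrite ffunE.
  by apply/ffunP => i; rewrite ffunE; have := Hx i I; rewrite PE.
move=> [idx [mi ->]]; exists k, (fun i => [set x | idx x = i]); split.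
  split=> //; last by apply/seteqP; split=> // x _; exists (idx x).
  by move=> i j _ _ [x [/= -> ->]].
congr (_%:E); congr (limn _); apply/funext => n; congr (_ * _).
rewrite /shannon_entropy /Hent; congr (- _); apply: eq_bigr => w _.
suff -> : refined_partition f (fun i : 'I_k => [set x | idx x = i]) w =
  [set x | word idx n x = w] by [].
apply/seteqP; split=> [x Hx|x /= <- i _ /=]; last by rewrite ffunE.
by apply/ffunP => i; rewrite ffunE; exact: (Hx i I).
Qed.

Section Invariant.
Variable mu : probability (borel X) R.
Hypothesis fmu : invariant_measures f mu.

Lemma fm_iter n (A : set (borel X)) : measurable A -> fm mu (iter n f @^-1` A) = fm mu A.
Proof.
move=> mA; elim: n => [|n IH]; first by rewrite preimage_id.
have -> : iter n.+1 f @^-1` A = f @^-1` (iter n f @^-1` A).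
  by apply/seteqP; split=> x /=; rewrite -iterSr.
by rewrite fm_preimage//; exact: miter.
Qed.

Lemma Hent_word0 k (idx : X -> 'I_k) : fmeas idx -> Hent (law mu (word idx 0)) = 0.
Proof.
move=> mi; have d0 := law_distr mu (fmeas_word 0 mi).
apply/eqP; rewrite eq_le Hent_ge0// andbT (le_trans (Hent_le_card d0))//.
by rewrite card_ffun !card_ord expn0 ln1.
Qed.

(** A word of length [n + m] is determined by its first [n] letters and by the word of length [m]
    read from time [n]; by invariance the latter has the law of [word idx m]. *)
Lemma Hent_wordD k (idx : X -> 'I_k) n m : fmeas idx ->
  Hent (law mu (word idx (n + m))) <=
  Hent (law mu (word idx n)) + Hent (law mu (word idx m)).
Proof.
move=> mi.
pose Z1 (w : {ffun 'I_(n + m) -> 'I_k}) := [ffun i : 'I_n => w (lshift m i)].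
pose Z2 (w : {ffun 'I_(n + m) -> 'I_k}) := [ffun i : 'I_m => w (rshift n i)].
have mw := fmeas_word (n + m) mi.
have E1 : word idx n = Z1 \o word idx (n + m).
  by apply/funext => x; apply/ffunP => i; rewrite !ffunE.
have E2 : word idx m \o iter n f = Z2 \o word idx (n + m).
  by apply/funext => x; apply/ffunP => i; rewrite !ffunE /= addnC iterD.
have E3 : law mu (word idx m) = law mu (Z2 \o word idx (n + m)).
  rewrite -E2; apply/funext => w; rewrite /law -(fm_iter n)//.
  exact: fmeas_word.
rewrite E3 E1 !law_comp// -{1}(pushd_id (law mu (word idx (n + m)))).
apply: Hent_pushd_subadd; first exact: law_distr.
move=> w w' e1 e2; apply/ffunP => i; case: (splitP i) => j ij.
  have -> : i = lshift m j by exact: val_inj.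
  by have := congr1 (fun h : {ffun 'I_n -> 'I_k} => h j) e1; rewrite !ffunE.
have -> : i = rshift n j by exact: val_inj.
by have := congr1 (fun h : {ffun 'I_m -> 'I_k} => h j) e2; rewrite !ffunE.
Qed.

Lemma kent_cvg k (idx : X -> 'I_k) : fmeas idx ->
  (fun n => n%:R^-1 * Hent (law mu (word idx n))) @ \oo --> kent mu idx.
Proof.
move=> mi; apply: cvgP; apply: fekete.
- by move=> n; apply: Hent_ge0; apply: law_distr; exact: fmeas_word.
- exact: Hent_word0.
- by move=> n m; exact: Hent_wordD.
Qed.

Lemma kent_ge0 k (idx : X -> 'I_k) : fmeas idx -> 0 <= kent mu idx.
Proof.
move=> mi; apply: limr_ge; [exact: cvgP (kent_cvg mi)|apply: nearW => n].
by rewrite mulr_ge0 ?invr_ge0// Hent_ge0//; apply: law_distr; exact: fmeas_word.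
Qed.

Lemma le_kent k l (jdx : X -> 'I_l) (g : 'I_l -> 'I_k) : fmeas jdx ->
  kent mu (g \o jdx) <= kent mu jdx.
Proof.
move=> mj; have mi : fmeas (g \o jdx) by exact: fmeas_comp.
apply: (ler_cvg_to (kent_cvg mi) (kent_cvg mj)).
apply: nearW => n; rewrite ler_wpM2l ?invr_ge0//.
pose G (w : {ffun 'I_n -> 'I_l}) := [ffun i => g (w i)].
have -> : word (g \o jdx) n = G \o word jdx n.
  by apply/funext => x; apply/ffunP => i; rewrite !ffunE.
have mw := fmeas_word n mj.
rewrite law_comp// -{2}(pushd_id (law mu (word jdx n))).
by apply: le_Hent_pushd => [w|w w' ->//]; rewrite (law_distr mu mw).1.
Qed.

Lemma entropy_ge0 : (0 <= entropy f mu)%E.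
Proof.
rewrite entropyE; apply: ereal_sup_ubound.
pose idx (x : X) : 'I_1 := ord0.
have mi : fmeas idx.
  by move=> i; have -> : [set x | idx x = i] = setT by apply/seteqP; split=> // x _ /=; rewrite [i]ord1.
exists 1%N, idx; split=> //; congr (_%:E); apply/eqP; rewrite eq_le kent_ge0//=.
apply: limr_le; [exact: cvgP (kent_cvg mi)|apply: nearW => n].
have := Hent_le_card (law_distr mu (fmeas_word n mi)).
rewrite card_ffun !card_ord exp1n ln1 => h.
by rewrite mulr_ge0_le0 ?invr_ge0.
Qed.

(** On an orbit of period [N] at most [N] words of any given length occur, so the entropy of words
    stays below [ln N]. *)
Lemma entropy_eq0 x : periodic_point f x -> mu (Defs.orbit f x) = 1%E -> entropy f mu = 0%E.
Proof.
move=> [N N0 fN] orb; apply/eqP; rewrite eq_le entropy_ge0 andbT entropyE.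
apply: ge_ereal_sup => _ [k [idx [mi ->]]]; rewrite lee_fin.
have modN n : iter n f x = iter (n %% N) f x.
  rewrite {1}(divn_eq n N) addnC iterD; congr (iter _ f _).
  by elim: (n %/ N)%N => [//|t IH]; rewrite mulSn iterD IH.
have mO : measurable (Defs.orbit f x : set (borel X)).
  have -> : Defs.orbit f x = \bigcup_n [set iter n f x].
    by apply/seteqP; split=> [_ [n _ <-]|y [n _ ->]]; exists n.
  apply: bigcupT_measurable => n; rewrite -(setCK [set iter n f x]).
  apply: measurableC; apply: borel_open; apply: closed_openC.
  by apply: accessible_closed_set1; apply/hausdorff_accessible; exact: metric_hausdorff.
have bnd n : Hent (law mu (word idx n)) <= ln N%:R.
  have mw := fmeas_word n mi.
  apply: (@Hent_supp_le _ _ _ [pred w in codom (fun i : 'I_N => word idx n (iter i f x))]).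
  - exact: law_distr.
  - move=> w wA; apply/eqP; rewrite eq_le fm_ge0 andbT.
    have -> : 0 = fm mu (~` Defs.orbit f x) :> R by rewrite fm_setC// /fm orb /= subrr.
    apply: fm_le; [exact: mw|exact: measurableC|].
    move=> y /= yw [n' _ n'y]; move: wA; rewrite inE -yw -n'y modN.
    by rewrite (codom_f (fun i : 'I_N => word idx n (iter i f x)) (Ordinal (ltn_pmod n' N0))).
  - by rewrite (leq_trans (card_size _))// size_codom card_ord.
have c0 : (fun n => n%:R^-1 * ln N%:R) @ \oo --> (0 : R).
  rewrite -[X in _ --> X](mul0r (ln N%:R)); apply: cvgM; last exact: cvg_cst.
  exact: cvg_invn.
apply: (ler_cvg_to (kent_cvg mi) c0); apply: nearW => n.
by rewrite ler_wpM2l ?invr_ge0.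
Qed.

End Invariant.

Section Affine.
Variables (t : R) (mu nu P : probability (borel X) R).
Hypotheses (t01 : 0 < t < 1) (HP : is_mix t mu nu P).
Hypotheses (fmu : invariant_measures f mu) (fnu : invariant_measures f nu).

Let fP : invariant_measures f P.
Proof. exact: mix_invariant HP fmu fnu. Qed.

Let law_mix (I : finType) (Z : X -> I) : fmeas Z ->
  law P Z = fun i => t * law mu Z i + (1 - t) * law nu Z i.
Proof. by move=> mZ; apply/funext => i; exact: HP. Qed.

(** Concavity and almost convexity squeeze the entropy of words, per unit time, between two
    sequences that differ by [C / n]. *)
Lemma kent_mix k (idx : X -> 'I_k) : fmeas idx ->
  kent P idx = t * kent mu idx + (1 - t) * kent nu idx.
Proof.
move=> mi; have /andP[t0 t1] := t01.
pose C : R := - (t * ln t) - (1 - t) * ln (1 - t).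
pose a n := n%:R^-1 * (t * Hent (law mu (word idx n)) + (1 - t) * Hent (law nu (word idx n))).
have ca : a @ \oo --> t * kent mu idx + (1 - t) * kent nu idx.
  have -> : a = fun n => t * (n%:R^-1 * Hent (law mu (word idx n))) +
                       (1 - t) * (n%:R^-1 * Hent (law nu (word idx n))).
    by apply/funext => n; rewrite /a; ring.
  by apply: cvgD; apply: cvgM; [exact: cvg_cst|exact: kent_cvg|exact: cvg_cst|exact: kent_cvg].
have cb : (fun n => a n + n%:R^-1 * C) @ \oo --> t * kent mu idx + (1 - t) * kent nu idx.
  rewrite -[X in _ --> X]addr0; apply: cvgD => //.
  rewrite -[X in _ --> X](mul0r C); apply: cvgM; last exact: cvg_cst.
  exact: cvg_invn.
suff : (fun n => n%:R^-1 * Hent (law P (word idx n))) @ \oo -->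
    t * kent mu idx + (1 - t) * kent nu idx.
  by move=> h; apply: cvg_unique (kent_cvg fP mi) h; exact: norm_hausdorff.
apply: squeeze_cvgr ca cb; apply: nearW => n.
have mw := fmeas_word n mi.
have dm := law_distr mu mw; have dn := law_distr nu mw.
rewrite /a -mulrDr law_mix//; apply/andP; split; rewrite ler_wpM2l ?invr_ge0//; last first.
  by rewrite /C; apply: Hent_almost_convex.
by apply: Hent_mix_ge; rewrite ?ltW.
Qed.

(** The upper bound holds partition by partition. For the lower bound, a partition suited to [mu]
    and one suited to [nu] are replaced by their join, which serves both measures. *)
Lemma entropy_mix : (entropy f P = t%:E * entropy f mu + (1 - t)%:E * entropy f nu)%E.
Proof.
have /andP[t0 t1] := t01; have s0 : 0 < 1 - t by lra.
have entmu := entropy_ge0 fmu; have entnu := entropy_ge0 fnu.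
have lekent (Q : probability (borel X) R) k (idx : X -> 'I_k) : fmeas idx ->
    ((kent Q idx)%:E <= entropy f Q)%E.
  by move=> mi; rewrite entropyE; apply: ereal_sup_ubound; exists k, idx.
apply/eqP; rewrite eq_le; apply/andP; split.
  rewrite {1}entropyE; apply: ge_ereal_sup => _ [k [idx [mi ->]]].
  rewrite kent_mix// EFinD !EFinM; apply: leeD.
    by apply: lee_wpmul2l; [rewrite lee_fin ltW|exact: lekent].
  by apply: lee_wpmul2l; [rewrite lee_fin ltW|exact: lekent].
have [EP|EP] := eqVneq (entropy f P) +oo%E; first by rewrite EP leey.
have EPfin : entropy f P \is a fin_num by rewrite ge0_fin_numE ?lt_neqAle ?EP ?leey// entropy_ge0.
have key k l (idx : X -> 'I_k) (jdx : X -> 'I_l) : fmeas idx -> fmeas jdx ->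
    t * kent mu idx + (1 - t) * kent nu jdx <= fine (entropy f P).
  move=> mi mj; pose r x := enum_rank (idx x, jdx x).
  have mr : fmeas r.
    by apply: (@fmeas_comp _ _ _ _ (fun x => (idx x, jdx x)) enum_rank); exact: fmeas_pair.
  have E1 : idx = (fun i => (enum_val i).1) \o r by apply/funext => x; rewrite /r /= enum_rankK.
  have E2 : jdx = (fun i => (enum_val i).2) \o r by apply/funext => x; rewrite /r /= enum_rankK.
  apply: (@le_trans _ _ (kent P r)).
    rewrite kent_mix// lerD// ler_pM2l// ?{1}E1 ?{1}E2; exact: le_kent.
  by rewrite -lee_fin fineK//; exact: lekent.
have kent0 (Q : probability (borel X) R) (fQ : invariant_measures f Q) : exists k (idx : X -> 'I_k),
    fmeas idx /\ 0 <= kent Q idx.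
  exists 1%N, (fun=> ord0).
  have mi : fmeas (fun _ : X => ord0 : 'I_1).
    by move=> i; have -> : [set x : X | ord0 = i] = setT by apply/seteqP; split=> // x _ /=; rewrite [i]ord1.
  by split=> //; exact: kent_ge0.
set E := fine (entropy f P) in key.
(* The two suprema are taken one after the other; the first yields the finiteness that the
   subtraction in the second relies on. *)
have mufin l (jdx : X -> 'I_l) : fmeas jdx ->
    (entropy f mu <= (t^-1 * (E - (1 - t) * kent nu jdx))%:E)%E.
  move=> mj; rewrite entropyE; apply: ge_ereal_sup => _ [k [idx [mi ->]]].
  by rewrite lee_fin ler_pdivlMl//; have := key _ _ _ _ mi mj; lra.
have [l0 [j0 [mj0 _]]] := kent0 _ fnu.
have mfin : entropy f mu \is a fin_num.
  by rewrite ge0_fin_numE//; apply: le_lt_trans (mufin _ _ mj0) _; rewrite ltry.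
have nufin : (entropy f nu <= ((1 - t)^-1 * (E - t * fine (entropy f mu)))%:E)%E.
  rewrite [leLHS]entropyE; apply: ge_ereal_sup => _ [k [idx [mi ->]]].
  have := mufin _ _ mi; rewrite -(fineK mfin) !lee_fin ler_pdivlMl// ler_pdivlMl//; lra.
have nfin : entropy f nu \is a fin_num.
  by rewrite ge0_fin_numE//; apply: le_lt_trans nufin _; rewrite ltry.
move: nufin; rewrite -(fineK mfin) -(fineK nfin) -(fineK EPfin) -!EFinM -EFinD !lee_fin/=.
by rewrite ler_pdivlMl// -/E; lra.
Qed.

End Affine.

End Entropy.

(** * Measures of positive entropy *)

Section XLnX.
Variable R : realType.

(** [ln y <= y - 1] at [y = 1 / sqrt x]. It gives continuity of [x ln x] at [0], where [ln] itself
    is not continuous. *)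
Lemma xlnx_le_sqrt (x : R) : 0 <= x <= 1 -> `|x * ln x| <= 2 * Num.sqrt x.
Proof.
move=> /andP[x0 x1]; have [->|xn0] := eqVneq x 0; first by rewrite mul0r normr0 sqrtr0 mulr0.
have xp : 0 < x by rewrite lt_neqAle eq_sym xn0.
have sp : 0 < Num.sqrt x by rewrite sqrtr_gt0.
set y := (Num.sqrt x)^-1; have yp : 0 < y by rewrite invr_gt0.
have lnx : ln x = - (2 * ln y).
  by rewrite lnV// mulrN opprK -[in LHS](sqr_sqrtr x0) lnXn// mulr_natl.
have xy : Num.sqrt x = x * y.
  by rewrite /y -{2}(sqr_sqrtr x0) expr2 mulfK// gt_eqF.
rewrite ler0_norm; last by rewrite mulr_ge0_le0// ln_le0.
rewrite lnx mulrN opprK mulrCA ler_pM2l// [leRHS]xy ler_pM2l//.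
by have := ln_le_sub1 yp; lra.
Qed.

Lemma cvg_xlnx (F : set_system nat) (FF : ProperFilter F) (u : nat -> R) (l : R) :
  (forall n, 0 <= u n) -> u @ F --> l -> (fun n => u n * ln (u n)) @ F --> l * ln l.
Proof.
move=> u0 ul; have l0 : 0 <= l.
  have cu : cvg (u @ F) by apply: cvgP ul.
  have <- : lim (u @ F) = l by apply: cvg_lim.
  by apply: limr_ge => //; exact: nearW.
have [l1|ln0] := eqVneq l 0; last first.
  have lp : 0 < l by rewrite lt_neqAle eq_sym ln0.
  apply: cvgM => //; apply: (cvg_comp _ _ ul); exact: continuous_ln.
rewrite l1 mul0r in ul *.
have cs : (fun n => 2 * Num.sqrt (u n)) @ F --> (0 : R).
  rewrite -[X in _ --> X](mulr0 2) -[in X in _ --> X](@sqrtr0 R).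
  apply: cvgM; first exact: cvg_cst.
  by apply: (cvg_comp _ _ ul); exact: sqrt_continuous.
apply/cvgrPdist_lt => e e0; move/cvgrPdist_lt: cs => /(_ e e0) cs.
near=> n; rewrite sub0r normrN.
have un1 : u n < 1 by near: n; apply: (cvgr_lt 0).
apply: (le_lt_trans (xlnx_le_sqrt _)); first by rewrite u0 ltW.
have : `|0 - 2 * Num.sqrt (u n)| < e by near: n.
by rewrite sub0r normrN; apply: le_lt_trans; exact: ler_norm.
Unshelve. all: by end_near. Qed.

Lemma cvg_Hent (F : set_system nat) (FF : ProperFilter F) (I : finType)
    (p : nat -> I -> R) (q : I -> R) : (forall n i, 0 <= p n i) ->
  (forall i, (fun n => p n i) @ F --> q i) -> (fun n => Hent (p n)) @ F --> Hent q.
Proof.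
move=> p0 pq; rewrite /Hent; apply: cvgN.
elim: (index_enum I) => [|i r IH].
  by under eq_fun do rewrite big_nil; rewrite big_nil; exact: cvg_cst.
under eq_fun do rewrite big_cons; rewrite big_cons; apply: cvgD => //.
exact: cvg_xlnx.
Qed.

Variables (g : nat -> nat -> R) (c : R) (q : nat).
Hypotheses (c0 : 0 <= c) (q0 : (0 < q)%N).
Hypothesis gD : forall r l m, g r (l + m)%N <= g r l + g (r + l)%N m.
Hypothesis g_le : forall r l, g r l <= l%:R * c.
Hypothesis g_ge0 : forall r l, 0 <= g r l.

Let blocks t : \sum_(j < q) g j (t * q) <= \sum_(s < t * q) g s q.
Proof.
elim: t => [|t IH].
  rewrite mul0n big_ord0 sumr_le0// => j _.
  by rewrite (le_trans (g_le _ _))// mul0r.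
rewrite mulSn addnC; apply: (@le_trans _ _ (\sum_(j < q) (g j (t * q)%N + g (j + t * q)%N q))).
  by apply: ler_sum => j _; exact: gD.
rewrite big_split/= big_split_ord/= lerD//.
by apply: ler_sum => j _; rewrite addnC.
Qed.

(** Misiurewicz's block trick; in the application [g r l] is the entropy of the word of length [l]
    read from time [r]. From each offset [j < q], the segment of length [n] is cut into blocks of
    length [q]; over all offsets each time starts at most one block. An offset loses a head shorter
    than [q] and a tail shorter than [2 q], whence [3 q^2 c] for the [q] offsets together. *)
Lemma subadditive_blocks n :
  q%:R * g 0%N n <= \sum_(s < n) g s q + 3 * q%:R ^+ 2 * c.
Proof.
have qR : (0 : R) <= q%:R by [].
have sum_ge0 m : 0 <= \sum_(s < m) g s q by apply: sumr_ge0.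
have [nq|qn] := ltnP n q.
  apply: (@le_trans _ _ (q%:R * (q%:R * c))).
    by rewrite ler_wpM2l// (le_trans (g_le _ _))// ler_wpM2r// ler_nat ltnW.
  have := sum_ge0 n; have : 0 <= q%:R ^+ 2 * c by rewrite mulr_ge0 ?exprn_ge0.
  lra.
have t0 : (0 < n %/ q)%N by rewrite divn_gt0.
(* One block fewer than fits in [n], which leaves room for every offset [j < q]. *)
set t := (n %/ q).-1.
have nE : n = (t.+1 * q + n %% q)%N by rewrite /t prednK// -divn_eq.
have rq := ltn_pmod n q0.
have tqn : (t * q + q <= n)%N by rewrite [X in (_ <= X)%N]nE mulSn; lia.
have step (j : 'I_q) : g 0%N n <= q%:R * c + g j (t * q)%N + 2 * q%:R * c.
  have nj : n = (j + (t * q + (n - j - t * q)))%N by have := ltn_ord j; lia.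
  have le1 : g 0%N n <= g 0%N j + g j (n - j)%N.
    have -> : (n - j)%N = (t * q + (n - j - t * q))%N by lia.
    by rewrite {1}nj; exact: gD.
  have le2 : g j (n - j)%N <= g j (t * q)%N + g (j + t * q)%N (n - j - t * q)%N.
    have {1}-> : (n - j)%N = (t * q + (n - j - t * q))%N by have := ltn_ord j; lia.
    exact: gD.
  have le3 : g 0%N j <= q%:R * c.
    by rewrite (le_trans (g_le _ _))// ler_wpM2r// ler_nat ltnW.
  have le4 : g (j + t * q)%N (n - j - t * q)%N <= 2 * q%:R * c.
    rewrite (le_trans (g_le _ _))// ler_wpM2r// -natrM ler_nat.
    by rewrite {1}nE mulSn; lia.
  lra.
have : \sum_(j < q) g 0%N n <= \sum_(j < q) (q%:R * c + g j (t * q)%N + 2 * q%:R * c).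
  by apply: ler_sum => j _; exact: step.
have sc (x : R) : \sum_(j < q) x = q%:R * x by rewrite sumr_const card_ord mulr_natl.
rewrite !big_split/= !sc.
have := blocks t.
have : \sum_(s < t * q) g s q <= \sum_(s < n) g s q.
  have tn : (t * q <= n)%N by lia.
  by rewrite -(subnKC tn) big_split_ord/= lerDl sumr_ge0.
lra.
Qed.

End XLnX.

(** * Fine partitions whose cells have null boundary *)

Section SmallPartitions.
Variables (R : realType) (X : pmetricType R).
Hypothesis Xc : compact [set: X].
Variable mu : probability (borel X) R.

(** Finitely many balls of radius below [e / 2] with null spheres cover the space. A point is
    indexed by the first ball of the list containing it, so a cell is a ball minus earlier balls. *)
Lemma contset_partition (e : R) : 0 < e -> exists k (idx : X -> 'I_k),
  (forall i, contset mu [set x | idx x = i]) /\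
  forall x y, idx x = idx y -> mdist x y <= e.
Proof.
move=> e0; have e4 : 0 < e / 4 < e / 2 by apply/andP; split; lra.
have rad x : exists r, e / 4 < r < e / 2 /\ contset mu (ball x r).
  by have [r re cr] := contset_ball Xc mu x e4; exists r.
pose r x := sval (cid (rad x)).
have rP x : e / 4 < r x < e / 2 /\ contset mu (ball x (r x)) by rewrite /r; case: cid.
pose B x : set X := ball x (r x).
have oB x : open (B x).
  rewrite /B ballEmdist.
  have -> : [set y | mdist x y < r x] = mdist x @^-1` `]-oo, r x[%classic.
    by apply/seteqP; split=> y; rewrite /= in_itv.
  by apply: open_comp => [y _|]; [exact: mdist_continuous|exact: interval_open].
have := Xc; rewrite compact_cover => /(_ X setT B (fun x _ => oB x)) [].
  move=> x _; exists x => //; rewrite /B ballEmdist /= mdistxx.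
  by have [/andP[? _] _] := rP x; lra.
move=> D _ covD; pose s := finmap.enum_fset D; pose k := size s.
pose p x c : bool := `[< B c x >].
have hasp x : (find (p x) s < k)%N.
  rewrite -has_find; have [c cD Bcx] := covD x I.
  by apply/hasP; exists c => //; exact/asboolP.
exists k, (fun x => Ordinal (hasp x)); split.
  move=> i; have x0 : X := point.
  have -> : [set x | Ordinal (hasp x) = i] =
     B (nth x0 s i) `&` \bigcap_(j in [set: 'I_i]) ~` B (nth x0 s j).
    apply/seteqP; split=> [x /= <- /=|x [Bi Bj] /=].
      split.
        by have := nth_find x0 (etrans (has_find _ _) (hasp x)) => /asboolP.
      by move=> j _ Bj; have := before_find x0 (ltn_ord j) => /asboolP.
    apply: val_inj => /=; apply/eqP; rewrite eqn_leq; apply/andP; split.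
      rewrite leqNgt; apply/negP => lt; have := before_find x0 lt => /asboolP; exact.
    rewrite leqNgt; apply/negP => lt; have := Bj (Ordinal lt) I; apply => /=.
    by have := nth_find x0 (etrans (has_find _ _) (hasp x)) => /asboolP.
  apply: contsetI => //; first by have [] := rP (nth x0 s i).
  apply: contset_bigI => // j; apply: contsetC => //.
  by have [] := rP (nth x0 s j).
move=> x y /(congr1 val)/= fxy; have x0 : X := point.
have Bx : B (nth x0 s (find (p x) s)) x.
  by have := nth_find x0 (etrans (has_find _ _) (hasp x)) => /asboolP.
have By : B (nth x0 s (find (p x) s)) y.
  by rewrite fxy; have := nth_find x0 (etrans (has_find _ _) (hasp y)) => /asboolP.
set c := nth x0 s _ in Bx By; have [/andP[_ rc] _] := rP c.
move: Bx By; rewrite /B ballEmdist /= => Bx By.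
by have := metric_triangle x c y; rewrite (metric_sym x c); lra.
Qed.

End SmallPartitions.

(** * Misiurewicz's construction of a measure of positive entropy *)

Section Misiurewicz.
Variables (R : realType) (X : pmetricType R) (f : X -> X).
Hypotheses (Xc : compact [set: X]) (fc : continuous f).

(** Unfolds the two nested limits into one scale [e] and one rate [h] valid for arbitrarily large
    [n]. The cardinality enters through its logarithm, the entropy of the uniform law on the
    separated set. *)
Lemma topological_entropy_gt0P : (0 < topological_entropy f)%E ->
  exists e h : R, [/\ 0 < e, 0 < h & forall N, exists n (E : seq X),
    [/\ (N <= n)%N, (0 < n)%N, uniq E, (0 < size E)%N & n%:R * h < ln (size E)%:R /\
     forall x y, x \in E -> y \in E -> x != y ->
       exists2 i, (i < n)%N & e < mdist (iter i f x) (iter i f y)]].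
Proof.
pose S n e : \bar R := separated_number f n e.
pose F e := limn_esup (fun n => (n%:R^-1)%:E * lne (S n e))%E.
move=> htop; have S1 n e : (1 <= S n e)%E.
  apply: ereal_sup_ubound; exists (finmap.fset1 point); last by rewrite finmap.cardfs1.
  by move=> x y; rewrite !finmap.inE => /eqP -> /eqP ->; rewrite eqxx.
have u0 n e : (0 <= (n%:R^-1)%:E * lne (S n e))%E.
  by rewrite mule_ge0 ?lee_fin ?invr_ge0// lne_ge0.
have [e [e0 Fe]] : exists e, 0 < e /\ (0 < F e)%E.
  apply: contrapT => /forallNP H; move: htop; rewrite /topological_entropy.
  suff -> : lim (F e @[e --> 0^'+]) = 0%E by rewrite ltxx.
  apply: cvg_lim => //; apply: cvg_near_cst; near=> e.
  have e0 : 0 < e by near: e; exact: nbhs_right_gt.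
  apply/eqP; rewrite eq_le; apply/andP; split.
    by rewrite leNgt; apply/negP => Fe; apply: (H e).
  rewrite /F limn_esup_lim; apply: lime_ge; first exact: is_cvg_esups.
  apply: nearW => n; apply: (@le_trans _ _ ((n%:R^-1)%:E * lne (S n e))%E) => //.
  by apply: ereal_sup_ubound; exists n => /=.
have [h [h0 hF]] : exists h : R, 0 < h /\ (h%:E < F e)%E.
  case: (F e) Fe => [r| |] //; last by exists 1; rewrite ltr01 ltry.
  by rewrite !lte_fin => r0; exists (r / 2); rewrite lte_fin; split; lra.
exists e, h; split=> // N.
have : (F e <= esups (fun n => (n%:R^-1)%:E * lne (S n e)) N)%E.
  rewrite /F limn_esup_lim (cvg_lim _ (@cvg_esups_inf R _))//.
  by apply: ereal_inf_lbound; exists N.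
move=> /(lt_le_trans hF)/ereal_sup_gt[_ [n /= Nn <-]] hn.
(* At [n = 0] the term is [0], because [0^-1 = 0], and cannot exceed [h]. *)
have n0 : (0 < n)%N.
  by case: n {Nn} hn => //; rewrite invr0 mul0e lte_fin ltNge (ltW h0).
have nR : (0 : R) < n%:R by rewrite ltr0n.
have lnS : ((n%:R * h)%:E < lne (S n e))%E.
  move: hn; rewrite -(@lte_pmul2l _ n%:R%:E)// ?lte_fin// -EFinM muleA -EFinM divff ?gt_eqF//.
  by rewrite mul1e.
have : ((expR (n%:R * h))%:E < S n e)%E.
  rewrite ltNge; apply/negP => Sle; move: lnS; rewrite ltNge => /negP; apply.
  rewrite -[leRHS]/((n%:R * h)%:E) -[n%:R * h in leRHS]expRK -lne_EFin ?expR_gt0//.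
  rewrite lee_lne//; rewrite in_itv/= leey andbT; last by rewrite lee_fin expR_ge0.
  by rewrite (le_trans _ (S1 n e)).
move=> /ereal_sup_gt[_ [A sepA <-]]; rewrite lte_fin => hA.
have A0 : (0 : R) < (size (finmap.enum_fset A))%:R by apply: lt_trans hA; exact: expR_gt0.
exists n, (finmap.enum_fset A); split=> //.
- exact: finmap.fset_uniq.
- by rewrite -(@ltr0n R).
split; first by rewrite -[ltLHS]expRK ltr_ln ?posrE ?expR_gt0.
move=> x y xA yA xy; have := sepA x y xA yA xy; rewrite /bowen_dist.
apply: contraPP => /forall2NP H; apply/negP; rewrite -leNgt.
apply: bigmax_le; first exact: ltW.
by move=> i _; rewrite leNgt; apply/negP => ei; case: (H i) => // -[].
Unshelve. all: by end_near. Qed.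

Theorem positive_entropy_measure : (0 < topological_entropy f)%E ->
  exists2 mu : probability (borel X) R, invariant_measures f mu & (0 < entropy f mu)%E.
Proof.
move=> /topological_entropy_gt0P[e [h [e0 h0 H]]].
pose n_ j := sval (cid (H j)).
have H1 j : exists E : seq X,
    [/\ (j <= n_ j)%N, (0 < n_ j)%N, uniq E, (0 < size E)%N & (n_ j)%:R * h < ln (size E)%:R /\
     forall x y, x \in E -> y \in E -> x != y ->
       exists2 i, (i < n_ j)%N & e < mdist (iter i f x) (iter i f y)].
  by rewrite /n_; case: cid.
pose E_ j := sval (cid (H1 j)).
have HE j : [/\ (j <= n_ j)%N, (0 < n_ j)%N, uniq (E_ j), (0 < size (E_ j))%N &
   (n_ j)%:R * h < ln (size (E_ j))%:R /\
     forall x y, x \in E_ j -> y \in E_ j -> x != y ->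
       exists2 i, (i < n_ j)%N & e < mdist (iter i f x) (iter i f y)].
  by rewrite /E_; case: cid.
pose N_ j := size (E_ j); pose pt j (i : 'I_(N_ j)) := tnth (in_tuple (E_ j)) i.
have nR j : (0 : R) < (n_ j)%:R by rewrite ltr0n; case: (HE j).
have NR j : (0 : R) < (N_ j)%:R by rewrite ltr0n; case: (HE j).
(* The uniform average over the first [n_ j] points of the orbits of the separated set. *)
pose L j (g : X -> R) := ((n_ j)%:R)^-1 * \sum_(s < n_ j)
    ((N_ j)%:R^-1 * \sum_(i < N_ j) g (iter s f (@pt j i))).
have avgcst m (c : R) : 0 < m%:R :> R -> m%:R^-1 * \sum_(i < m) c = c.
  by move=> m0; rewrite sumr_const card_ord -[X in _ * X]mulr_natl mulKf// gt_eqF.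
have HL j : pos_functional (L j).
  split=> [g k _ _|c g _|g _ g0|]; rewrite /L.
  - rewrite -mulrDr; congr (_ * _); rewrite -big_split/=; apply: eq_bigr => s _.
    by rewrite -mulrDr -big_split.
  - rewrite mulrCA; congr (_ * _); rewrite mulr_sumr; apply: eq_bigr => s _.
    by rewrite mulrCA; congr (_ * _); rewrite mulr_sumr.
  - rewrite mulr_ge0 ?invr_ge0// sumr_ge0// => s _.
    by rewrite mulr_ge0 ?invr_ge0// sumr_ge0.
  - by under eq_bigr do rewrite avgcst//; rewrite avgcst.
have Lle j (g k : X -> R) : (forall x, g x <= k x) -> L j g <= L j k.
  move=> gk; rewrite ler_wpM2l ?invr_ge0//; apply: ler_sum => s _.
  by rewrite ler_wpM2l ?invr_ge0//; apply: ler_sum.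
have [mu Lmu] := functional_ultralimit Xc HL.
have ninf : (fun j => (n_ j)%:R^-1 : R) @ \oo --> (0 : R).
  apply: squeeze_cvgr (cvg_cst 0) (@cvg_invn R).
  near=> j; rewrite invr_ge0 ler0n/= lef_pV2 ?posrE ?ltr0n// ?ler_nat.
  - by case: (HE j).
  - by case: (HE j).
  - by near: j; exists 1%N.
have fmu : invariant_measures f mu.
  apply/(invariantP Xc fc) => g gc.
  have gfc : continuous (g \o f) by move=> x; apply: continuous_comp; [exact: fc|exact: gc].
  have c1 := Lmu _ gfc; have c2 := Lmu _ gc.
  have [M HM] := continuous_bounded Xc gc.
  have M0 : 0 <= M by apply: le_trans (HM point).
  (* Composing with [f] shifts time by one; the sum telescopes and changes by at most
     [2 M / n_ j]. *)
  have c3 : (fun j => L j (g \o f) - L j g) @ freeU --> (0 : R).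
    apply: cvg_freeU; apply/norm_cvg0P.
    have c4 : (fun j => (n_ j)%:R^-1 * (2 * M)) @ \oo --> (0 : R).
      by rewrite -[X in _ --> X](mul0r (2 * M)); apply: cvgM => //; exact: cvg_cst.
    apply: squeeze_cvgr (cvg_cst 0) c4.
    apply: nearW => j; rewrite normr_ge0/= /L -mulrBr normrM ger0_norm ?invr_ge0//.
    rewrite ler_wpM2l ?invr_ge0// -sumrB.
    pose A s := (N_ j)%:R^-1 * \sum_(i < N_ j) g (iter s f (@pt j i)).
    rewrite (eq_bigr (fun s : 'I_(n_ j) => A s.+1 - A s)) => [|//].
    rewrite -(big_mkord xpredT (fun s => A s.+1 - A s)) telescope_sumr//.
    have bA s : `|A s| <= M.
      rewrite /A normrM ger0_norm ?invr_ge0// -[leRHS](avgcst (N_ j) M)//.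
      rewrite ler_wpM2l ?invr_ge0// (le_trans (ler_norm_sum _ _ _))//.
      by apply: ler_sum => i _; exact: HM.
    have := ler_normB (A (n_ j)) (A 0%N); have := bA (n_ j); have := bA 0%N; lra.
  have c4 : (fun j => L j (g \o f) - L j g) @ freeU -->
      \int[mu]_x g (f x) - \int[mu]_x g x.
    by apply: cvgB c1 c2.
  apply/eqP; rewrite -subr_eq0; apply/eqP.
  by apply: cvg_unique c4 c3; exact: norm_hausdorff.
exists mu => //.
have [k [idx [cidx didx]]] := contset_partition Xc mu e0.
have midx : fmeas idx by move=> i; case: (cidx i).
have k0 : (0 < k)%N by exact: leq_ltn_trans (leq0n _) (ltn_ord (idx point)).
pose c : R := ln k%:R.
have c0 : 0 <= c by apply: ln_ge0; rewrite ler1n.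
(* The word length [q] is fixed while [j] tends to infinity; only afterwards does [q] grow. *)
have key q : (0 < q)%N -> q%:R * h <= Hent (law mu (word f idx q)).
  move=> q0.
  pose unif j (i : 'I_(N_ j)) : R := (N_ j)%:R^-1.
  have dunif j : distr (unif j).
    split=> [i|]; first by rewrite invr_ge0.
    by rewrite /unif sumr_const card_ord -[LHS]mulr_natl divff// gt_eqF.
  pose W j r l (i : 'I_(N_ j)) := word f idx l (iter r f (@pt j i)).
  pose g j r l := Hent (pushd (unif j) (@W j r l)).
  pose P j (w : {ffun 'I_q -> 'I_k}) := \sum_(s < n_ j) (n_ j)%:R^-1 * pushd (unif j) (@W j s q) w.
  have dW j r l : distr (pushd (unif j) (@W j r l)) by exact: distr_pushd.
  (* Cells have diameter at most [e], so separated points have distinct words of length [n_ j], and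
     the law of words is uniform on [N_ j] of them. *)
  have gN j : g j 0%N (n_ j) = ln (N_ j)%:R.
    have -> : g j 0%N (n_ j) = Hent (pushd (unif j) id).
      apply: eq_Hent_pushd => [i|i i']; first by rewrite (dunif j).1.
      split=> [->//|Wii'].
      have [_ _ uE _ [_ sep]] := HE j.
      apply/eqP/negPn/negP => ii'.
      have [|||s sn] := sep (@pt j i) (@pt j i').
      - exact: mem_tnth.
      - exact: mem_tnth.
      - by rewrite /pt !(tnth_nth point)/= nth_uniq.
      rewrite ltNge => /negP; apply; apply: didx.
      by have := congr1 (fun w : {ffun 'I_(n_ j) -> 'I_k} => w (Ordinal sn)) Wii'; rewrite !ffunE.
    rewrite pushd_id /Hent (eq_bigr (fun=> - ((N_ j)%:R^-1 * ln (N_ j)%:R))).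
      by rewrite sumrN opprK sumr_const card_ord -[LHS]mulr_natl mulrA divff ?mul1r// gt_eqF.
    by move=> i _; rewrite /unif lnV ?posrE//; rewrite mulrN.
  have bound j : q%:R * h <= Hent (P j) + (n_ j)%:R^-1 * (3 * q%:R ^+ 2 * c).
    have gD r l m : g j r (l + m)%N <= g j r l + g j (r + l)%N m.
      apply: Hent_pushd_subadd => // i i' e1 e2; apply/ffunP => s; rewrite !ffunE.
      case: (splitP s) => u su.
        have := congr1 (fun w : {ffun 'I_l -> 'I_k} => w u) e1; rewrite !ffunE.
        by rewrite su.
      have := congr1 (fun w : {ffun 'I_m -> 'I_k} => w u) e2; rewrite !ffunE.
      rewrite su -!iterD; have -> : (u + (r + l) = l + u + r)%N by lia.
      by [].
    have gle r l : g j r l <= l%:R * c.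
      rewrite (le_trans (Hent_le_card (dW j r l)))// card_ffun !card_ord.
      by rewrite natrX lnXn ?ltr0n// mulr_natl.
    have gge r l : 0 <= g j r l by exact: Hent_ge0.
    have := subadditive_blocks c0 q0 gD gle gge (n_ j); rewrite gN.
    (* Concavity moves the average over time inside the entropy. *)
    have cc : \sum_(s < n_ j) (n_ j)%:R^-1 * g j s q <= Hent (P j).
      apply: Hent_concave => //.
      rewrite -[RHS](avgcst (n_ j) 1)// mulr_sumr; apply: eq_bigr => s _.
      by rewrite mulr1.
    have [_ _ _ _ [hN _]] := HE j.
    move=> B; rewrite -(ler_pM2l (nR j)) mulrDr mulrA mulVKf ?gt_eqF//.
    move: cc; rewrite -mulr_sumr ler_pdivrMl// => cc.
    apply: (@le_trans _ _ (q%:R * ln (N_ j)%:R)).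
      by rewrite mulrAC mulrC ler_wpM2l// ltW.
    lra.
  have cP : (fun j => Hent (P j)) @ freeU --> Hent (law mu (word f idx q)).
    apply: cvg_Hent => [j w|w].
      by apply: sumr_ge0 => s _; rewrite mulr_ge0 ?invr_ge0// (dW j s q).1.
    (* Cells of words are intersections of preimages of continuity sets, so the limit measure gives
       them the limit of their frequencies. *)
    have cw : contset mu [set x | word f idx q x = w].
      have -> : [set x | word f idx q x = w] =
          \bigcap_(i in [set: 'I_q]) (iter i f @^-1` [set x | idx x = w i]).
        apply/seteqP; split=> [x /= <- i _ /=|x Hx /=]; first by rewrite ffunE.
        by apply/ffunP => i; rewrite ffunE; exact: Hx.
      by apply: contset_bigI => // i; exact: contset_iter.
    have PL j : P j w = L j (fun x => (word f idx q x == w)%:R).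
      rewrite /P /L mulr_sumr; apply: eq_bigr => s _; congr (_ * _).
      rewrite /pushd /unif mulr_sumr big_mkcond/=; apply: eq_bigr => i _.
      by rewrite /W; case: eqP; rewrite ?mulr1 ?mulr0.
    apply: (contset_cvg Xc cw Lmu) => j g' g01 gA; rewrite PL; apply: Lle => x.
      by case: eqP => [_|/gA -> //]; have /andP[] := g01 x.
    by case: eqP => [/gA ->//|_]; have /andP[] := g01 x.
  have cb : (fun j => Hent (P j) + (n_ j)%:R^-1 * (3 * q%:R ^+ 2 * c)) @ freeU -->
      Hent (law mu (word f idx q)).
    rewrite -[X in _ --> X]addr0; apply: cvgD => //.
    rewrite -[X in _ --> X](mul0r (3 * q%:R ^+ 2 * c)); apply: cvgM; last exact: cvg_cst.
    exact: cvg_freeU.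
  apply: (ler_cvg_to (cvg_cst (q%:R * h)) cb); exact: nearW.
have hk : h <= kent f mu idx.
  have kc := kent_cvg fc fmu midx.
  apply: limr_ge; first exact: cvgP kc.
  near=> q; have q0 : (0 < q)%N by near: q; exists 1%N.
  by rewrite ler_pdivlMl ?ltr0n//; exact: key.
apply: (@lt_le_trans _ _ h%:E); first by rewrite lte_fin.
rewrite entropyE//; apply: (@le_trans _ _ (kent f mu idx)%:E); first by rewrite lee_fin.
by apply: ereal_sup_ubound; exists k, idx.
Unshelve. all: by end_near. Qed.

End Misiurewicz.

(** * Weak* topology and ergodic maximizing measures *)

Section WeakStarTopology.
Variables (R : realType) (X : pmetricType R).
Implicit Types (mu nu : probability (borel X) R).

(** The weak* topology is pulled back from a product by [integral_map], and convergence in the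
    product is coordinatewise. *)
Lemma wcvg_cvg (mu_ : nat -> probability (borel X) R) mu : wcvg mu_ mu ->
  mu_ @ freeU --> mu.
Proof.
move=> cmu A; rewrite nbhsE => -[_ [[B oB <-] Bmu] BA].
have : (fun n => integral_map (mu_ n)) @ freeU --> integral_map mu.
  apply/cvg_sup => g N; rewrite nbhsE => -[_ [[V oV <-] Vg] VN].
  have cg : continuous (g : X -> R) by exact: cts_fun.
  have := cmu _ cg => /(_ V (open_nbhs_nbhs (conj oV Vg))) h.
  have {}h : freeU [set n | V (\int[mu_ n]_x g x)] by exact: h.
  by apply: (@filterS _ freeU _ _ _ _ h) => n Vn; exact: VN.
move=> /(_ B (open_nbhs_nbhs (conj oB Bmu))) h.
have {}h : freeU [set n | B (integral_map (mu_ n))] by exact: h.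
by apply: (@filterS _ freeU _ _ _ _ h) => n Bn; exact: BA.
Qed.

Lemma weak_closure (S : set (probability (borel X) R)) mu (g : X -> R) (e : R) :
  closure S mu -> continuous g -> 0 < e ->
  exists2 nu, S nu & `|\int[mu]_x g x - \int[nu]_x g x| < e.
Proof.
move=> clS gc e0; pose G : continuousType X R := HB.pack g (isContinuous.Build _ _ g gc).
have cG : {for mu, continuous (fun nu : probability (borel X) R => \int[nu]_x g x)}.
  apply: (@continuous_comp _ _ _ (@integral_map R X) (fun h : {ptws continuousType X R -> R} => h G)).
    exact: initial_continuous.
  exact: (@proj_continuous _ _ G).
have := clS [set nu : probability (borel X) R | `|\int[mu]_x g x - \int[nu]_x g x| < e].
have /cvgrPdist_lt/(_ e e0) h := cG.
by move=> /(_ h)[nu [Snu h2]]; exists nu.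
Qed.

End WeakStarTopology.

(** Allows a maximizing sequence to be chosen in the same way for finite and infinite suprema. *)
Lemma ereal_approx_lt (R : realType) (H : \bar R) : (0 <= H)%E ->
  exists2 a : nat -> R, (forall n, ((a n)%:E < H)%E) &
    forall b : R, (b%:E < H)%E -> \forall n \near \oo, b < a n.
Proof.
case: H => [r| |] //= _; last first.
  by exists (fun n => n%:R) => [n|b _]; [rewrite ltry|exact: nbhs_infty_gtr].
exists (fun n => r - n.+1%:R^-1) => [n|b].
  by rewrite lte_fin ltrBlDr ltrDl invr_gt0.
rewrite lte_fin => br.
have c1 : (fun n => r - n.+1%:R^-1 : R) @ \oo --> r.
  by rewrite -[X in _ --> X]subr0; apply: cvgB; [exact: cvg_cst|exact: cvg_harmonic].
exact: (cvgr_gt r c1).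
Qed.

(** * Maximizing measures and the interval structure of the spectrum *)

Section Spectrum.
Variables (R : realType) (X : pmetricType R) (f : X -> X).
Hypotheses (Xc : compact [set: X]) (fc : continuous f).
Hypothesis husc : upper_semicontinuous_on (invariant_measures f) (@entropy R X f).
Implicit Types (mu nu : probability (borel X) R).

Let ent mu : \bar R := entropy f mu.

Definition wclosed (S : set (probability (borel X) R)) :=
  forall (mu_ : nat -> probability (borel X) R) mu, (forall n, S (mu_ n)) -> wcvg mu_ mu -> S mu.

Lemma wcvg_entropy (mu_ : nat -> probability (borel X) R) mu (a : R) :
  (forall n, invariant_measures f (mu_ n)) -> invariant_measures f mu ->
  wcvg mu_ mu -> (ent mu < a%:E)%E -> \forall n \near freeU, (ent (mu_ n) < a%:E)%E.
Proof.
move=> fmu_ fmu cmu ha; have := wcvg_cvg cmu (husc fmu ha).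
move=> h; have {}h : freeU [set n | invariant_measures f (mu_ n) -> (ent (mu_ n) < a%:E)%E] by exact: h.
by apply: (@filterS _ freeU _ _ _ _ h) => n; exact.
Qed.

(** The ultralimit of a maximizing sequence stays in [S]. Were its entropy below the supremum, upper
    semicontinuity would keep the sequence below some real strictly between the two. *)
Lemma entropy_max_attained (S : set (probability (borel X) R)) :
  S !=set0 -> S `<=` invariant_measures f -> wclosed S ->
  exists2 mu, S mu & forall nu, S nu -> (ent nu <= ent mu)%E.
Proof.
move=> [s0 Ss0] SM clS; pose H := ereal_sup (ent @` S).
have H0 : (0 <= H)%E.
  by apply: (le_trans (entropy_ge0 fc (SM _ Ss0))); apply: ereal_sup_ubound; exists s0.
have [a aH aev] := ereal_approx_lt H0.
have ex n : exists mu, S mu /\ ((a n)%:E < ent mu)%E.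
  by have [_ [mu Smu <-] h] := ereal_sup_gt (aH n); exists mu.
pose mu_ n := sval (cid (ex n)).
have mu_P n : S (mu_ n) /\ ((a n)%:E < ent (mu_ n))%E by rewrite /mu_; case: cid.
have [mu cmu] := wcvg_subseq Xc mu_.
have Smu : S mu by apply: clS cmu => n; case: (mu_P n).
exists mu => // nu Snu; rewrite leNgt; apply/negP => lt.
have ltH : (ent mu < H)%E by apply: lt_le_trans lt _; apply: ereal_sup_ubound; exists nu.
have mid (h k : \bar R) : (0 <= h)%E -> (h < k)%E -> exists b : R, (h < b%:E)%E /\ (b%:E < k)%E.
  case: h => [r| |] //=; last by move=> _; rewrite ltNge leey.
  case: k => [s| |] //= _.
    by rewrite lte_fin => rs; exists ((r + s) / 2); rewrite !lte_fin; split; lra.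
  by move=> _; exists (r + 1); split; [rewrite lte_fin ltrDl|rewrite ltry].
have [b [hb bH]] := mid _ _ (entropy_ge0 fc (SM _ Smu)) ltH.
have ev1 := wcvg_entropy (fun n => SM _ (mu_P n).1) (SM _ Smu) cmu hb.
have ev2 : \forall n \near freeU, b < a n by apply: freeU_oo; exact: aev.
have [n [n1 n2]] := filter_ex (filterI ev1 ev2).
have := lt_trans (mu_P n).2 n1; rewrite lte_fin => n3.
by have := lt_trans n2 n3; rewrite ltxx.
Qed.

Lemma wclosed_invariant : wclosed (invariant_measures f).
Proof. by move=> mu_ mu fmu_ cmu; exact: wcvg_invariant cmu. Qed.

(** Mixtures of [nu] with a vanishing share of [mu] have infinite entropy and converge to [nu], so
    upper semicontinuity leaves no finite value for [nu]. *)
Lemma entropy_infinite mu nu : invariant_measures f mu -> invariant_measures f nu ->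
  ent mu = +oo%E -> ent nu = +oo%E.
Proof.
move=> fmu fnu hmu; apply: contrapT => /eqP hnu.
have nu0 := entropy_ge0 fc fnu.
have [r hr] : exists r : R, ent nu = r%:E.
  by move: hnu nu0; rewrite /ent; case: (entropy f nu) => [r| |] //; exists r.
(* Starting at [n.+2] keeps the weight strictly below 1, as [entropy_mix] requires. *)
have t01 n : 0 < (n.+2%:R^-1 : R) < 1.
  by rewrite invr_gt0 ltr0n/= invf_lt1// ltr1n.
have ex n : exists P, is_mix n.+2%:R^-1 mu nu P.
  by apply: mix_exists; have /andP[/ltW -> /ltW ->] := t01 n.
pose P_ n := sval (cid (ex n)).
have HP n : is_mix n.+2%:R^-1 mu nu (P_ n) by rewrite /P_; case: cid.
have fP n : invariant_measures f (P_ n) by exact: mix_invariant (HP n) fmu fnu.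
have cP : wcvg P_ nu.
  move=> g gc; apply: cvg_freeU.
  have -> : (fun n => \int[P_ n]_x g x) = (fun n => n.+2%:R^-1 * \int[mu]_x g x +
      (1 - n.+2%:R^-1) * \int[nu]_x g x).
    by apply/funext => n; apply: mix_int => //; have /andP[/ltW -> /ltW ->] := t01 n.
  have c0 : (fun n => n.+2%:R^-1 : R) @ \oo --> (0 : R).
    by have := @cvg_invn R; rewrite -(cvg_shiftn 2); under eq_fun do rewrite addn2.
  suff : (fun n => n.+2%:R^-1 * \int[mu]_x g x + (1 - n.+2%:R^-1) * \int[nu]_x g x) @ \oo -->
      0 * \int[mu]_x g x + (1 - 0) * \int[nu]_x g x by rewrite mul0r add0r subr0 mul1r.
  by apply: cvgD; apply: cvgM => //; try exact: cvg_cst; apply: cvgB => //; exact: cvg_cst.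
have hlt : (ent nu < (r + 1)%:E)%E by rewrite hr lte_fin; lra.
have [n] := filter_ex (wcvg_entropy fP fnu cP hlt).
rewrite /ent (entropy_mix fc (t01 n) (HP n))//.
rewrite (_ : entropy f mu = +oo%E)// (_ : entropy f nu = r%:E)// gt0_muley ?lte_fin; last by have /andP[] := t01 n.
by rewrite -EFinM addye// ltNge leey.
Qed.

Section Class.
Variables (m : nat) (Phi : X -> 'rV[R]_m).
Hypothesis Phic : forall i, continuous (fun x => Phi x ord0 i).

Lemma rv_mix t mu nu P : 0 <= t <= 1 -> is_mix t mu nu P ->
  rotation_vector Phi P = t *: rotation_vector Phi mu + (1 - t) *: rotation_vector Phi nu.
Proof.
move=> t01 HP; apply/rowP => i; rewrite !mxE.
by apply: mix_int.
Qed.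

Lemma wclosed_class w : wclosed (rotation_class f Phi w).
Proof.
move=> mu_ mu H cmu; split.
  by apply: wclosed_invariant cmu => n; case: (H n).
apply/rowP => i; rewrite mxE.
have c1 := cmu _ (@Phic i).
have e1 : (fun n => \int[mu_ n]_x Phi x ord0 i) = fun=> w ord0 i.
  by apply/funext => n; have [_ <-] := H n; rewrite mxE.
rewrite e1 in c1; have c2 : (fun=> w ord0 i) @ freeU --> w ord0 i by exact: cvg_cst.
by apply: cvg_unique c1 c2; exact: norm_hausdorff.
Qed.

Variable w : 'rV[R]_m.
Hypothesis Rw : rotation_set f Phi w.

Let class_neq0 : rotation_class f Phi w !=set0.
Proof. by case: Rw => mu fmu rmu; exists mu; split. Qed.

Let H := localized_entropy f Phi w.

Lemma spectrum_max : entropy_spectrum f Phi w H.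
Proof.
have [||mu Cmu maxmu] := entropy_max_attained class_neq0.
- by move=> mu [].
- exact: wclosed_class.
exists mu => //; apply/eqP; rewrite eq_le; apply/andP; split.
  by apply: ereal_sup_ubound; exists mu.
by apply: ge_ereal_sup => _ [nu Cnu <-]; exact: maxmu.
Qed.

Lemma spectrum_le y : entropy_spectrum f Phi w y -> (0 <= y <= H)%E.
Proof.
move=> Sy; apply/andP; split; last exact: ereal_sup_ubound.
by case: Sy => mu [fmu _] <-; exact: entropy_ge0.
Qed.

(** Mixing a measure of maximal entropy with one of entropy [x] stays in the class and reaches every
    value between. If [H] is infinite, [entropy_infinite] forces [x = +oo]. *)
Lemma spectrum_interval x y : entropy_spectrum f Phi w x -> (x <= y <= H)%E ->
  entropy_spectrum f Phi w y.
Proof.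
move=> Sx /andP[xy yH]; have /andP[x0 xH] := spectrum_le Sx.
have SH := spectrum_max; have [mu [fmu rmu] hmu] := SH; have [nu [fnu rnu] hnu] := Sx.
have [Hoo|Hfin] := eqVneq H +oo%E.
  have xoo : x = +oo%E by rewrite -hnu; apply: (entropy_infinite fmu) => //; rewrite /ent hmu.
  suff <- : x = y by [].
  by apply/eqP; rewrite eq_le xy xoo leey.
have [->//|xny] := eqVneq y x.
have [->//|yHn] := eqVneq y H.
have xy' : (x < y)%E by rewrite lt_neqAle eq_sym xny.
have yH' : (y < H)%E by rewrite lt_neqAle yHn.
case: x x0 xH hnu xy xy' xny {Sx} => [x| |] //= x0 xH hnu xy xy' xny; last by rewrite ltNge leey in xy'.
case: y xy xy' xny yH yHn yH' => [y| |] //= xy xy' xny yH yHn yH'; last by rewrite ltNge leey in yH'.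
move: SH hmu yH' Hfin xH yH yHn; rewrite -/H; case: H => [h| |] //= SH hmu yH' _ xH yH yHn.
rewrite !lte_fin in xy' yH'.
(* Solves [t h + (1 - t) x = y]. *)
pose t := (y - x) / (h - x).
have hx : 0 < h - x by lra.
have t01 : 0 < t < 1.
  by apply/andP; split; [rewrite divr_gt0// subr_gt0|rewrite /t ltr_pdivrMr// mul1r; lra].
have t01' : 0 <= t <= 1 by have /andP[/ltW -> /ltW ->] := t01.
have [P HP] := mix_exists mu nu t01'.
exists P; first split.
- exact: mix_invariant HP fmu fnu.
- by rewrite (rv_mix t01' HP) rmu rnu -scalerDl addrC subrK scale1r.
rewrite (entropy_mix fc t01 HP)// hmu hnu -!EFinM -EFinD; congr (_%:E).
by rewrite /t; field; rewrite gt_eqF.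
Qed.

(** The infimum of the spectrum decides: it equals [H], or is attained and positive, or attained and
    zero, or not attained. *)
Lemma spectrum_cases :
  [\/ entropy_spectrum f Phi w = [set H],
      exists2 x : \bar R, (0 < x < H)%E & entropy_spectrum f Phi w = `[x, H]%classic,
      entropy_spectrum f Phi w = `[0%E, H]%classic |
      exists2 x : \bar R, (0 <= x < H)%E & entropy_spectrum f Phi w = `]x, H]%classic].
Proof.
set S := entropy_spectrum f Phi w; pose x := ereal_inf S.
have x0 : (0 <= x)%E.
  by apply: le_ereal_inf_tmp => y /spectrum_le/andP[].
have xle y : S y -> (x <= y)%E by move=> Sy; exact: ereal_inf_lbound.
have xH : (x <= H)%E by apply: xle; exact: spectrum_max.
have [xeH|xnH] := eqVneq x H.
  apply: Or41; apply/seteqP; split=> [y Sy|_ ->]; last exact: spectrum_max.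
  by apply/eqP; rewrite eq_le; have /andP[_ ->] := spectrum_le Sy; rewrite -xeH xle.
have xltH : (x < H)%E by rewrite lt_neqAle xnH.
have [Sx|nSx] := pselect (S x).
  have E : S = `[x, H]%classic.
    apply/seteqP; split=> y /=; rewrite in_itv/=.
      by move=> Sy; rewrite xle//=; have /andP[] := spectrum_le Sy.
    exact: spectrum_interval.
  have [xe0|xn0] := eqVneq x 0%E; first by apply: Or43; rewrite -xe0.
  by apply: Or42; exists x => //; rewrite xltH andbT lt_neqAle eq_sym xn0.
apply: Or44; exists x; first by rewrite x0.
apply/seteqP; split=> y /=; rewrite in_itv/=.
  move=> Sy; have /andP[_ ->] := spectrum_le Sy; rewrite andbT lt_neqAle xle// andbT.
  by apply/eqP => xy; apply: nSx; rewrite xy.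
move=> /andP[xy yH]; have [z Sz zy] := ereal_inf_lt xy.
by apply: spectrum_interval Sz _; rewrite (ltW zy).
Qed.

End Class.

Lemma int_max_attained (S : set (probability (borel X) R)) (g : X -> R) :
  S !=set0 -> wclosed S -> continuous g ->
  exists2 mu, S mu & forall nu, S nu -> \int[nu]_x g x <= \int[mu]_x g x.
Proof.
move=> S0 clS gc; have [M HM] := continuous_bounded Xc gc.
pose A := [set \int[mu]_x g x | mu in S].
have supA : has_sup A.
  split; first by have [s Ss] := S0; exists (\int[s]_x g x), s.
  by exists M => _ [mu _ <-]; apply: (le_trans (ler_norm _)); exact: int_norm_le.
have ex n : exists mu, S mu /\ sup A - n.+1%:R^-1 < \int[mu]_x g x.
  have e0 : (0 : R) < n.+1%:R^-1 by rewrite invr_gt0.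
  by have [_ [mu Smu <-] h] := sup_adherent e0 supA; exists mu.
pose mu_ n := sval (cid (ex n)).
have mu_P n : S (mu_ n) /\ sup A - n.+1%:R^-1 < \int[mu_ n]_x g x by rewrite /mu_; case: cid.
have [mu cmu] := wcvg_subseq Xc mu_.
have Smu : S mu by apply: clS cmu => n; case: (mu_P n).
exists mu => // nu Snu; apply: (@le_trans _ _ (sup A)).
  by apply: (sup_ubound supA.2); exists nu.
have c1 : (fun n => sup A - n.+1%:R^-1) @ freeU --> sup A.
  apply: cvg_freeU; rewrite -[X in _ --> X]subr0.
  by apply: cvgB; [exact: cvg_cst|exact: cvg_harmonic].
apply: (freeU_lim_le _ c1 (cmu _ gc)).
by apply: nearW => n; apply/ltW; case: (mu_P n).
Qed.

(* Maximizing g, phi 0, phi 1, ... lexicographically singles out one measure,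
   which is an extreme point of the set of invariant measures. *)
Lemma ergodic_max (phi : nat -> continuousType X R) (g : X -> R) :
  dense_sequence phi -> continuous g -> invariant_measures f !=set0 ->
  exists2 mu, ergodic_measures f mu &
    forall nu, invariant_measures f nu -> \int[nu]_x g x <= \int[mu]_x g x.
Proof.
move=> phid gc M0.
(* With [g] in front, the later functions only break ties among its maximizers. *)
pose psi k : X -> R := if k is k'.+1 then phi k' else g.
have psic k : continuous (psi k) by case: k => //= k; exact: cts_fun.
pose S := fix S k := if k is k'.+1 then
   [set mu | S k' mu /\ forall nu, S k' nu -> \int[nu]_x psi k' x <= \int[mu]_x psi k' x]
   else invariant_measures f.
have SP k : S k !=set0 /\ wclosed (S k).
  elim: k => [|k [IH1 IH2]]; first by split=> //; exact: wclosed_invariant.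
  split; first by have [mu h1 h2] := int_max_attained IH1 IH2 (psic k); exists mu; split.
  move=> mu_ mu H cmu; split; first by apply: IH2 cmu => n; case: (H n).
  move=> nu Snu.
  have c1 : (fun=> \int[nu]_x psi k x) @ freeU --> \int[nu]_x psi k x by exact: cvg_cst.
  apply: (freeU_lim_le _ c1 (cmu _ (psic k))).
  by apply: nearW => n; case: (H n) => _; apply.
have Sdec k l : (k <= l)%N -> S l `<=` S k.
  elim: l => [|l IH]; first by rewrite leqn0 => /eqP ->.
  rewrite leq_eqVlt => /predU1P[->//|/IH h] mu [+ _]; exact: h.
pose mu_ k := sval (cid (SP k).1).
have mu_P k : S k (mu_ k) by rewrite /mu_; case: cid.
have [mu cmu] := wcvg_subseq Xc mu_.
have Smu k : S k mu.
  have [_ clk] := SP k.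
  (* [mu_ n] is known to lie in [S k] only from [n = k] on; changing the earlier terms does not
     affect the limit. *)
  pose nu_ n := mu_ (maxn k n).
  apply: (clk nu_); first by move=> n; apply: (Sdec _ (maxn k n)); [exact: leq_maxl|exact: mu_P].
  move=> h hc; apply: cvg_trans (cmu h hc); apply: near_eq_cvg.
  by apply: freeU_oo; exists k => // n /= kn; rewrite /nu_ (maxn_idPr kn).
have fmu : invariant_measures f mu := Smu 0%N.
exists mu; last by move=> nu fnu; have [_] := Smu 1%N; exact.
split=> // A mA fA.
have [a0|an0] := eqVneq (fm mu A) 0; first by left; rewrite (fmE mu mA) a0.
have [a1|an1] := eqVneq (fm mu A) 1; first by right; rewrite (fmE mu mA) a1.
exfalso; set a := fm mu A in an0 an1.
have a0 : 0 < a by rewrite lt_neqAle eq_sym an0 fm_ge0.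
have a1 : a < 1 by rewrite lt_neqAle an1 fm_le1.
have mC := measurableC mA.
have aC : fm mu (~` A) = 1 - a by rewrite fm_setC.
have aC0 : 0 < fm mu (~` A) by rewrite aC; lra.
(* An invariant set of intermediate mass writes [mu] as a mixture of its conditional measures on [A]
   and on the complement, both invariant. *)
have [P HP] := cond_prob_exists mA a0.
have [Q HQ] := cond_prob_exists mC aC0.
have inv (B : set (borel X)) (r : R) (Z : probability (borel X) R) : measurable B -> f @^-1` B = B ->
    (forall C : set (borel X), measurable C -> fm Z C = r * fm mu (C `&` B)) ->
    invariant_measures f Z.
  move=> mB fB HZ C mC'.
  have mfC := measurable_preim fc mC'.
  rewrite (fmE Z mC') (fmE Z mfC) !HZ//; congr (_ * _)%:E.
  have -> : f @^-1` C `&` B = f @^-1` (C `&` B) by rewrite preimage_setI fB.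
  by rewrite (fm_preimage fmu)//; exact: measurableI.
have fP : invariant_measures f P by exact: (inv _ _ _ mA fA HP).
have fCA : f @^-1` (~` A) = ~` A := congr1 (@setC X) fA.
have fQ : invariant_measures f Q by exact: (inv _ _ _ mC fCA HQ).
have mix : is_mix a P Q mu.
  move=> B mB; rewrite HP// HQ// aC !mulVKf ?gt_eqF//; last lra.
  rewrite -fm_setU; [|exact: measurableI|exact: measurableI|].
    by rewrite -setIUr setUv setIT.
  by rewrite setIACA setICr setI0.
have a01 : 0 <= a <= 1 by rewrite !ltW.
(* If a mixture maximizes a linear functional, so do its components: [P] and [Q] survive every
   stage, and [P] has the same integrals as [mu]. *)
have key k : S k P /\ S k Q /\ (forall l, (l < k)%N -> \int[P]_x psi l x = \int[mu]_x psi l x).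
  elim: k => [//|k [SkP [SkQ IH]]].
  have [_ maxmu] := Smu k.+1.
  have hP := maxmu _ SkP; have hQ := maxmu _ SkQ.
  have hm := mix_int Xc a01 mix (psic k).
  have eP : \int[P]_x psi k x = \int[mu]_x psi k x.
    apply/eqP; rewrite eq_le hP/= leNgt; apply/negP => lt.
    have := ltr_pM2l a0; move=> /(_ (\int[P]_x psi k x) (\int[mu]_x psi k x)); rewrite lt => h1.
    have h2 : (1 - a) * \int[Q]_x psi k x <= (1 - a) * \int[mu]_x psi k x.
      by rewrite ler_wpM2l// subr_ge0 ltW.
    by move: h1 h2 hm; clear => h1 h2 hm; lra.
  have eQ : \int[Q]_x psi k x = \int[mu]_x psi k x.
    move: hm; rewrite eP => hm; have h1 : (1 - a) * (\int[Q]_x psi k x - \int[mu]_x psi k x) = 0.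
      by move: hm; clear => hm; lra.
    move/eqP: h1; rewrite mulf_eq0 subr_eq0 (gt_eqF a1)/= subr_eq0 => /eqP //.
  split; first by split=> // nu Snu; rewrite eP; exact: maxmu.
  split; first by split=> // nu Snu; rewrite eQ; exact: maxmu.
  by move=> l; rewrite ltnS leq_eqVlt => /predU1P[->//|]; exact: IH.
have eqphi k : \int[P]_x phi k x = \int[mu]_x phi k x.
  by have [_ [_ /(_ k.+1 (ltnSn _))]] := key k.+2.
have eqint h : continuous h -> \int[P]_x h x = \int[mu]_x h x.
  move=> hc; apply/eqP; rewrite -subr_eq0 -normr_eq0 eq_le normr_ge0 andbT.
  apply/ler_addgt0Pr => e e0; rewrite add0r.
  pose G : continuousType X R := HB.pack h (isContinuous.Build _ _ h hc).
  have e20 : 0 < e / 2 by lra.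
  have [k hk] := phid G (e / 2) e20.
  have pk : continuous (phi k) by exact: cts_fun.
  have dist x : `|h x - phi k x| <= e / 2.
    apply: le_trans (ltW hk); apply: sup_ubound; last by exists x.
    have dc : continuous (fun x => h x - phi k x).
      by move=> y; apply: continuousB; [exact: hc|exact: pk].
    have [M HM] := continuous_bounded Xc dc.
    by exists M => _ [y _ <-]; exact: HM.
  have d1 : `|\int[P]_x h x - \int[P]_x phi k x| <= e / 2 by apply: int_dist.
  have d2 : `|\int[mu]_x h x - \int[mu]_x phi k x| <= e / 2 by apply: int_dist.
  rewrite eqphi in d1; move: d1 d2; rewrite !ler_norml => /andP[? ?] /andP[? ?].
  by apply/andP; split; lra.
(* Thus [P] equals [mu], yet [P] gives full mass to [A]. *)
have := @int_measure_eq R X Xc P mu eqint A mA.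
rewrite (fmE P mA) (fmE mu mA) HP// setIid mulVf ?gt_eqF// => -[] a1'.
by move: a1; rewrite /a -a1' ltxx.
Qed.

End Spectrum.

(** * Convex sets and relative interiors *)

Section ConvexGeometry.
Variables (R : realType) (m : nat).
Implicit Types (C K : set 'rV[R]_m) (v w x y : 'rV[R]_m).

Definition near_rV (e : R) v w := forall i, `|v ord0 i - w ord0 i| < e.

Lemma nbhs_rVP w (A : set 'rV[R]_m) :
  nbhs w A <-> exists2 e, 0 < e & forall v, near_rV e w v -> A v.
Proof.
split=> [/nbhs_ballP[e /= e0 eA]|[e e0 eA]].
  exists e => // v wv; apply: eA; split=> // i j; rewrite [i]ord1; exact: wv.
apply/nbhs_ballP; exists e => //= v [_ wv]; apply: eA => i; exact: wv.
Qed.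

Definition convex C :=
  forall x y (t : R), C x -> C y -> 0 <= t <= 1 -> C (t *: x + (1 - t) *: y).

(** The base point [c0] takes the missing mass, so the other weights can be perturbed independently;
    [relative_interior_convex] exploits this. *)
Lemma convex_sum C (n : nat) (c0 : 'rV[R]_m) (c : 'I_n -> 'rV[R]_m) (l : 'I_n -> R) :
  convex C -> C c0 -> (forall i, C (c i)) -> (forall i, 0 <= l i) ->
  \sum_i l i <= 1 -> C (c0 + \sum_i l i *: (c i - c0)).
Proof.
move=> cC Cc0; elim: n c l => [|n IH] c l Cc l0 l1; first by rewrite big_ord0 addr0.
rewrite big_ord_recr/=; set t := l ord_max.
have s0 : 0 <= \sum_(i < n) l (widen_ord (leqnSn n) i) by apply: sumr_ge0.
move: (l1); rewrite big_ord_recr/= -/t => st1.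
have t0 : 0 <= t := l0 ord_max.
have [t1|tn1] := eqVneq t 1.
  have lz i : l (widen_ord (leqnSn n) i) = 0.
    apply/eqP; rewrite eq_le l0 andbT.
    have : l (widen_ord (leqnSn n) i) <= \sum_(i < n) l (widen_ord (leqnSn n) i).
      by rewrite (bigD1 i)//= lerDl sumr_ge0.
    lra.
  rewrite big1 ?add0r ?t1 ?scale1r; last by move=> i _; rewrite lz scale0r.
  by rewrite addrC subrK.
have tlt1 : t < 1 by rewrite lt_neqAle tn1; lra.
have u0 : 0 < 1 - t by lra.
have := IH (fun i => c (widen_ord (leqnSn n) i))
   (fun i => l (widen_ord (leqnSn n) i) / (1 - t)).
move=> /(_ (fun=> Cc _) (fun=> divr_ge0 (l0 _) (ltW u0))) h.
have Cz : C (c0 + \sum_(i < n) (l (widen_ord (leqnSn n) i) / (1 - t)) *: (c (widen_ord (leqnSn n) i) - c0)).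
  by apply: h; rewrite -mulr_suml ler_pdivrMr// mul1r; lra.
have -> : c0 + (\sum_(i < n) l (widen_ord (leqnSn n) i) *: (c (widen_ord (leqnSn n) i) - c0) +
    t *: (c ord_max - c0)) = t *: c ord_max + (1 - t) *:
   (c0 + \sum_(i < n) (l (widen_ord (leqnSn n) i) / (1 - t)) *: (c (widen_ord (leqnSn n) i) - c0)).
  rewrite [in RHS]scalerDr scaler_sumr.
  under [in RHS]eq_bigr do rewrite scalerA mulrC divfK ?gt_eqF//.
  set S := \sum_(i < n) _; apply/rowP => i; rewrite !mxE; ring.
by apply: cC => //; rewrite t0 ltW.
Qed.

Lemma convex_combinations_sub C K : convex C -> K `<=` C -> convex_combinations K `<=` C.
Proof.
move=> cC KC w [[|k] [v [c [Kv c0 c1 ->]]]].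
  by move: c1; rewrite big_ord0 => /eqP; rewrite eq_sym oner_eq0.
have -> : \sum_i c i *: v i = v ord0 + \sum_i c i *: (v i - v ord0).
  under [in RHS]eq_bigr do rewrite scalerBr.
  by rewrite sumrB -scaler_suml c1 scale1r addrC subrK.
apply: convex_sum => //; [exact: KC|by move=> i; exact: KC|by rewrite c1].
Qed.

Definition dotp x y : R := \sum_i x ord0 i * y ord0 i.

Lemma dotp_ge0 x : 0 <= dotp x x.
Proof. by apply: sumr_ge0 => i _; rewrite -expr2 sqr_ge0. Qed.

Lemma dotpB x y z : dotp x (y - z) = dotp x y - dotp x z.
Proof. by rewrite /dotp -sumrB; apply: eq_bigr => i _; rewrite !mxE; ring. Qed.

(** [C] need not be closed, so a near-minimizer [c0] of the squared distance to [v] replaces the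
    nearest point, and [v - c0] is the normal. Comparing [c0] with points of the segment towards [c]
    bounds [<v - c0, c - c0>] by [D / 4], while [|v - c0|^2 >= D]. *)
Lemma separation C v (M e : R) : convex C -> C !=set0 -> 0 < e ->
  (forall c, C c -> dotp (v - c) (v - c) <= M) ->
  (forall c, C c -> e <= dotp (v - c) (v - c)) ->
  exists a (d : R), 0 < d /\ forall c, C c -> dotp a c + d <= dotp a v.
Proof.
move=> cC [c1 Cc1] e0 CM Ce.
pose A := [set dotp (v - c) (v - c) | c in C].
have infA : has_inf A by split; [exists (dotp (v - c1) (v - c1)), c1|exists e => _ [c /Ce + <-]].
pose D := inf A.
have De : e <= D by apply: lb_le_inf infA.1 _ => _ [c /Ce + <-].
have D0 : 0 < D by lra.
have M0 : 0 <= M by apply: le_trans (CM _ Cc1); exact: dotp_ge0.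
(* Expanding the square, for c in C and 0 < t <= 1,
   2 <v - c0, c - c0> <= eta / t + t |c - c0|^2. *)
pose B := 4 * M + 1.
have B0 : 0 < B by rewrite /B; lra.
pose t := Num.min 1 (D / (4 * B)).
have t0 : 0 < t by rewrite /t lt_min ltr01/= divr_gt0//; lra.
have t1 : t <= 1 by rewrite /t ge_min lexx.
have tB : t * B <= D / 4.
  have : t <= D / (4 * B) by rewrite /t ge_min lexx orbT.
  rewrite ler_pdivlMr; last lra.
  lra.
(* Makes [eta / t] equal to [D / 4]; [t] was chosen so that the quadratic term is at most [D / 4]
   too. *)
pose eta := t * D / 4.
have eta0 : 0 < eta by rewrite /eta divr_gt0// mulr_gt0.
have [_ [c0 Cc0 <-] hc0] := inf_adherent eta0 infA.
exists (v - c0), (D / 2); split; first lra.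
move=> c Cc.
have hD : D <= dotp (v - (t *: c + (1 - t) *: c0)) (v - (t *: c + (1 - t) *: c0)).
  apply: (ge_inf infA.2); exists (t *: c + (1 - t) *: c0) => //.
  by apply: cC => //; rewrite ltW.
set s := dotp (v - c0) (c - c0); set r := dotp (c - c0) (c - c0).
have exp1 : dotp (v - (t *: c + (1 - t) *: c0)) (v - (t *: c + (1 - t) *: c0)) =
    dotp (v - c0) (v - c0) - 2 * t * s + t ^+ 2 * r.
  rewrite /s /r /dotp !mulr_sumr -sumrB -big_split/=; apply: eq_bigr => i _.
  by rewrite !mxE; ring.
have rB : r <= 4 * M.
  apply: (@le_trans _ _ (\sum_i (2 * ((v - c0) ord0 i * (v - c0) ord0 i) + 2 * ((v - c) ord0 i * (v - c) ord0 i)))).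
    apply: ler_sum => i _; rewrite !mxE.
    have := sqr_ge0 ((v ord0 i - c ord0 i) + (v ord0 i - c0 ord0 i)); rewrite expr2; lra.
  rewrite big_split/= -!mulr_sumr.
  by have := CM _ Cc; have := CM _ Cc0; rewrite /dotp; lra.
have key : 2 * s <= D / 4 + t * r.
  rewrite -(ler_pM2l t0); move: hD; rewrite exp1; move: hc0; rewrite -/D /eta expr2; lra.
have tr : t * r <= D / 4.
  by apply: le_trans tB; rewrite ler_pM2l// /B; lra.
have sD : s <= D / 4 by lra.
have Dc0 : D <= dotp (v - c0) (v - c0) by apply: (ge_inf infA.2); exists c0.
move: sD Dc0; rewrite /s !dotpB; lra.
Qed.

Lemma affine_hull_sub K : K `<=` affine_hull K.
Proof. by move=> x Kx A [_]; exact. Qed.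

Lemma affine_hull_affine K : affine_subspace (affine_hull K).
Proof. by move=> x y t Kx Ky A AK; case: (AK) => aA _; apply: aA; [exact: Kx|exact: Ky]. Qed.

Lemma relative_interior_sub K : relative_interior K `<=` K.
Proof.
by move=> w [aw]; rewrite /within /= => /nbhs_singleton; apply.
Qed.

(** The new point is on the line through [b] and [w], hence in the affine hull, where coefficients
    outside [[0, 1]] are allowed; a short extension stays in the neighbourhood of [w] on which the
    hull lies in [K]. *)
Lemma relative_interior_extend K w b : relative_interior K w -> K b ->
  exists2 d : R, 0 < d & K (w + d *: (w - b)).
Proof.
move=> [aw nw] Kb; have /nbhs_rVP[e e0 eK] : nbhs w [set v | affine_hull K v -> K v] by exact: nw.
pose N := 1 + \sum_i `|(w - b) ord0 i|.
have N0 : 0 < N by rewrite /N ltr_pwDl// sumr_ge0.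
exists (e / N); first by rewrite divr_gt0.
apply: eK; last first.
  have -> : w + (e / N) *: (w - b) = (1 + e / N) *: w + (1 - (1 + e / N)) *: b.
    by apply/rowP => i; rewrite !mxE; ring.
  by apply: affine_hull_affine => //; exact: affine_hull_sub.
move=> i; rewrite [(w + _) ord0 i]mxE opprD addrA subrr sub0r normrN mxE normrM.
rewrite gtr0_norm ?divr_gt0// mulrAC ltr_pdivrMr// ltr_pM2l//.
by rewrite /N (bigD1 i)//= addrCA ltrDl ltr_pwDl// sumr_ge0.
Qed.

(** Lines through an interior point [b] contain other points of [K] in every direction, so the
    affine hull is the whole space. *)
Lemma interior_relative_interior K : K° !=set0 -> relative_interior K = K°.
Proof.
move=> [b /nbhs_rVP[e e0 eK]].
have aT : affine_hull K = setT.
  apply/seteqP; split=> // y _.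
  pose N := 1 + \sum_i `|(y - b) ord0 i|.
  have N0 : 0 < N by rewrite /N ltr_pwDl// sumr_ge0.
  pose t := e / N; have t0 : 0 < t by rewrite divr_gt0.
  have Kb : K b by apply: eK => i; rewrite subrr normr0.
  have Kz : K (b + t *: (y - b)).
    apply: eK => i; rewrite [(b + _) ord0 i]mxE opprD addrA subrr sub0r normrN mxE normrM.
    rewrite gtr0_norm// /t mulrAC ltr_pdivrMr// ltr_pM2l//.
    by rewrite /N (bigD1 i)//= addrCA ltrDl ltr_pwDl// sumr_ge0.
  have -> : y = t^-1 *: (b + t *: (y - b)) + (1 - t^-1) *: b.
    rewrite scalerDr scalerA mulVf ?gt_eqF// scale1r.
    by apply/rowP => i; rewrite !mxE; ring.
  by apply: affine_hull_affine; exact: affine_hull_sub.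
apply/seteqP; split=> w; rewrite /relative_interior /interior/= aT.
  by move=> [_ h]; have : nbhs w [set v | setT v -> K v] := h; apply: filterS => v; exact.
move=> h; split=> //; suff : nbhs w [set v | setT v -> K v] by [].
exact: (@filterS _ (nbhs w) _ _ _ (fun v Kv _ => Kv) h).
Qed.

(* C has a relative interior point b, and w lies strictly between b and some
   w' in K; moving w' to a nearby point of C moves b within C. *)
Lemma relative_interior_convex C K w : convex C -> C `<=` K ->
  (forall v, K v -> forall e : R, 0 < e -> exists2 c, C c & near_rV e v c) ->
  relative_interior K w -> C w.
Proof.
move=> cC CK KC riw; have Kw := relative_interior_sub riw.
have [c0 Cc0 _] := KC w Kw 1 ltr01.
(* A family of directions from [c0] into [C] with maximal rank spans all such directions, since one
   more row cannot raise the rank. *)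
pose dirs r (D : 'M[R]_(r, m)) := forall i, C (c0 + row i D).
pose Q n := `[< exists r (D : 'M[R]_(r, m)), dirs r D /\ \rank D = n >].
have exQ : exists n, Q n.
  exists 0%N; apply/asboolP; exists 0%N, 0; split; first by case.
  by rewrite mxrank0.
have bndQ n : Q n -> (n <= m)%N by move=> /asboolP[r [D [_ <-]]]; exact: rank_leq_col.
case: (ex_maxnP exQ bndQ) => n /asboolP[r [D [dD rkD]]] maxn.
have CD c : C c -> (c - c0 <= D)%MS.
  move=> Cc; pose D' := col_mx D (c - c0).
  have dD' : dirs _ D'.
    move=> i; case: (splitP i) => j ij.
      have -> : i = lshift 1 j by exact: val_inj.
      by rewrite rowKu; exact: dD.
    have -> : i = rshift r j by exact: val_inj.
    by rewrite rowKd row_id addrC subrK.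
  have rk : (\rank D' <= \rank D)%N.
    by rewrite rkD; apply: maxn; apply/asboolP; exists (r + 1)%N, D'.
  have sDD' : (D <= D')%MS by rewrite -addsmxE addsmxSl.
  have : (D' <= D)%MS by rewrite -(geq_leqif (mxrank_leqif_sup sDD')).
  by apply: submx_trans; rewrite -addsmxE addsmxSr.
(* A row space is closed, being the kernel of [cokermx D], and [v] is approximated by points of
   [C]. *)
have KD v : K v -> (v - c0 <= D)%MS.
  move=> Kv; rewrite submxE; apply/eqP/rowP => i; rewrite [RHS]mxE; apply/eqP.
  pose u := cokermx D; pose N := 1 + \sum_j `|u j i|.
  have N0 : 0 < N by rewrite /N ltr_pwDl// sumr_ge0.
  rewrite -normr_eq0 eq_le normr_ge0 andbT; apply/ler_addgt0Pr => e e0; rewrite add0r.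
  have [c Cc cv] := KC v Kv (e / N) (divr_gt0 e0 N0).
  have := CD c Cc; rewrite submxE => /eqP/rowP/(_ i) cu.
  have -> : ((v - c0) *m cokermx D) ord0 i = \sum_j (v - c) ord0 j * u j i.
    have -> : v - c0 = (v - c) + (c - c0) by rewrite addrA subrK.
    by rewrite mulmxDl [LHS]mxE cu [X in _ + X]mxE addr0 mxE.
  rewrite (le_trans (ler_norm_sum _ _ _))//.
  apply: (@le_trans _ _ (\sum_j e / N * `|u j i|)).
    apply: ler_sum => j _; rewrite normrM ler_wpM2r//.
    by have := cv j; rewrite !mxE => /ltW.
  by rewrite -mulr_sumr mulrAC ler_pdivrMr// ler_pM2l// /N; lra.
(* The common weight of the barycentre [b] of [c0] and the [r] points [c0 + row i D]. *)
pose k : R := r.+1%:R^-1.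
have rR : (0 : R) < r.+1%:R by rewrite ltr0n.
have k0 : 0 < k by rewrite invr_gt0.
(* A small [y] in the row space has coefficients of size at most [k^2] on the rows. The perturbed
   weights stay nonnegative because [k^2 <= k], and their sum is at most [r (k + k^2) = 1 - k^2]. *)
have [s s0 ball] : exists2 s : R, 0 < s & forall y, (y <= D)%MS -> (forall i, `|y ord0 i| <= s) ->
    C (c0 + \sum_i k *: row i D + y).
  pose V := pinvmx D; pose N := 1 + \sum_i \sum_j `|V i j|.
  have N0 : 0 < N by rewrite /N ltr_pwDl// sumr_ge0// => i _; rewrite sumr_ge0.
  exists (k ^+ 2 / N); first by rewrite divr_gt0// exprn_gt0.
  move=> y yD ys; pose l := y *m V.
  have yE : y = \sum_i l ord0 i *: row i D by rewrite -mulmx_sum_row mulmxKpV.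
  have lk i : `|l ord0 i| <= k ^+ 2.
    rewrite mxE (le_trans (ler_norm_sum _ _ _))//.
    apply: (@le_trans _ _ (\sum_j k ^+ 2 / N * `|V j i|)).
      by apply: ler_sum => j _; rewrite normrM ler_wpM2r.
    rewrite -mulr_sumr mulrAC ler_pdivrMr// ler_pM2l ?exprn_gt0//.
    apply: (@le_trans _ _ (\sum_i \sum_j `|V i j|)); last by rewrite /N; lra.
    by apply: ler_sum => j _; rewrite (bigD1 i)//= lerDl sumr_ge0.
  have -> : c0 + \sum_i k *: row i D + y = c0 + \sum_i (k + l ord0 i) *: ((c0 + row i D) - c0).
    rewrite {1}yE -addrA -big_split/=; congr (_ + _); apply: eq_bigr => i _.
    by rewrite -scalerDl addrAC subrr add0r.
  have kk : k ^+ 2 <= k.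
    by rewrite expr2 ler_piMr ?(ltW k0)// invf_le1// ler1n.
  apply: convex_sum => // [i|]; first by have := lk i; rewrite ler_norml => /andP[]; lra.
  apply: (@le_trans _ _ (\sum_(i < r) (k + k ^+ 2))).
    by apply: ler_sum => i _; have := lk i; rewrite ler_norml => /andP[]; lra.
  rewrite sumr_const card_ord -[leLHS]mulr_natl.
  have -> : (r%:R : R) = k^-1 - 1 by rewrite /k invrK -natr1 addrK.
  have kn0 : k != 0 by rewrite gt_eqF.
  have -> : (k^-1 - 1) * (k + k ^+ 2) = 1 - k ^+ 2 by field.
  by rewrite gerBl sqr_ge0.
set b := c0 + \sum_i k *: row i D in ball.
have Cb : C b by rewrite -[b]addr0; apply: ball => [|i]; rewrite ?sub0mx// mxE normr0 ltW.
have [d d0 Kw'] := relative_interior_extend riw (CK _ Cb).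
set w' := w + d *: (w - b) in Kw'.
have [c Cc cw'] := KC w' Kw' (d * s) (mulr_gt0 d0 s0).
(* Compensates at [b] for replacing [w'] by [c], so that [w] is exactly [(c + d b') / (1 + d)]; the
   factor [d^-1] explains the tolerance [d * s]. *)
pose b' := b + d^-1 *: (w' - c).
have Cb' : C b'.
  apply: ball => [|i].
    rewrite scalemx_sub// (_ : w' - c = (w' - c0) - (c - c0)); last by rewrite opprB addrA subrK.
    by rewrite addmx_sub ?KD// -scaleN1r scalemx_sub// CD.
  rewrite mxE normrM gtr0_norm ?invr_gt0// ler_pdivrMl//.
  by have := cw' i; rewrite !mxE => /ltW.
have d1 : 1 + d != 0 by rewrite gt_eqF// ltr_pwDl// ltW.
have -> : w = (1 + d)^-1 *: c + (1 - (1 + d)^-1) *: b'.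
  have dn0 : d != 0 by rewrite gt_eqF.
  by apply/rowP => i; rewrite /b' /w' !mxE; field; rewrite d1 dn0.
apply: cC => //; rewrite invr_ge0 invf_le1 ?ltr_pwDl ?(ltW d0)//; lra.
Qed.

End ConvexGeometry.

(** * Rotation sets *)

Section RotationSet.
Variables (R : realType) (X : pmetricType R) (f : X -> X).
Hypotheses (Xc : compact [set: X]) (fc : continuous f).
Variables (m : nat) (Phi : X -> 'rV[R]_m).
Hypothesis Phic : forall i, continuous (fun x => Phi x ord0 i).

Let rv := rotation_vector Phi.
Let Rot := rotation_set f Phi.

Definition zero_entropy_vectors : set 'rV[R]_m :=
  [set w | exists2 mu, rotation_class f Phi w mu & entropy f mu = 0%E].

Lemma convex_zero_entropy : convex zero_entropy_vectors.
Proof.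
move=> x y t [mu [fmu rmu] hmu] [nu [fnu rnu] hnu] /andP[t0 t1].
have [->|tn0] := eqVneq t 0; first by exists nu => //; rewrite scale0r add0r subr0 scale1r.
have [->|tn1] := eqVneq t 1; first by exists mu => //; rewrite scale1r subrr scale0r addr0.
have t01 : 0 < t < 1 by rewrite !lt_neqAle eq_sym tn0 t0 tn1.
have t01' : 0 <= t <= 1 by rewrite t0.
have [P HP] := mix_exists mu nu t01'.
exists P; last by rewrite (entropy_mix fc t01 HP)// hmu hnu !mule0 adde0.
split; first exact: mix_invariant HP fmu fnu.
by rewrite (rv_mix Xc Phic t01' HP) rmu rnu.
Qed.

Lemma zero_entropy_sub : zero_entropy_vectors `<=` Rot.
Proof. by move=> w [mu [fmu rmu] _]; exists mu. Qed.

Lemma periodic_zero_entropy mu : periodic_measures f mu -> entropy f mu = 0%E.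
Proof. by move=> [fmu [x [px ox _]]]; exact: entropy_eq0 px ox. Qed.

Lemma int_dotp (a : 'rV[R]_m) (mu : probability (borel X) R) :
  continuous (fun x => dotp a (Phi x)) /\ \int[mu]_x dotp a (Phi x) = dotp a (rv mu).
Proof.
rewrite /dotp.
suff [c1 c2] : continuous (fun x => \sum_(i <- index_enum 'I_m) a ord0 i * Phi x ord0 i) /\
    \int[mu]_x (\sum_(i <- index_enum 'I_m) a ord0 i * Phi x ord0 i) =
    \sum_(i <- index_enum 'I_m) a ord0 i * \int[mu]_x Phi x ord0 i.
  by split=> //; rewrite c2; apply: eq_bigr => i _; rewrite mxE.
elim: (index_enum 'I_m) => [|i r [IH1 IH2]].
  under eq_fun do rewrite big_nil; split; first by move=> x; exact: cvg_cst.
  by rewrite big_nil int_cst.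
have c0 : continuous (fun x => a ord0 i * Phi x ord0 i).
  by move=> x; apply: cvgM; [exact: cvg_cst|exact: Phic].
split.
  under eq_fun do rewrite big_cons.
  by move=> x; apply: cvgD; [exact: c0|exact: IH1].
under eq_Rintegral do rewrite big_cons.
rewrite (intD Xc)//.
by rewrite big_cons IH2 (intZ Xc)//; exact: Phic.
Qed.

(** If no zero-entropy vector were near [v], some [a] would strictly separate [v] from all of them.
    But the integral of [dotp a (Phi x)] is maximized at an ergodic measure, which periodic measures
    approximate, and these have zero entropy. *)
Lemma zero_entropy_dense (phi : nat -> continuousType X R) : dense_sequence phi ->
  ergodic_measures f `<=` closure (periodic_measures f) ->
  forall v, Rot v -> forall e : R, 0 < e ->
    exists2 c, zero_entropy_vectors c & near_rV e v c.
Proof.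
move=> phid dense v Rv e e0; apply: contrapT => /forall2NP H.
have [nu fnu rnu] := Rv.
have M0 : invariant_measures f !=set0 by exists nu.
have per (g : X -> R) (d : R) : continuous g -> 0 < d ->
    exists2 mu, periodic_measures f mu & \int[nu]_x g x < \int[mu]_x g x + d.
  move=> gc d0; have [mu emu maxmu] := ergodic_max Xc fc phid gc M0.
  have [rho prho] := weak_closure (dense _ emu) gc d0.
  rewrite ltr_norml => /andP[h1 h2]; exists rho => //.
  by have := maxmu _ fnu; lra.
have perZ mu : periodic_measures f mu -> zero_entropy_vectors (rv mu).
  by move=> pmu; exists mu; [split=> //; case: pmu|exact: periodic_zero_entropy].
have bnd i := cid (continuous_bounded Xc (@Phic i)).
pose B i := sval (bnd i).
have HB i x : `|Phi x ord0 i| <= B i by rewrite /B; case: (bnd i).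
have rvB mu i : `|rv mu ord0 i| <= B i.
  by rewrite mxE; apply: int_norm_le => //; exact: Phic.
(* Coordinates of rotation vectors are bounded by [B i], so two of them differ by at most
   [2 * B i]. *)
have [] := @separation R m zero_entropy_vectors v (\sum_i (2 * B i) ^+ 2) (e ^+ 2).
- exact: convex_zero_entropy.
- have [|mu pmu _] := per (fun=> 0) 1 _ ltr01; first by move=> x; exact: cvg_cst.
  by exists (rv mu); exact: perZ.
- by rewrite exprn_gt0.
- move=> c [mu [_ rmu] _]; apply: ler_sum => i _.
  rewrite -expr2 -[leLHS]real_normK ?num_real// ler_sqr ?nnegrE ?mulr_ge0//.
    rewrite -rnu -rmu mxE [X in _ + X]mxE (le_trans (ler_normB _ _))//.
    by have := rvB nu i; have := rvB mu i; rewrite /rv; lra.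
  by apply: le_trans (rvB nu i).
- move=> c Zc; case: (H c) => [//|/existsNP[i /negP]]; rewrite -leNgt => hi.
  rewrite /dotp (bigD1 i)//= -expr2; apply: ler_wpDr.
    by apply: sumr_ge0 => j _; rewrite -expr2 sqr_ge0.
  rewrite -[leRHS]real_normK ?num_real// ler_sqr ?nnegrE ?(ltW e0)//.
  by rewrite !mxE.
- move=> a [d [d0 sep]].
  have [cpsi inu] := int_dotp a nu.
  have [mu pmu] := per _ d cpsi d0.
  have [_ ->] := int_dotp a mu; rewrite inu /rv rnu => lt.
  by have := sep _ (perZ _ pmu); rewrite /rv; lra.
Qed.

Lemma localized_entropy_gt0 (w : 'rV[R]_m) mu : relative_interior Rot w ->
  invariant_measures f mu -> (0 < entropy f mu)%E -> (0 < localized_entropy f Phi w)%E.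
Proof.
move=> riw fmu hmu.
have Rmu : Rot (rv mu) by exists mu.
have [d d0 [nu fnu rnu]] := relative_interior_extend riw Rmu.
have d1 : 1 + d != 0 by rewrite gt_eqF// ltr_pwDl// ltW.
(* Solves [w = t rv(mu) + (1 - t) (w + d (w - rv(mu)))]. *)
pose t := d / (1 + d).
have t01 : 0 < t < 1.
  have p : 0 < 1 + d by lra.
  by apply/andP; split; [rewrite divr_gt0|rewrite /t ltr_pdivrMr// mul1r; lra].
have t01' : 0 <= t <= 1 by have /andP[/ltW -> /ltW ->] := t01.
have [P HP] := mix_exists mu nu t01'.
have CP : rotation_class f Phi w P.
  split; first exact: mix_invariant HP fmu fnu.
  rewrite (rv_mix Xc Phic t01' HP) rnu /rv /t.
  by apply/rowP => i; rewrite !mxE; field.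
apply: (@lt_le_trans _ _ (entropy f P)); last by apply: ereal_sup_ubound; exists P.
rewrite (entropy_mix fc t01 HP)//.
apply: (@lt_le_trans _ _ (t%:E * entropy f mu)%E).
  by rewrite mule_gt0// lte_fin; have /andP[] := t01.
by rewrite leeDl// mule_ge0 ?entropy_ge0// lee_fin subr_ge0; have /andP[] := t01'.
Qed.

End RotationSet.

Local Open Scope ereal_scope.

Theorem theorem1p1 (R : realType) (X : pmetricType R) (f : X -> X) (m : nat)
    (Xcompact : compact [set: X]) (fcont : continuous f)
    (htop_gt0 : 0 < topological_entropy f)
    (husc : upper_semicontinuous_on (invariant_measures f) (entropy f))
    (m_ge1 : (1 <= m)%N) :
  (forall phi : nat -> continuousType X R,
     dense_sequence phi ->
     let Phi : X -> 'rV[R]_m := fun x => (\row_(i < m) phi i x)%R in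
     ergodic_measures f `<=` closure (periodic_measures f) \/ good f Phi ->
     ((rotation_set f Phi)° !=set0 ->
        relative_interior (rotation_set f Phi) = (rotation_set f Phi)°) /\
     (forall w : 'rV[R]_m, relative_interior (rotation_set f Phi) w ->
        0 < localized_entropy f Phi w /\
        entropy_spectrum f Phi w = `[0, localized_entropy f Phi w]%classic)) /\
  (forall Phi : X -> 'rV[R]_m, continuous Phi ->
     forall w : 'rV[R]_m, rotation_set f Phi w ->
     ~ relative_interior (rotation_set f Phi) w ->
     [\/ entropy_spectrum f Phi w = [set localized_entropy f Phi w],
         exists2 x : \bar R, 0 < x < localized_entropy f Phi w &
           entropy_spectrum f Phi w = `[x, localized_entropy f Phi w]%classic,
         entropy_spectrum f Phi w = `[0, localized_entropy f Phi w]%classic |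
         exists2 x : \bar R, 0 <= x < localized_entropy f Phi w &
           entropy_spectrum f Phi w = `]x, localized_entropy f Phi w]%classic]).
Proof.
split=> [phi phid Phi hyp|Phi Phic w Rw _]; last first.
  apply: spectrum_cases => // i.
  move=> x; apply: (@continuous_comp _ _ _ Phi (fun v : 'rV[R]_m => v ord0 i) x).
    exact: Phic.
  exact: coord_continuous.
split=> [|w riw]; first exact: interior_relative_interior.
have Phic i : continuous (fun x => Phi x ord0 i).
  have -> : (fun x => Phi x ord0 i) = phi i by apply/funext => x; rewrite /Phi mxE.
  exact: cts_fun.
have [mu fmu hmu] := positive_entropy_measure Xcompact fcont htop_gt0.
have Hw := localized_entropy_gt0 Xcompact fcont Phic riw fmu hmu.
split=> //.
have Rw := relative_interior_sub riw.
have cZ := convex_zero_entropy Xcompact fcont Phic.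
(* Under density, zero-entropy vectors are dense in the rotation set and convexity fills its
   relative interior; for a good potential, [w] is a convex combination of periodic vectors. *)
have [nu Cnu hnu] : zero_entropy_vectors f Phi w.
  case: hyp => [dense|gd].
    apply: (relative_interior_convex cZ) riw; first exact: zero_entropy_sub.
    exact: zero_entropy_dense phid dense.
  apply: (convex_combinations_sub cZ _ (gd _ riw)) => v [_ [rho Crho prho]].
  by exists rho => //; exact: periodic_zero_entropy.
have S0 : entropy_spectrum f Phi w 0 by exists nu.
apply/seteqP; split=> y /=; rewrite in_itv/=.
  exact: spectrum_le.
exact: spectrum_interval.
Qed.
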